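(* Let $(M,g)$ and $(M,g')$ be space-times (on the same manifold $M$) with Levi-Civita connections $\nabla$ and $\nabla'$ respectively, with $(M,g)$ non-flat and of holonomy type $R_{10}$, $R_{11}$ or $R_{13}$, and with the curvature tensor $\mathrm{Riem}$ of $(M,g)$ of curvature class $\mathbf{C}$ at each point of an open, dense subset $U$ of $M$. Suppose that $\nabla$ and $\nabla'$ are projectively related. Then $\nabla=\nabla'$ on $M$.
   Context: A space-time $(M,g)$ is a 4-dimensional, Hausdorff, connected, smooth manifold $M$ with a smooth metric $g$ of Lorentz signature $(-,+,+,+)$. It is non-flat if its curvature tensor $\mathrm{Riem}$ does not vanish identically on any non-empty open subset of $M$. Projectively related: $\nabla$ and $\nabla'$ (or $g$ and $g'$) are projectively related if their sets of unparametrised geodesics (geodesic paths) coincide; equivalently there is a global smooth 1-form $\psi$ on $M$ with $\Gamma'^a_{bc}-\Gamma^a_{bc}=\delta^a_b\psi_c+\delta^a_c\psi_b$ in every coordinate domain. Bivectors: for $m\in M$ and $p,q\in T_mM$, $p\wedge q$ denotes the bivector $F^{ab}=p^aq^b-q^ap^b$, identified (using $g(m)$) with the skew-self-adjoint endomorphism $F^a{}_b=F^{ac}g_{cb}$ of $T_mM$. Bivectors of this form (non-zero) are called simple. A null tetrad at $m$ is a basis $l,n,x,y$ of $T_mM$ whose only non-vanishing inner products are $g(l,n)=g(x,x)=g(y,y)=1$; an orthonormal tetrad is a basis $u,x,y,z$ whose only non-vanishing inner products are $-g(u,u)=g(x,x)=g(y,y)=g(z,z)=1$. Holonomy type: let $\phi$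 be the Lie algebra of the holonomy group of $\nabla$ at a point $m\in M$, regarded as a Lie algebra of skew-self-adjoint endomorphisms (bivectors) of $T_mM$. $(M,g)$ is of holonomy type: $R_{10}$ if $\phi$ is the 3-dimensional algebra spanned by $l\wedge n,\ l\wedge x,\ n\wedge x$ for some null tetrad $l,n,x,y$ at $m$; $R_{11}$ if $\phi$ is spanned by $l\wedge x,\ l\wedge y,\ x\wedge y$ for some null tetrad $l,n,x,y$ at $m$; $R_{13}$ if $\phi$ is spanned by $x\wedge y,\ y\wedge z,\ x\wedge z$ for some orthonormal tetrad $u,x,y,z$ at $m$. (The type does not depend on the choice of $m$.) Curvature class $\mathbf{C}$: let $B_m$ be the range of the linear map $F^{ab}\mapsto R^{ab}{}_{cd}F^{cd}$ on bivectors at $m$. The curvature class at $m$ is $\mathbf{C}$ if $\dim B_m\in\{2,3\}$ and $B_m$ is spanned by (two or three) independent simple bivectors for which there is a common $0\ne r\in T_mM$ with $F_{ab}r^b=0$ for each of them (such $r$ is then unique up to scaling). *)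

(* Defs.v *)
From HB Require Import structures.
From mathcomp Require Import all_boot all_order all_algebra.
From mathcomp Require Import all_classical all_reals all_analysis.

Set Implicit Arguments.
Unset Strict Implicit.
Unset Printing Implicit Defensive.

Import Order.TTheory GRing.Theory Num.Theory.
Import numFieldNormedType.Exports.

Local Open Scope classical_set_scope.
Local Open Scope ring_scope.

(* Points of R^4 and tangent vectors (in components with respect to a chart)
   are column vectors, so that linear maps with components A^a_b act by *m. *)

Section Smoothness.
Context {R : realType} {V W : normedModType R}.

(* Meant for open U: only the germ of f along U matters then. *)
Fixpoint Ck (k : nat) (U : set V) (f : V -> W) : Prop :=
  (forall x, U x -> {for x, continuous f}) /\
  if k is k'.+1 then
    forall v, (forall x, U x -> derivable f x v) /\ Ck k' U (fun x => 'D_v f x)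
  else True.

Definition smooth_on (U : set V) (f : V -> W) : Prop := forall k, Ck k U f.

End Smoothness.

Record atlas (R : realType) (M : topologicalType) := Atlas {
  chart : Type;
  cdom : chart -> set M;
  cmap : chart -> M -> 'cV[R]_4;
  cinv : chart -> 'cV[R]_4 -> M;
  cdom_open : forall i, open (cdom i);
  cdom_cover : forall p, exists i, cdom i p;
  cimg_open : forall i, open (cmap i @` cdom i);
  cmapK : forall i p, cdom i p -> cinv i (cmap i p) = p;
  cmap_continuous : forall i p, cdom i p -> {for p, continuous (cmap i)};
  cinv_continuous : forall i x, (cmap i @` cdom i) x ->
    {for x, continuous (cinv i)};
  transition_smooth : forall i j,
    smooth_on (cmap i @` (cdom i `&` cdom j)) (fun x => cmap j (cinv i x))
}.

Section Geometry.
Context {R : realType} {M : topologicalType} (A : atlas R M).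
Implicit Types (i j : chart A) (p : M) (x : 'cV[R]_4).

Definition cimg i : set 'cV[R]_4 := cmap i @` cdom i.

Definition partial (a : 'I_4) (f : 'cV[R]_4 -> R) x : R :=
  'D_(delta_mx a 0) f x.

(* Entry (b, a) is dy^b/dx^a at p, for x the coordinates of i, y those of j. *)
Definition jac i j p : 'M[R]_4 :=
  \matrix_(b, a) partial a (fun x => cmap j (cinv i x) b 0) (cmap i p).

Definition is_tetrad (G eta e : 'M[R]_4) : Prop :=
  e \in unitmx /\ e^T *m G *m e = eta.

Definition lorentz_gram : 'M[R]_4 := diag_mx (\row_a if a == 0 then -1 else 1).

(* Gram matrix of l, n, x, y with g(l,n) = g(x,x) = g(y,y) = 1. *)
Definition null_gram : 'M[R]_4 :=
  \matrix_(a, b) (if (a < 2)%N then (a + b == 1)%N else a == b)%:R.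

(* The columns of e are the vectors of the tetrad, in the order u, x, y, z,
   respectively l, n, x, y. *)
Definition orthonormal_tetrad (G e : 'M[R]_4) := is_tetrad G lorentz_gram e.
Definition null_tetrad (G e : 'M[R]_4) := is_tetrad G null_gram e.

(* The components g_ab in each chart, as functions of the coordinates; values
   outside cimg i are irrelevant. *)
Record lorentz_metric := LorentzMetric {
  gcomp :> chart A -> 'cV[R]_4 -> 'M[R]_4;
  gcomp_smooth : forall i a b, smooth_on (cimg i) (fun x => gcomp i x a b);
  gcomp_sym : forall i x, cimg i x -> (gcomp i x)^T = gcomp i x;
  gcomp_signature : forall i x, cimg i x ->
    exists e, orthonormal_tetrad (gcomp i x) e;
  gcomp_tensor : forall i j p, cdom i p -> cdom j p ->
    gcomp i (cmap i p) =
    (jac i j p)^T *m gcomp j (cmap j p) *m jac i j p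
}.

(* G i x a b c stands for the connection coefficient Gamma^a_bc at the point
   with coordinates x in the chart i. *)
Definition connection_coefs : Type :=
  chart A -> 'cV[R]_4 -> 'I_4 -> 'I_4 -> 'I_4 -> R.

Definition levi_civita (g : lorentz_metric) : connection_coefs :=
  fun i x a b c =>
    2^-1 * \sum_d invmx (g i x) a d *
      (partial b (fun y => g i y d c) x + partial c (fun y => g i y d b) x
       - partial d (fun y => g i y b c) x).

Definition same_connection (G G' : connection_coefs) : Prop :=
  forall i p, cdom i p -> forall a b c,
    G i (cmap i p) a b c = G' i (cmap i p) a b c.

(* riemann G i x a b c d is R^a_bcd. *)
Definition riemann (G : connection_coefs) i x (a b c d : 'I_4) : R :=
  partial c (fun y => G i y a d b) x - partial d (fun y => G i y a c b) x
  + \sum_e (G i x a c e * G i x e d b - G i x a d e * G i x e c b).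

Definition non_flat (g : lorentz_metric) : Prop :=
  forall O : set M, open O -> O !=set0 ->
    exists p i a b c d,
      [/\ O p, cdom i p & riemann (levi_civita g) i (cmap i p) a b c d != 0].

Definition smooth_curve (I : set R) (gam : R -> M) : Prop :=
  (forall t, I t -> {for t, continuous gam}) /\
  forall i, smooth_on (I `&` gam @^-1` cdom i) (fun t => cmap i (gam t)).

(* Affinely parametrised, non-constant geodesic on the open interval I. *)
Definition geodesic (G : connection_coefs) (I : set R) (gam : R -> M) : Prop :=
  smooth_curve I gam /\
  forall i t, I t -> cdom i (gam t) ->
    let x := fun s : R => cmap i (gam s) in
    derive1 x t != 0 /\
    forall a, derive1n 2 x t a 0 +
      \sum_b \sum_c G i (x t) a b c * derive1 x t b 0 * derive1 x t c 0 = 0.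

(* Some regular reparametrisation of gam : I -> M is an affinely parametrised
   geodesic; tau maps the interval I diffeomorphically onto tau @` I. *)
Definition geodesic_path (G : connection_coefs) (I : set R) (gam : R -> M) :
    Prop :=
  exists (tau : R -> R) (c : R -> M),
    [/\ smooth_on I tau, forall t, I t -> derive1 tau t != 0,
        geodesic G (tau @` I) c & forall t, I t -> gam t = c (tau t)].

Definition projectively_related (G G' : connection_coefs) : Prop :=
  forall (I : set R) (gam : R -> M), open I -> is_interval I ->
    geodesic_path G I gam <-> geodesic_path G' I gam.

(* V solves V'^a + Gamma^a_bc x'^b V^c = 0 on [0, 1] along the coordinate
   curve x. *)
Definition parallel_along (G : connection_coefs) i (x V : R -> 'cV[R]_4) :
    Prop :=
  forall t : R, 0 <= t <= 1 ->
    is_derive t (1 : R) V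
      (- \col_a \sum_b \sum_c G i (x t) a b c * derive1 x t b 0 * V t c 0).

(* transport G i p j q P: there is a piecewise smooth curve from p to q such
   that parallel transport along it is the linear map T_pM -> T_qM with matrix
   P with respect to the coordinate bases of i at p and of j at q. Every
   piecewise smooth curve is a finite concatenation of smooth curves each lying
   in one chart domain. *)
Inductive transport (G : connection_coefs) :
    chart A -> M -> chart A -> M -> 'M[R]_4 -> Prop :=
| transport_chart i j p : cdom i p -> cdom j p ->
    transport G i p j p (jac i j p)
| transport_curve i (x : R -> 'cV[R]_4) (P : 'M[R]_4) :
    smooth_on setT x ->
    (forall t, 0 <= t <= 1 -> cimg i (x t)) ->
    (forall v, exists V, [/\ parallel_along G i x V, V 0 = v & V 1 = P *m v]) ->
    transport G i (cinv i (x 0)) i (cinv i (x 1)) P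
| transport_comp i p j q k r (P Q : 'M[R]_4) :
    transport G i p j q P -> transport G j q k r Q ->
    transport G i p k r (Q *m P).

Definition holonomy_group (G : connection_coefs) i p : set 'M[R]_4 :=
  [set P | transport G i p i p P].

(* The Lie algebra of a Lie subgroup H of GL(4), as its tangent space at the
   identity: velocities at 0 of the C^1 curves lying in H. *)
Definition lie_algebra (H : set 'M[R]_4) : set 'M[R]_4 :=
  [set X | exists c : R -> 'M[R]_4,
     [/\ forall t, H (c t), c 0 = 1%:M, Ck 1 setT c & derive1 c 0 = X]].

Definition holonomy_algebra (g : lorentz_metric) i p : set 'M[R]_4 :=
  lie_algebra (holonomy_group (levi_civita g) i p).

(* The bivector F^ab = u^a v^b - v^a u^b. *)
Definition wedge (u v : 'cV[R]_4) : 'M[R]_4 := u *m v^T - v *m u^T.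

(* The endomorphism F^a_b = F^ac g_cb for F the wedge of columns a and b of the
   tetrad e. *)
Definition wedge_endo (G e : 'M[R]_4) (a b : 'I_4) : 'M[R]_4 :=
  wedge (col a e) (col b e) *m G.

Definition spans (B : set 'M[R]_4) (s : seq 'M[R]_4) : Prop :=
  forall X, B X <-> X \in span s.

Definition holonomy_R10 (g : lorentz_metric) : Prop :=
  exists m i e, let G := g i (cmap i m) in
    [/\ cdom i m, null_tetrad G e &
        spans (holonomy_algebra g i m)
          [:: wedge_endo G e 0 1; wedge_endo G e 0 2; wedge_endo G e 1 2]].

Definition holonomy_R11 (g : lorentz_metric) : Prop :=
  exists m i e, let G := g i (cmap i m) in
    [/\ cdom i m, null_tetrad G e &
        spans (holonomy_algebra g i m)
          [:: wedge_endo G e 0 2; wedge_endo G e 0 3; wedge_endo G e 2 3]].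

Definition holonomy_R13 (g : lorentz_metric) : Prop :=
  exists m i e, let G := g i (cmap i m) in
    [/\ cdom i m, orthonormal_tetrad G e &
        spans (holonomy_algebra g i m)
          [:: wedge_endo G e 1 2; wedge_endo G e 2 3; wedge_endo G e 1 3]].

Definition simple_bivector (F : 'M[R]_4) : Prop :=
  F != 0 /\ exists u v, F = wedge u v.

(* R^ab_cd = R^a_ecd g^eb. *)
Definition riemann_up (g : lorentz_metric) i x (a b c d : 'I_4) : R :=
  \sum_e riemann (levi_civita g) i x a e c d * invmx (g i x) e b.

Definition curvature_range (g : lorentz_metric) i x : set 'M[R]_4 :=
  [set B | exists F : 'M[R]_4, F^T = - F /\
     B = \matrix_(a, b) \sum_c \sum_d riemann_up g i x a b c d * F c d].

(* G *m F *m G has the components F_ab = g_ac F^cd g_db. *)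
Definition curvature_class_C (g : lorentz_metric) p : Prop :=
  forall i, cdom i p -> let G := g i (cmap i p) in
    exists s : seq 'M[R]_4,
      [/\ size s = 2 \/ size s = 3, free s,
          spans (curvature_range g i (cmap i p)) s,
          forall F, F \in s -> simple_bivector F &
          exists r : 'cV[R]_4, r != 0 /\
            forall F, F \in s -> G *m F *m G *m r = 0].

End Geometry.

(* Main.v *)
(* A geodesic of g becomes one of g' after reparametrisation; comparing their
   accelerations, the difference T of the connections satisfies T(v,v) = mu v for
   every v, and by polarisation T^a_bc = delta^a_b psi_c + delta^a_c psi_b.

   For the three holonomy types the holonomy algebra annihilates a nonzero vector w.
   Transport around small coordinate rectangles shows that the transport k of w to
   any point is annihilated by the curvature Riem of g. Riem and the curvature of g'
   are skew for g and g' and differ by terms in the Schouten-like tensor of psi;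
   contracting with k shows that this tensor is a multiple of g', hence Riem is
   also skew for g'. At a point of class C, the simple bivectors in the range of
   Riem then force g' = a g (as maps to covectors) on the hyperplane orthogonal
   to k. Differentiating this relation along the coordinate lines, where k can be
   taken parallel, gives an algebraic identity that forces psi = 0. Hence the
   connections agree on the dense set U, and everywhere by continuity. *)

(* Only the holonomy algebra is known to annihilate w; the holonomy group need not fix it, so
   transports of w along different paths may disagree and no parallel field on M is available.
   Pointwise facts are therefore stated for transport along an arbitrary path, and near a point that
   path is prolonged along one coordinate line. The factor a is not known to be differentiable. The
   relation on the hyperplane is differentiated in the form (g' z) ^ (g z) = 0, from which a has
   disappeared, with z moving inside the hyperplanes. The algebra is defined by velocities of C^1
   curves in the holonomy group. To place loops around rectangles on such a curve, transport along
   one side has to be C^1 in the length of the other; this is why linear differential equations are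
   solved with a parameter. *)
From HB Require Import structures.
Require Import Defs.
From mathcomp Require Import all_boot all_order all_algebra.
From mathcomp Require Import all_classical all_reals all_analysis.
From mathcomp Require Import ring lra.

Set Implicit Arguments.
Unset Strict Implicit.
Unset Printing Implicit Defensive.

Import Order.TTheory GRing.Theory Num.Theory.
Import numFieldNormedType.Exports.

Local Open Scope classical_set_scope.
Local Open Scope ring_scope.

(** * Matrix-valued derivatives *)

Section Calculus.
Context {R : realType}.

Lemma mx_norm_leP m n (A : 'M[R]_(m, n)) (c : R) : 0 <= c ->
  (forall i j, `|A i j| <= c) -> `|A| <= c.
Proof.
move=> c0 h; rewrite [leLHS]/Num.Def.normr/= mx_normrE.
by apply: bigmax_le => //= -[i j] _; exact: h.
Qed.

Lemma mx_norm_ge m n (A : 'M[R]_(m, n)) i j : `|A i j| <= `|A|.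
Proof.
rewrite [leRHS]/Num.Def.normr/= mx_normrE.
exact: (le_bigmax _ (fun ij => `|A ij.1 ij.2|) (i, j)).
Qed.

Lemma mx_norm_lt m n (A : 'M[R]_(m, n)) (c : R) : 0 < c ->
  (forall i j, `|A i j| < c) -> `|A| < c.
Proof.
move=> c0 h; rewrite [ltLHS]/Num.Def.normr/= mx_normrE.
by apply: bigmax_lt => //= -[i j] _; exact: h.
Qed.

Lemma norm_mulmx_le m n p (A : 'M[R]_(m, n)) (B : 'M[R]_(n, p)) :
  `|A *m B| <= n%:R * `|A| * `|B|.
Proof.
apply: mx_norm_leP => [|i j]; first by rewrite !mulr_ge0.
rewrite mxE (le_trans (ler_norm_sum _ _ _))//.
rewrite (@le_trans _ _ (\sum_(k < n) `|A| * `|B|))//.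
  by apply: ler_sum => k _; rewrite normrM ler_pM ?mx_norm_ge.
by rewrite sumr_const card_ord -mulrA mulr_natl.
Qed.

Lemma cvg_mxP (T : Type) (F : set_system T) (FF : Filter F) m n
    (f : T -> 'M[R]_(m, n)) (l : 'M[R]_(m, n)) :
  f x @[x --> F] --> l <-> forall i j, f x i j @[x --> F] --> l i j.
Proof.
split=> [h i j|h].
  apply/cvgrPdist_lt => e e0; move/cvgrPdist_lt : h => /(_ e e0).
  apply: filterS => t; apply: le_lt_trans.
  by have := mx_norm_ge (l - f t) i j; rewrite !mxE.
apply/cvgrPdist_lt => e e0.
have : \forall t \near F, forall ij : 'I_m * 'I_n,
    `|l ij.1 ij.2 - f t ij.1 ij.2| < e.
  by apply: filter_forall => -[i j]; move/cvgrPdist_lt : (h i j); exact.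
apply: filterS => t ht; apply: mx_norm_lt => // i j.
by rewrite !mxE; exact: (ht (i, j)).
Qed.

Lemma continuous_mxP (V : topologicalType) m n (f : V -> 'M[R]_(m, n)) x :
  {for x, continuous f} <-> forall i j, {for x, continuous (fun y => f y i j)}.
Proof. exact: (cvg_mxP (F := nbhs x)). Qed.

Lemma is_derive_mxP (V : normedModType R) m n (f : V -> 'M[R]_(m, n)) x v d :
  is_derive x v f d <-> forall i j, is_derive x v (fun y => f y i j) (d i j).
Proof.
split=> [[fd <-] i j|h].
  split; first by move/derivable_mxP: fd.
  by rewrite derive_mx// mxE.
have fd : derivable f x v.
  by apply/derivable_mxP => i j; have [] := h i j.
split => //; rewrite derive_mx//; apply/matrixP => i j; rewrite mxE.
by have [] := h i j.
Qed.

Lemma is_derive_bigsum (V : normedModType R) (W : normedModType R) (I : finType)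
    (h : I -> V -> W) (x v : V) (dh : I -> W) :
  (forall i, is_derive x v (h i) (dh i)) ->
  is_derive x v (fun y => \sum_i h i y) (\sum_i dh i).
Proof.
move=> hd.
suff H (s : seq I) :
    is_derive x v (fun y => \sum_(i <- s) h i y) (\sum_(i <- s) dh i).
  exact: H.
elim: s => [|i s ih].
  rewrite big_nil (_ : (fun _ => _) = cst 0); last first.
    by apply/funext => y; rewrite big_nil.
  exact: is_derive_cst.
rewrite big_cons (_ : (fun _ => _) =
    h i + (fun y => \sum_(i <- s) h i y)); last first.
  by apply/funext => y; rewrite big_cons.
exact: is_deriveD.
Qed.

Lemma is_derive_mulr (V : normedModType R) (f g : V -> R) x v df dg :
  is_derive x v f df -> is_derive x v g dg ->
  is_derive x v (fun y => f y * g y) (df * g x + f x * dg).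
Proof.
move=> hf hg; have := is_deriveM hf hg.
by move/is_derive_eq; apply; rewrite addrC; congr (_ + _); exact: mulrC.
Qed.

Lemma is_derive_mulmx (V : normedModType R) m n p (A : V -> 'M[R]_(m, n))
    (B : V -> 'M[R]_(n, p)) x v dA dB :
  is_derive x v A dA -> is_derive x v B dB ->
  is_derive x v (fun y => A y *m B y) (dA *m B x + A x *m dB).
Proof.
move=> /is_derive_mxP hA /is_derive_mxP hB; apply/is_derive_mxP => i j.
rewrite (_ : (fun _ => _) = (fun y => \sum_k A y i k * B y k j)); last first.
  by apply/funext => y; rewrite mxE.
rewrite !mxE -big_split /=; apply: is_derive_bigsum => k.
exact: is_derive_mulr.
Qed.

Lemma is_derive_trmx (V : normedModType R) m n (A : V -> 'M[R]_(m, n)) x v dA :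
  is_derive x v A dA -> is_derive x v (fun y => (A y)^T) dA^T.
Proof.
move=> /is_derive_mxP hA; apply/is_derive_mxP => i j; rewrite mxE.
rewrite (_ : (fun _ => _) = (fun y => A y j i)) //.
by apply/funext => y; rewrite mxE.
Qed.

Lemma is_derive_ext (V W : normedModType R) (f g : V -> W) x v d :
  f =1 g -> is_derive x v f d -> is_derive x v g d.
Proof. by move=> /funext ->. Qed.

(** The two difference quotients are the same function, so one-variable results transfer to
    directional derivatives without any differentiability of [f]. *)
Lemma is_derive_line (V W : normedModType R) (f : V -> W) x v d (t : R) :
  is_derive (t *: v + x) v f d <-> is_derive t 1 (fun s : R => f (s *: v + x)) d.
Proof.
have E : (fun h : R => h^-1 *: ((f \o shift (t *: v + x)) (h *: v) - f (t *: v + x)))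
  = (fun h : R => h^-1 *: (((fun s : R => f (s *: v + x)) \o shift t) (h *: (1 : R))
       - f (t *: v + x))).
  by apply/funext => h /=; rewrite [_%:A]mulr1 addrA -scalerDl.
by split => -[h1 h2]; split; rewrite /derivable /derive ?E// -?E//.
Qed.

(** Both [b + f] and [b - f] have a nonnegative derivative, so the mean value theorem makes them
    monotone. Comparison with a majorant [b] takes the place of estimates of integrals in what
    follows. *)
Lemma le_increment_of_derive (f b df db : R -> R) (s t : R) : s <= t ->
  (forall u, s <= u <= t -> is_derive u 1 f (df u)) ->
  (forall u, s <= u <= t -> is_derive u 1 b (db u)) ->
  (forall u, s <= u <= t -> `|df u| <= db u) ->
  `|f t - f s| <= b t - b s.
Proof.
move=> st hf hb hle.
have key (g dg : R -> R) : (forall u, s <= u <= t -> is_derive u 1 g (dg u)) ->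
    (forall u, s <= u <= t -> 0 <= dg u) -> g s <= g t.
  move=> hg g0.
  have [c cst E] : exists2 c, c \in `[s, t]%R & g t - g s = dg c * (t - s).
    apply: MVT_segment => //.
      move=> x; rewrite in_itv/= => /andP[sx xt].
      by apply: hg; rewrite !ltW.
    apply: derivable_within_continuous => x; rewrite in_itv/= => sxt.
    by have [] := hg _ sxt.
  rewrite -subr_ge0 E mulr_ge0 ?subr_ge0//; apply: g0.
  by move: cst; rewrite in_itv.
have h1 : b s + f s <= b t + f t.
  apply: (key (b + f) (fun u => db u + df u)) => u su.
    by apply: is_deriveD; [exact: hb|exact: hf].
  by have := hle u su; rewrite ler_norml => /andP[]; lra.
have h2 : b s - f s <= b t - f t.
  apply: (key (b - f) (fun u => db u - df u)) => u su.
    by apply: is_deriveB; [exact: hb|exact: hf].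
  by have := hle u su; rewrite ler_norml => /andP[]; lra.
by rewrite ler_norml; apply/andP; split; lra.
Qed.

End Calculus.

(** * Ordinary differential equations *)

Section ODE.
Context {R : realType}.

Lemma primitive_right (f : R -> R) (a : R) : continuous f ->
  exists F : R -> R, forall t : R, a < t -> is_derive t 1 F (f t).
Proof.
move=> cf; exists (fun x => \int[lebesgue_measure]_(t in [set` `[a, x]]) f t)%R.
move=> t at_.
have [] := @continuous_FTC1_closed R f a t (t + 1) _ _ at_ (cf t).
- by rewrite ltrDl.
- apply: continuous_compact_integrable; first exact: segment_compact.
  by apply: continuous_subspaceT => x; exact: cf.
by move=> h1; rewrite derive1E => h2; exact: DeriveDef h1 h2.
Qed.

Lemma is_derive0_eq (f : R -> R) (a : R) :
  (forall t : R, a < t -> is_derive t 1 f 0) ->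
  forall s t, a < s -> a < t -> f s = f t.
Proof.
move=> hf.
suff H s t : a < s -> s <= t -> f s = f t.
  by move=> s t as_ at_; case: (leP s t) => [/H|/ltW /H]; [exact|move=> ->].
move=> as_ st.
have h : `|f t - f s| <= 0 - 0.
  apply: (@le_increment_of_derive R f (cst 0) (cst 0) (cst 0)) => // u /andP[su _].
    by apply: hf; exact: lt_le_trans su.
  by rewrite normr0.
by move: h; rewrite subrr normr_le0 subr_eq0 => /eqP.
Qed.

(** The integral from a base point is a primitive only to the right of it. Primitives based at
    -(n+1) and normalised to vanish at 0 agree wherever both are valid, so at each point one with a
    large enough index can be used. *)
Lemma primitive_exists (f : R -> R) : continuous f ->
  exists F : R -> R, F 0 = 0 /\ forall t : R, is_derive t 1 F (f t).
Proof.
move=> cf.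
have /choice[G hG] : forall n : nat, exists F : R -> R,
    F 0 = 0 /\ forall t : R, - n.+1%:R < t -> is_derive t 1 F (f t).
  move=> n; have [F hF] := primitive_right (- n.+1%:R) cf.
  exists (fun x => F x - F 0); split; first by rewrite subrr.
  move=> t nt; have h := is_deriveB (hF t nt) (is_derive_cst (F 0) t 1).
  by move: h; rewrite subr0.
have agree n m t : - n.+1%:R < t -> (n <= m)%N -> G n t = G m t.
  move=> nt nm; have [Gn0 hn] := hG n; have [Gm0 hm] := hG m.
  have le : - m.+1%:R <= - n.+1%:R :> R by rewrite lerN2 ler_nat.
  have H : (G n - G m) t = (G n - G m) 0.
    apply: (@is_derive0_eq (G n - G m) (- n.+1%:R)) => //.
      move=> s ns; have := is_deriveB (hn s ns) (hm s (le_lt_trans le ns)).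
      by rewrite subrr.
  move: H; rewrite !fctE Gn0 Gm0 subrr => /eqP; rewrite subr_eq0 => /eqP.
  exact.
pose N (x : R) := Num.truncn `|x|.
have hN (x : R) : - (N x).+1%:R < x.
  rewrite ltrNl; apply: le_lt_trans (truncnS_gt _).
  by rewrite -normrN ler_norm.
exists (fun x => G (N x) x); split; first by have [] := hG (N 0).
move=> t.
have [_ h] := hG (N t).+1.
have ht : - (N t).+2%:R < t by apply: lt_trans (hN t); rewrite ltrN2 ltr_nat.
apply: near_eq_is_derive (h t ht).
have : \forall x \near t, - (N t).+1%:R < x.
  by apply: (lt_nbhsr (hN t)).
apply: filterS => x ntx.
rewrite (agree (N t).+1 (maxn (N t).+1 (N x))) ?leq_maxl//; last first.
  by apply: lt_trans ntx; rewrite ltrN2 ltr_nat.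
by rewrite [RHS](agree _ (maxn (N t).+1 (N x))) ?leq_maxr.
Qed.

Lemma primitive_mx m n (f : R -> 'M[R]_(m, n)) (x0 : 'M[R]_(m, n)) :
  continuous f ->
  exists F : R -> _, F 0 = x0 /\ forall t : R, is_derive t 1 F (f t).
Proof.
move=> cf.
have /choice[G hG] : forall ij : 'I_m * 'I_n, exists F : R -> R,
    F 0 = 0 /\ forall t : R, is_derive t 1 F (f t ij.1 ij.2).
  move=> [i j] /=; apply: primitive_exists => t.
  by have /continuous_mxP := cf t; exact.
exists (fun t => \matrix_(i, j) (x0 i j + G (i, j) t)); split.
  by apply/matrixP => i j; rewrite mxE; have [-> _] := hG (i, j); rewrite addr0.
move=> t; apply/is_derive_mxP => i j.
apply: (@is_derive_ext _ _ _ (cst (x0 i j) + G (i, j))).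
  by move=> s; rewrite mxE.
rewrite -[X in is_derive _ _ _ X]add0r; apply: is_deriveD.
by have [_ /(_ t)] := hG (i, j).
Qed.

Lemma derive_mx_bound m n (F dF : R -> 'M[R]_(m, n)) (b db : R -> R) (s t : R) :
  s <= t ->
  (forall u, s <= u <= t -> is_derive u 1 F (dF u)) ->
  (forall u, s <= u <= t -> is_derive u 1 b (db u)) ->
  (forall u, s <= u <= t -> `|dF u| <= db u) ->
  `|F t - F s| <= b t - b s.
Proof.
move=> st hF hb hle.
have H i j : `|(F t - F s) i j| <= b t - b s.
  rewrite !mxE.
  apply: (@le_increment_of_derive _ (fun u => F u i j) b (fun u => dF u i j) db)
    => // u su.
    by have /is_derive_mxP := hF u su; exact.
  by apply: le_trans (hle u su); exact: mx_norm_ge.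
apply: mx_norm_leP => //.
(* That [b t - b s] is nonnegative cannot be read off an entry, since the matrices may be empty; the
   zero function is compared with [b] instead. *)
apply: le_trans (normr_ge0 (0 - 0 : R)) _.
apply: (@le_increment_of_derive R (cst 0) b (cst 0) db) => // u su.
by rewrite normr0; apply: le_trans (hle u su).
Qed.

Lemma is_derive_expZ (c t : R) :
  is_derive t 1 (fun u => expR (c * u)) (c * expR (c * t)).
Proof.
have h : is_derive t 1 (fun u : R => c * u) c.
  have := is_deriveZ c (is_derive_id t (1 : R)).
  by rewrite [_%:A]mulr1.
have := is_derive1_comp (is_derive_expR (c * t)) h.
by rewrite mulrC.
Qed.

(* In the norm weighted by this function one Picard step contracts by 1/2, which
   gives existence on the whole line at once. *)
Definition picard_weight (L t : R) : R := expR (2 * L * t) + expR (- (2 * L) * t).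

Lemma picard_weight_gt0 L t : 0 < picard_weight L t.
Proof. by rewrite addr_gt0// expR_gt0. Qed.

Lemma picard_weight_ge2 L t : 2 <= picard_weight L t.
Proof.
rewrite /picard_weight; have := expR_ge1Dx (2 * L * t).
by have := expR_ge1Dx (- (2 * L) * t); lra.
Qed.

Lemma picard_weight_cont L : continuous (picard_weight L).
Proof.
move=> t; apply: differentiable_continuous; apply/derivable1_diffP.
apply: derivableD.
  by have [] := is_derive_expZ (2 * L) t.
by have [] := is_derive_expZ (- (2 * L)) t.
Qed.

(** The majorant [b] is the odd primitive of 2 L c times the weight. Being odd it serves both signs
    of t, and its absolute value is at most c times the weight. Integration thus gains a factor 1 /
    (2 L). *)
Lemma picard_weight_bound m n (D dD : R -> 'M[R]_(m, n)) (L c : R) :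
  0 < L -> 0 <= c -> D 0 = 0 -> (forall t : R, is_derive t 1 D (dD t)) ->
  (forall t, `|dD t| <= 2 * L * c * picard_weight L t) ->
  forall t, `|D t| <= c * picard_weight L t.
Proof.
move=> L0 c0 D0 hD hle t.
pose b u := c * (expR (2 * L * u) - expR (- (2 * L) * u)).
have hb (u : R) : is_derive u 1 b (2 * L * c * picard_weight L u).
  have h1 := is_derive_expZ (2 * L) u; have h2 := is_derive_expZ (- (2 * L)) u.
  have := is_deriveZ c (is_deriveB h1 h2).
  move/is_derive_eq; apply.
  by rewrite /picard_weight /GRing.scale /=; ring.
have b0 : b 0 = 0 by rewrite /b !mulr0 subrr mulr0.
have le1 : `|D t| <= `|b t|.
  case: (leP 0 t) => [t0|/ltW t0].
    have := derive_mx_bound t0 (fun u _ => hD u) (fun u _ => hb u) (fun u _ => hle u).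
    by rewrite D0 b0 !subr0 => h; apply: le_trans h _; exact: ler_norm.
  have := derive_mx_bound t0 (fun u _ => hD u) (fun u _ => hb u) (fun u _ => hle u).
  rewrite D0 b0 !sub0r normrN => h; apply: le_trans h _.
  by rewrite -normrN; exact: ler_norm.
apply: le_trans le1 _; rewrite /b normrM (ger0_norm c0) ler_wpM2l//.
rewrite /picard_weight (le_trans (ler_normB _ _))//.
by rewrite !ger0_norm// expR_ge0.
Qed.

(** With [e n] the tail of the geometric series, the intervals from u n - e n to u n + e n are
    nested; the limit is the supremum of their left ends. *)
Lemma geometric_limit (u : nat -> R) (c : R) :
  (forall n, `|u n.+1 - u n| <= c * 2^-1 ^+ n) ->
  exists l, forall n, `|l - u n| <= 2 * c * 2^-1 ^+ n.
Proof.
move=> h.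
pose e n : R := 2 * c * 2^-1 ^+ n.
have eS n : e n.+1 = e n - c * 2^-1 ^+ n.
  by rewrite /e exprS; set x := _ ^+ n; field.
have c0 : 0 <= c.
  by have := h 0; rewrite expr0 mulr1; apply: le_trans.
have e0 n : 0 <= e n by rewrite /e !mulr_ge0// exprn_ge0// invr_ge0.
have lo n m : (n <= m)%N -> u n - e n <= u m - e m.
  elim: m => [|m ih]; first by rewrite leqn0 => /eqP ->.
  rewrite leq_eqVlt => /predU1P[-> //|]; rewrite ltnS => /ih.
  move/le_trans; apply; rewrite eS; have := h m; rewrite ler_norml => /andP[].
  by lra.
have hi n m : (n <= m)%N -> u m + e m <= u n + e n.
  elim: m => [|m ih]; first by rewrite leqn0 => /eqP ->.
  rewrite leq_eqVlt => /predU1P[-> //|]; rewrite ltnS => /ih.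
  apply: le_trans; rewrite eS; have := h m; rewrite ler_norml => /andP[].
  by lra.
have lohi n m : u n - e n <= u m + e m.
  have h1 := lo n (maxn n m) (leq_maxl _ _).
  have h2 := hi m (maxn n m) (leq_maxr _ _).
  by have := e0 (maxn n m); lra.
pose S := [set u n - e n | n in [set: nat]].
exists (sup S) => n.
have h1 : u n - e n <= sup S.
  apply: ub_le_sup; last by exists n.
  by exists (u 0%N + e 0%N) => _ [k _ <-]; exact: lohi.
have h2 : sup S <= u n + e n.
  apply: ge_sup; first by exists (u 0%N - e 0%N); exists 0%N.
  by move=> _ [k _ <-]; exact: lohi.
by rewrite ler_norml -/(e n); apply/andP; split; lra.
Qed.

Lemma small_pow2 (c e : R) : 0 < e -> exists n, c * 2^-1 ^+ n < e.
Proof.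
move=> e0.
have hn n : 2^-1 ^+ n * n%:R <= 1 :> R.
  rewrite exprVn mulrC ler_pdivrMr ?exprn_gt0// mul1r.
  by rewrite -natrX ler_nat ltnW// ltn_expl.
pose n := (Num.truncn (`|c| / e)).+1; exists n.
have lt : `|c| / e < n%:R by exact: truncnS_gt.
have n0 : 0 < n%:R :> R by rewrite ltr0n.
apply: le_lt_trans (_ : `|c| * 2^-1 ^+ n < e).
  by rewrite ler_wpM2r ?ler_norm// exprn_ge0// invr_ge0.
rewrite ltr_pdivrMr// in lt.
have := hn n; rewrite -(ler_pM2l e0) mulr1; set x := _ ^+ n => h.
apply: lt_le_trans h.
rewrite (_ : e * (x * n%:R) = (n%:R * e) * x); last by ring.
by rewrite ltr_pM2r// exprn_gt0// invr_gt0.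
Qed.

Lemma picard m n (f : R -> 'M[R]_(m, n) -> 'M[R]_(m, n)) (x0 : 'M[R]_(m, n))
    (L K : R) : 0 < L ->
  (forall x : R -> 'M[R]_(m, n), continuous x -> continuous (fun t => f t (x t))) ->
  (forall t x y, `|f t x - f t y| <= L * `|x - y|) ->
  (forall t, `|f t x0| <= K) ->
  exists X : R -> 'M[R]_(m, n), [/\ X 0 = x0,
    forall t : R, is_derive t 1 X (f t (X t)) &
    forall t, `|X t - x0| <= K / L * picard_weight L t].
Proof.
move=> L0 cf lf Kf.
have K0 : 0 <= K by apply: le_trans (Kf 0).
(* [picard_weight_bound] divides the bound K of the first derivative by 2 L, which gives [C]; every
   later step multiplies by L and divides by 2 L, hence the powers of 1/2 below. *)
pose C := K / (2 * L).
have C0 : 0 <= C by rewrite divr_ge0// mulr_ge0// ltW.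
have /choice[P hP] : forall x : R -> 'M[R]_(m, n), exists F : R -> 'M[R]_(m, n),
    continuous x -> F 0 = x0 /\ forall t : R, is_derive t 1 F (f t (x t)).
  move=> x; case: (pselect (continuous x)) => cx; last by exists (cst x0).
  have [F hF] := primitive_mx x0 (cf x cx).
  by exists F.
pose X_ := fix X_ k := if k is k'.+1 then P (X_ k') else cst x0.
have cX k : continuous (X_ k).
  elim: k => [|k ih] /=; first exact: cst_continuous.
  have [_ h] := hP _ ih => t.
  by apply: differentiable_continuous; apply/derivable1_diffP; have [] := h t.
have X0 k : X_ k 0 = x0.
  by case: k => [//|k] /=; have [] := hP _ (cX k).
have dX k (t : R) : is_derive t 1 (X_ k.+1) (f t (X_ k t)).
  by have [_] := hP _ (cX k).
have step k t : `|X_ k.+1 t - X_ k t| <= C * 2^-1 ^+ k * picard_weight L t.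
  elim: k t => [|k ih] t.
    rewrite expr0 mulr1.
    apply: (@picard_weight_bound _ _ (X_ 1%N - cst x0)
      (fun t => f t (X_ 0%N t) - 0)) => //.
    - by rewrite !fctE X0 subrr.
    - move=> s; rewrite subr0; apply: (le_trans (Kf s)).
      have -> : 2 * L * C = K by rewrite /C mulrC divfK// gt_eqF// mulr_gt0.
      by have := picard_weight_ge2 L s; nra.
  apply: (@picard_weight_bound _ _ (X_ k.+2 - X_ k.+1)
      (fun t => f t (X_ k.+1 t) - f t (X_ k t))) => //.
  - by rewrite mulr_ge0// exprn_ge0// invr_ge0.
  - by rewrite !fctE !(X0 (_.+1)) subrr.
  - move=> s; apply: (le_trans (lf _ _ _)).
    apply: le_trans (ler_wpM2l (ltW L0) (ih s)) _.
    rewrite exprS le_eqVlt; apply/orP; left; apply/eqP.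
    by set x := _ ^+ k; field.
have /choice[X hX] : forall t, exists x : 'M[R]_(m, n), forall k,
    `|x - X_ k t| <= 2 * C * picard_weight L t * 2^-1 ^+ k.
  move=> t.
  have /choice[l hl] : forall ij : 'I_m * 'I_n, exists l : R, forall k,
      `|l - X_ k t ij.1 ij.2| <= 2 * (C * picard_weight L t) * 2^-1 ^+ k.
    move=> [i j]; apply: geometric_limit => k /=.
    rewrite mulrAC; apply: le_trans (step k t).
    by have := mx_norm_ge (X_ k.+1 t - X_ k t) i j; rewrite !mxE.
  exists (\matrix_(i, j) l (i, j)) => k; apply: mx_norm_leP.
    have w0 := ltW (picard_weight_gt0 L t).
    apply: mulr_ge0; last by apply: exprn_ge0; rewrite invr_ge0.
    by apply: mulr_ge0 => //; exact: mulr_ge0.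
  by move=> i j; rewrite !mxE; have := hl (i, j) k; rewrite /= (mulrA 2).
have ctX : continuous X.
  move=> t; apply/cvgrPdist_lt => e e0.
  have E0 : 0 < 2 * C * (picard_weight L t + 1) + 1.
    have := picard_weight_gt0 L t; nra.
  (* The weight stays below its value at t plus 1 near t, so a single iterate is within e / 3 of [X]
     at all nearby points. *)
  have [k hk] := @small_pow2 (2 * C * (picard_weight L t + 1)) (e / 3) ltac:(lra).
  have h1 : \forall s \near t, picard_weight L s < picard_weight L t + 1.
    have /cvgrPdist_lt /(_ _ ltr01) := @picard_weight_cont L t.
    by apply: filterS => s; rewrite ltr_norml => /andP[]; lra.
  have h2 : \forall s \near t, `|X_ k t - X_ k s| < e / 3.
    have e3 : 0 < e / 3 by lra.
    by have /cvgrPdist_lt /(_ _ e3) := cX k t.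
  apply: filterS2 h1 h2 => s hs1 hs2.
  have B u : picard_weight L u <= picard_weight L t + 1 -> `|X u - X_ k u| < e / 3.
    move=> hu; apply: le_lt_trans hk; apply: (le_trans (hX u k)).
    rewrite ler_wpM2r ?exprn_ge0 ?invr_ge0//.
    by rewrite ler_wpM2l// mulr_ge0.
  have hb1 := B t ltac:(lra); have hb2 := B s (ltW hs1).
  rewrite (_ : X t - X s = (X t - X_ k t) + (X_ k t - X_ k s) - (X s - X_ k s)).
    apply: le_lt_trans (ler_normB _ _) _.
    have := ler_normD (X t - X_ k t) (X_ k t - X_ k s).
    lra.
  by rewrite opprB !addrA !subrK.
have [Y0 dY] := hP _ ctX; set Y := P X in Y0 dY.
(* [Y] is the Picard image of the limit; it is approximated by the shifted iterates, hence is the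
   limit itself, which turns its derivative into the equation. *)
have YX : Y = X.
  apply/funext => t; apply/eqP; rewrite -subr_eq0 -normr_le0.
  apply/ler_addgt0Pr => e e0; rewrite add0r.
  have YXk k : `|Y t - X_ k.+1 t| <= C * 2^-1 ^+ k * picard_weight L t.
    apply: (@picard_weight_bound _ _ (Y - X_ k.+1)
      (fun t => f t (X t) - f t (X_ k t))) => //.
    - by rewrite mulr_ge0// exprn_ge0// invr_ge0.
    - by rewrite !fctE (X0 (_.+1)) Y0 subrr.
    - move=> s; apply: (le_trans (lf _ _ _)).
      apply: le_trans (ler_wpM2l (ltW L0) (hX s k)) _.
      rewrite le_eqVlt; apply/orP; left; apply/eqP.
      by set x := _ ^+ k; ring.
  have [k hk] := @small_pow2 (2 * C * picard_weight L t) e e0.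
  rewrite (_ : Y t - X t = (Y t - X_ k.+1 t) - (X t - X_ k.+1 t)); last first.
    by rewrite opprB addrA subrK.
  apply: le_trans (ler_normB _ _) _; apply: le_trans (ltW hk).
  have := YXk k; have := hX t k.+1; rewrite exprS; set x := _ ^+ k.
  by move=> h1 h2; lra.
exists X; split.
- by rewrite -YX.
- by move=> t; rewrite -{1}YX; exact: dY.
- move=> t; have := hX t 0%N; rewrite expr0 mulr1 /=.
  suff -> : 2 * C = K / L by [].
  by rewrite /C; field; rewrite gt_eqF.
Qed.

End ODE.

(** * Functions of class C^k *)

Section CkTheory.
Context {R : realType}.

Lemma Ck_continuous (V W : normedModType R) k (O : set V) (f : V -> W) x :
  Ck k O f -> O x -> {for x, continuous f}.
Proof. by case: k => [|k] [h _] /h. Qed.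

Lemma Ck_le1 (V W : normedModType R) k (O : set V) (f : V -> W) :
  Ck k.+1 O f -> Ck k O f.
Proof.
elim: k f => [|k ih] f [c h]; split => // v; have [d h'] := h v.
by split => //; exact: ih.
Qed.

Lemma Ck_sub (V W : normedModType R) k (O O' : set V) (f : V -> W) :
  O' `<=` O -> Ck k O f -> Ck k O' f.
Proof.
move=> sub; elim: k f => [|k ih] f [c h]; split => //.
- by move=> x /sub /c.
- by move=> x /sub /c.
- by move=> v; have [d h'] := h v; split; [move=> x /sub/d|exact: ih].
Qed.

Lemma near_in_open (V : topologicalType) (O : set V) x : open O -> O x ->
  \forall y \near x, O y.
Proof. by move=> oO Ox; apply: open_nbhs_nbhs. Qed.

Lemma near_forall_fin (V : topologicalType) (x : V) (I : finType)
    (P : I -> V -> Prop) :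
  (forall i, \forall y \near x, P i y) -> \forall y \near x, forall i, P i y.
Proof. by move=> h; exact: (filter_forall (nbhs_filter x) h). Qed.

Lemma Ck_ext (V W : normedModType R) k (O : set V) (f g : V -> W) :
  open O -> (forall x, O x -> f x = g x) -> Ck k O f -> Ck k O g.
Proof.
move=> oO; elim: k f g => [|k ih] f g fg [c h].
  split => // x Ox; have := c x Ox; rewrite /prop_for /continuous_at -fg//.
  apply: cvg_trans; apply: near_eq_cvg.
  by apply: filterS (near_in_open oO Ox) => y /fg ->.
have nfg x : O x -> {near x, f =1 g}.
  by move=> Ox; apply: filterS (near_in_open oO Ox) => y /fg.
split.
  move=> x Ox; have := c x Ox; rewrite /prop_for /continuous_at -fg//.
  by apply: cvg_trans; apply: near_eq_cvg; have := nfg x Ox; apply: filterS.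
move=> v; have [d h'] := h v; split.
  by move=> x Ox; apply: near_eq_derivable (d x Ox); exact: nfg.
apply: ih h' => x Ox; apply: near_eq_derive; exact: nfg.
Qed.

Lemma Ck_cst (V W : normedModType R) k (O : set V) (w : W) :
  Ck k O (fun=> w).
Proof.
elim: k w => [|k ih] w; split => //; try by move=> x _; exact: cst_continuous.
move=> v; split; first by move=> x _; exact: derivable_cst.
have -> : (fun x : V => 'D_v (fun=> w) x) = (fun=> 0); last exact: ih.
by apply/funext => x; exact: derive_cst.
Qed.

Lemma Ck_add (V W : normedModType R) k (O : set V) (f g : V -> W) : open O ->
  Ck k O f -> Ck k O g -> Ck k O (fun x => f x + g x).
Proof.
move=> oO; elim: k f g => [|k ih] f g [cf hf] [cg hg].
  by split => // x Ox; apply: cvgD; [exact: cf|exact: cg].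
split; first by move=> x Ox; apply: cvgD; [exact: cf|exact: cg].
move=> v; have [df kf] := hf v; have [dg kg] := hg v; split.
  by move=> x Ox; apply: derivableD; [exact: df|exact: dg].
apply: Ck_ext oO _ (ih _ _ kf kg) => x Ox.
by rewrite -deriveD//; [exact: df|exact: dg].
Qed.

Lemma Ck_mul (V : normedModType R) k (O : set V) (f g : V -> R) : open O ->
  Ck k O f -> Ck k O g -> Ck k O (fun x => f x * g x).
Proof.
move=> oO; elim: k f g => [|k ih] f g hf0 hg0.
  have [cf _] := hf0; have [cg _] := hg0.
  by split => // x Ox; apply: cvgM; [exact: cf|exact: cg].
have [cf hf] := hf0; have [cg hg] := hg0.
split; first by move=> x Ox; apply: cvgM; [exact: cf|exact: cg].
move=> v; have [df kf] := hf v; have [dg kg] := hg v; split.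
  by move=> x Ox; apply: derivableM; [exact: df|exact: dg].
have := Ck_add oO (ih _ _ kf (Ck_le1 hg0)) (ih _ _ (Ck_le1 hf0) kg).
apply: Ck_ext => // x Ox.
have := is_derive_mulr (derivableP (df x Ox)) (derivableP (dg x Ox)).
by case=> _ ->.
Qed.

Lemma Ck_opp (V : normedModType R) k (O : set V) (f : V -> R) : open O ->
  Ck k O f -> Ck k O (fun x => - f x).
Proof.
move=> oO h; have := Ck_mul oO (Ck_cst k O (-1 : R)) h.
by apply: Ck_ext => // x _; rewrite mulN1r.
Qed.

Lemma Ck_sum (V W : normedModType R) k (O : set V) (I : finType)
    (f : I -> V -> W) : open O ->
  (forall i, Ck k O (f i)) -> Ck k O (fun x => \sum_i f i x).
Proof.
move=> oO h.
suff H (s : seq I) : Ck k O (fun x => \sum_(i <- s) f i x) by exact: H.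
elim: s => [|i s ih].
  by apply: Ck_ext oO _ (Ck_cst k O 0) => x _; rewrite big_nil.
by apply: Ck_ext oO _ (Ck_add oO (h i) ih) => x _; rewrite big_cons.
Qed.

Lemma Ck_prod (V : normedModType R) k (O : set V) (I : finType)
    (f : I -> V -> R) : open O ->
  (forall i, Ck k O (f i)) -> Ck k O (fun x => \prod_i f i x).
Proof.
move=> oO h.
suff H (s : seq I) : Ck k O (fun x => \prod_(i <- s) f i x) by exact: H.
elim: s => [|i s ih].
  by apply: Ck_ext oO _ (Ck_cst k O (1 : R)) => x _; rewrite big_nil.
by apply: Ck_ext oO _ (Ck_mul oO (h i) ih) => x _; rewrite big_cons.
Qed.

Lemma Ck_inv (V : normedModType R) k (O : set V) (f : V -> R) : open O ->
  (forall x, O x -> f x != 0) ->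
  Ck k O f -> Ck k O (fun x => (f x)^-1).
Proof.
move=> oO f0; elim: k => [|k ih] hf0.
  have [cf _] := hf0.
  by split => // x Ox; apply: cvgV; [exact: f0|exact: cf].
have [cf hf] := hf0.
split; first by move=> x Ox; apply: cvgV; [exact: f0|exact: cf].
move=> v; have [df kf] := hf v; split.
  by move=> x Ox; apply: derivableV; [exact: f0|exact: df].
have i1 := ih (Ck_le1 hf0).
have := Ck_opp oO (Ck_mul oO (Ck_mul oO i1 i1) kf).
apply: Ck_ext => // x Ox.
rewrite [RHS]deriveV; [|exact: f0|exact: df].
by rewrite /GRing.scale /= expr2 invfM mulNr.
Qed.

Lemma Ck_mxP (V : normedModType R) k (O : set V) m n (f : V -> 'M[R]_(m, n)) :
  open O -> Ck k O f <-> forall i j, Ck k O (fun x => f x i j).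
Proof.
move=> oO; elim: k f => [|k ih] f; split.
- move=> [c _] i j; split => // x Ox.
  by have /continuous_mxP := c x Ox; exact.
- move=> h; split => // x Ox; apply/continuous_mxP => i j.
  by have [c _] := h i j; exact: c.
- move=> [c h] i j; split.
    by move=> x Ox; have /continuous_mxP := c x Ox; exact.
  move=> v; have [d /ih h'] := h v; split.
    by move=> x Ox; have /derivable_mxP := d x Ox; exact.
  apply: Ck_ext oO _ (h' i j) => x Ox.
  by rewrite derive_mx ?mxE//; exact: d.
- move=> h; split.
    by move=> x Ox; apply/continuous_mxP => i j; have [c _] := h i j; exact: c.
  move=> v.
  have d x : O x -> derivable f x v.
    move=> Ox; apply/derivable_mxP => i j.
    by have [_ /(_ v)[d _]] := h i j; exact: d.
  split => //; apply/ih => i j; have [_ /(_ v)[_]] := h i j.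
  by apply: Ck_ext => // x Ox; rewrite derive_mx ?mxE//; exact: d.
Qed.

End CkTheory.

(** * Differentiability of C^1 functions and the chain rule *)

Section C1differentiable.
Context {R : realType} {n : nat}.
Implicit Types (f : 'cV[R]_n -> R) (x h : 'cV[R]_n).

(** The path from x to [h + x] changes one coordinate at a time: [tr k] keeps the first k
    coordinates of h. In the sup norm every leg stays in the ball, and each contributes an error of
    at most e times the norm of h. *)
Lemma C1_increment f x (e del : R) : 0 <= e ->
  (forall y a, `|y - x| < del -> derivable f y (delta_mx a 0) /\
     `|'D_(delta_mx a 0) f y - 'D_(delta_mx a 0) f x| <= e) ->
  forall h, `|h| < del ->
  `|f (h + x) - f x - \sum_a h a 0 * 'D_(delta_mx a 0) f x| <= n%:R * e * `|h|.
Proof.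
move=> e0 hyp h hdel.
pose tr k : 'cV[R]_n := \col_a (if (a < k)%N then h a 0 else 0).
have H k : (k <= n)%N ->
  `|f (tr k + x) - f x - \sum_(a < n | (a < k)%N) h a 0 * 'D_(delta_mx a 0) f x|
    <= k%:R * e * `|h|.
  elim: k => [_|k ih kn].
    rewrite big_pred0// (_ : tr _ = 0) ?add0r ?subrr ?subr0 ?normr0 ?mul0r//.
    by apply/matrixP => i j; rewrite !mxE.
  pose a := Ordinal kn.
  have trS : tr k.+1 = h a 0 *: delta_mx a 0 + tr k.
    apply/matrixP => i j; rewrite !mxE ord1 eqxx andbT ltnS leq_eqVlt.
    rewrite -(inj_eq val_inj) /=; case: eqP => [ik|_] /=.
      rewrite mulr1 ik ltnn addr0; congr (h _ _).
      by apply: val_inj.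
    by rewrite mulr0 add0r.
  have le_tr s i : `|s| <= `|h a 0| -> `|(s *: delta_mx a 0 + tr k) i 0| <= `|h|.
    move=> sh; rewrite !mxE eqxx andbT -(inj_eq val_inj) /=; case: eqP => [ik|_] /=.
      by rewrite mulr1 ik ltnn addr0 (le_trans sh)// mx_norm_ge.
    rewrite mulr0 add0r; case: ifP => _; first exact: mx_norm_ge.
    by rewrite normr0.
  have near_x s : `|s| <= `|h a 0| -> `|s *: delta_mx a 0 + (tr k + x) - x| < del.
    move=> sh; rewrite addrA addrK; apply: le_lt_trans hdel.
    by apply: mx_norm_leP => // i j; rewrite ord1; exact: le_tr.
  pose D := 'D_(delta_mx a 0) f x.
  pose phi s := f (s *: delta_mx a 0 + (tr k + x)) - s * D.
  pose dphi s := 'D_(delta_mx a 0) f (s *: delta_mx a 0 + (tr k + x)) - D.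
  have dphiP (s : R) : `|s| <= `|h a 0| -> is_derive s 1 phi (dphi s).
    move=> sh; have [df _] := hyp _ a (near_x s sh).
    have /is_derive_line h1 := derivableP df.
    have h2 : is_derive s 1 (fun u : R => u * D) D.
      have := is_derive_mulr (is_derive_id s (1 : R)) (is_derive_cst D s 1).
      by rewrite mulr0 addr0 mul1r.
    exact: is_deriveB.
  have dphi_le s : `|s| <= `|h a 0| -> `|dphi s| <= e.
    by move=> sh; have [] := hyp _ a (near_x s sh).
  have lin (s : R) : is_derive s 1 (fun u : R => e * u) e.
    have := is_deriveZ e (is_derive_id s (1 : R)).
    by rewrite [_%:A]mulr1.
  have key : `|phi (h a 0) - phi 0| <= e * `|h a 0|.
    case: (leP 0 (h a 0)) => h0.
      have B u : 0 <= u <= h a 0 -> `|u| <= `|h a 0|.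
        by move=> /andP[u0 uh]; rewrite (ger0_norm u0) (ger0_norm h0).
      have := @le_increment_of_derive R phi (fun u => e * u) dphi (cst e) 0 (h a 0) h0
        (fun u su => dphiP u (B u su)) (fun u _ => lin u)
        (fun u su => dphi_le u (B u su)).
      by rewrite mulr0 subr0 (ger0_norm h0).
    have B u : h a 0 <= u <= 0 -> `|u| <= `|h a 0|.
      by move=> /andP[uh u0]; rewrite (ler0_norm u0) (ltr0_norm h0) lerN2.
    have := @le_increment_of_derive R phi (fun u => e * u) dphi (cst e) (h a 0) 0 (ltW h0)
      (fun u su => dphiP u (B u su)) (fun u _ => lin u)
      (fun u su => dphi_le u (B u su)).
    by rewrite mulr0 sub0r distrC (ltr0_norm h0) mulrN.
  have -> : \sum_(b < n | (b < k.+1)%N) h b 0 * 'D_(delta_mx b 0) f x =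
     h a 0 * D + \sum_(b < n | (b < k)%N) h b 0 * 'D_(delta_mx b 0) f x.
    rewrite (bigD1 a)//=; congr (_ + _); apply: eq_bigl => b.
    by rewrite ltnS [RHS]ltn_neqAle andbC -(inj_eq val_inj).
  have := ih (ltnW kn); move: key; rewrite /phi trS scale0r mul0r add0r subr0 -(addrA (h a 0 *: _) (tr k) x).
  set S := \sum_(_ < _ | _) _; set F0 := f x; set F1 := f (_ + (_ + _)).
  set F2 := f _ => k1 k2.
  rewrite (_ : _ - _ - _ = (F1 - h a 0 * D - F2) + (F2 - F0 - S)); last by ring.
  apply: le_trans (ler_normD _ _) _.
  have := mx_norm_ge h a 0; rewrite -natr1 => hh.
  have : e * `|h a 0| <= e * `|h| by rewrite ler_wpM2l.
  lra.
have := H n (leqnn n).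
rewrite (_ : tr n = h); last first.
  by apply/matrixP => i j; rewrite !mxE ltn_ord ord1.
by rewrite (eq_bigl xpredT)// => a; rewrite ltn_ord.
Qed.

Lemma C1_differentiable f (O : set 'cV[R]_n) x : open O -> O x -> Ck 1 O f ->
  differentiable f x /\
  forall h, 'd f x h = \sum_a h a 0 * 'D_(delta_mx a 0) f x.
Proof.
move=> oO Ox [_ hf].
pose d h : R := \sum_a h a 0 * 'D_(delta_mx a 0) f x.
have lin_d : linear d.
  move=> c u v; rewrite /d scaler_sumr -big_split /=; apply: eq_bigr => a _.
  by rewrite !mxE mulrDl -mulrA.
pose dM := GRing.isLinear.Build _ _ _ _ d lin_d.
pose dL : {linear 'cV[R]_n -> R} := HB.pack d dM.
have cd : continuous dL.
  move=> u; apply: (@Ck_continuous _ _ _ 0 setT d) => //.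
  apply: Ck_sum; first exact: openT.
  move=> a; apply: Ck_mul; [exact: openT| |exact: Ck_cst].
  by split=> // y _; exact: coord_continuous.
have exp e : 0 < e ->
    \forall h \near nbhs (0 : 'cV[R]_n),
      `|(f \o shift x - (cst (f x) + dL)) h| <= e * `|h|.
  move=> e0.
  (* The increment estimate loses a factor n; dividing by n + 1 also covers n = 0. *)
  pose e' := e / n.+1%:R.
  have e'0 : 0 < e' by rewrite divr_gt0.
  have hpart : \forall y \near x, forall a : 'I_n,
      `|'D_(delta_mx a 0) f y - 'D_(delta_mx a 0) f x| <= e'.
    apply: near_forall_fin => a; have [_ [c _]] := hf (delta_mx a 0).
    have /cvgrPdist_le /(_ _ e'0) := c x Ox.
    by apply: filterS => y; rewrite distrC.
  have : \forall y \near x, O y /\ forall a : 'I_n,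
      `|'D_(delta_mx a 0) f y - 'D_(delta_mx a 0) f x| <= e'.
    by apply: filterS2 (near_in_open oO Ox) hpart.
  move=> /nbhs_normP[del /= del0 hdel].
  have hyp y a : `|y - x| < del -> derivable f y (delta_mx a 0) /\
     `|'D_(delta_mx a 0) f y - 'D_(delta_mx a 0) f x| <= e'.
    move=> yx; have [|Oy h] := hdel y; first by rewrite /= distrC.
    by split => //; have [dd _] := hf (delta_mx a 0); exact: dd.
  have : \forall h \near (0 : 'cV[R]_n), `|h| < del.
    by apply/nbhs_normP; exists del => //= h /=; rewrite sub0r normrN.
  apply: filterS => h /(C1_increment (ltW e'0) hyp).
  rewrite !fctE /= opprD addrA => /le_trans; apply.
  apply: ler_wpM2r => //; rewrite /e' mulrA ler_pdivrMr// mulrC.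
  by apply: ler_wpM2l; [exact: ltW|rewrite ler_nat].
have E : 'd f x = dL :> (_ -> _) by apply: diff_unique => //; exact/eqaddoP.
split; last by move=> h; rewrite E.
by apply/diff_locallyP; rewrite E; split => //; exact/eqaddoP.
Qed.

Lemma derive_partials f (O : set 'cV[R]_n) x v : open O -> O x -> Ck 1 O f ->
  'D_v f x = \sum_a v a 0 * 'D_(delta_mx a 0) f x.
Proof.
by move=> oO Ox hf; have [d E] := C1_differentiable oO Ox hf; rewrite deriveE ?E.
Qed.

(** Only the derivative of [c] along v is given, so [c] is restricted to the line through x. There
    derivability is differentiability, and the chain rule for differentials applies. *)
Lemma is_derive_chain (V : normedModType R) (c : V -> 'cV[R]_n) f
    (O : set 'cV[R]_n) (x v : V) dc : open O -> O (c x) -> Ck 1 O f ->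
  is_derive x v c dc ->
  is_derive x v (fun y => f (c y)) (\sum_a dc a 0 * 'D_(delta_mx a 0) f (c x)).
Proof.
move=> oO Ox hf hc.
have [d E] := C1_differentiable oO Ox hf.
have x0 : (0 : R) *: v + x = x by rewrite scale0r add0r.
have hc0 : is_derive ((0 : R) *: v + x) v c dc by rewrite x0.
move/is_derive_line: hc0 => hc0.
suff H : is_derive ((0 : R) *: v + x) v (fun y => f (c y))
    (\sum_a dc a 0 * 'D_(delta_mx a 0) f (c x)) by rewrite x0 in H.
apply/is_derive_line.
pose c0 (s : R) := c (s *: v + x).
have dc0 : differentiable c0 (0 : R) by apply/derivable1_diffP; case: hc0.
have c00 : c0 0 = c x by rewrite /c0 x0.
have df : differentiable f (c0 0) by rewrite c00.
have dfc : differentiable (f \o c0) (0 : R) by exact: differentiable_comp.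
apply: DeriveDef; first by apply/derivable1_diffP.
change (derive (f \o c0) (0 : R) 1 = \sum_a dc a 0 * 'D_(delta_mx a 0) f (c x)).
rewrite (deriveE _ dfc).
have -> : 'd (f \o c0) (0 : R) 1 = 'd f (c0 0) ('d c0 (0 : R) 1).
  by rewrite (diff_comp dc0 df).
by rewrite c00 E -(deriveE _ dc0); case: hc0 => _ ->.
Qed.

End C1differentiable.

(** * Smooth compositions, symmetry of second derivatives, inverse matrices *)

Section SmoothTheory.
Context {R : realType}.

Lemma smooth_derive (V W : normedModType R) (O : set V) (f : V -> W) v :
  smooth_on O f -> smooth_on O (fun x => 'D_v f x).
Proof. by move=> h k; have [_ /(_ v)[]] := h k.+1. Qed.

Lemma smooth_derivable (V W : normedModType R) (O : set V) (f : V -> W) x v :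
  smooth_on O f -> O x -> derivable f x v.
Proof. by move=> h Ox; have [_ /(_ v)[]] := h 1%N => h' _; exact: h'. Qed.

Lemma Ck_comp (V : normedModType R) n k (O' : set V) (O : set 'cV[R]_n)
    (c : V -> 'cV[R]_n) (f : 'cV[R]_n -> R) : open O' -> open O ->
  (forall x, O' x -> O (c x)) -> Ck k O' c -> smooth_on O f ->
  Ck k O' (fun x => f (c x)).
Proof.
move=> oO' oO cO; elim: k f => [|k ih] f hc hf.
  split => // x Ox; apply: continuous_comp; first exact: (Ck_continuous hc).
  by apply: (Ck_continuous (hf 0%N)); exact: cO.
have chain x v : O' x -> is_derive x v (fun y => f (c y))
    (\sum_a ('D_v c x) a 0 * 'D_(delta_mx a 0) f (c x)).
  move=> Ox; apply: is_derive_chain oO (cO x Ox) (hf 1%N) _.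
  by apply: derivableP; have [_ /(_ v)[h _]] := hc; exact: h.
split.
  move=> x Ox; apply: continuous_comp; first exact: (Ck_continuous hc).
  by apply: (Ck_continuous (hf 0%N)); exact: cO.
move=> v; split; first by move=> x Ox; have [] := chain x v Ox.
have : Ck k O' (fun x => \sum_a ('D_v c x) a 0 * 'D_(delta_mx a 0) f (c x)).
  apply: Ck_sum => // a; apply: Ck_mul => //.
    by have [_ /(_ v)[_ /Ck_mxP]] := hc; exact.
  apply: (ih (fun y => 'D_(delta_mx a 0) f y)); last exact: smooth_derive.
  exact: Ck_le1.
by apply: Ck_ext => // x Ox; have [_ ->] := chain x v Ox.
Qed.

(* The mean value theorem twice; [schwarz] compares the two orders. *)
Lemma second_difference (V : normedModType R) (O : set V) (f : V -> R) x u v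
    (h : R) : 0 < h -> Ck 2 O f ->
  (forall s t, 0 <= s <= h -> 0 <= t <= h -> O (s *: u + (t *: v + x))) ->
  exists s t, [/\ 0 <= s <= h, 0 <= t <= h &
    f (h *: u + (h *: v + x)) - f (h *: u + x) - f (h *: v + x) + f x =
    'D_v (fun y => 'D_u f y) (s *: u + (t *: v + x)) * h * h].
Proof.
move=> h0 [_ hf] hO.
have h00 : (0 : R) <= (0 : R) <= h by rewrite lexx ltW.
have hhh : 0 <= h <= h by rewrite lexx ltW.
have hO0 s : 0 <= s <= h -> O (s *: u + x).
  by move=> /hO /(_ h00); rewrite scale0r add0r.
have [dfu [_ kfu]] := hf u; have [dfuv _] := kfu v.
pose phi (s : R) := f (s *: u + (h *: v + x)) - f (s *: u + x).
pose dphi (s : R) := 'D_u f (s *: u + (h *: v + x)) - 'D_u f (s *: u + x).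
have phiP (s : R) : 0 <= s <= h -> is_derive s 1 phi (dphi s).
  move=> sh.
  have /is_derive_line h1 := derivableP (dfu _ (hO s h sh hhh)).
  have /is_derive_line h2 := derivableP (dfu _ (hO0 s sh)).
  exact: (is_deriveB h1 h2).
have [s sh E1] : exists2 c, c \in `[0, h]%R & phi h - phi 0 = dphi c * (h - 0).
  apply: MVT_segment; first exact: ltW.
    by move=> y; rewrite in_itv/= => /andP[y0 y1]; apply: phiP; rewrite !ltW.
  apply: derivable_within_continuous => y; rewrite in_itv/= => yh.
  by have [] := phiP _ yh.
rewrite in_itv/= in sh.
pose psi (t : R) := 'D_u f (t *: v + (s *: u + x)).
pose dpsi (t : R) := 'D_v (fun y => 'D_u f y) (t *: v + (s *: u + x)).
have psiP (t : R) : 0 <= t <= h -> is_derive t 1 psi (dpsi t).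
  move=> th; have := hO s t sh th; rewrite addrCA => Ost.
  by have /is_derive_line := derivableP (dfuv _ Ost).
have [t th E2] : exists2 c, c \in `[0, h]%R & psi h - psi 0 = dpsi c * (h - 0).
  apply: MVT_segment; first exact: ltW.
    by move=> y; rewrite in_itv/= => /andP[y0 y1]; apply: psiP; rewrite !ltW.
  apply: derivable_within_continuous => y; rewrite in_itv/= => yh.
  by have [] := psiP _ yh.
rewrite in_itv/= in th.
exists s, t; split => //.
have -> : f (h *: u + (h *: v + x)) - f (h *: u + x) - f (h *: v + x) + f x
  = phi h - phi 0 by rewrite /phi !scale0r !add0r; ring.
rewrite E1 subr0; congr (_ * _).
have -> : dphi s = psi h - psi 0.
  by rewrite /dphi /psi scale0r add0r addrCA.
by rewrite E2 subr0 /dpsi addrCA.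
Qed.

Lemma mulIf2 (h P Q a b : R) : 0 < h ->
  a = P * h * h -> b = Q * h * h -> a = b -> P = Q.
Proof.
move=> h0 -> -> PQ; have h0' : h != 0 by rewrite gt_eqF.
by apply: (mulIf h0'); apply: (mulIf h0').
Qed.

Lemma dist_le_halves (e a b c d : R) :
  `|a - b| < e / 2 -> `|d - c| < e / 2 -> b = c -> `|a - d| <= e.
Proof.
move=> h1 h2 bc; rewrite bc in h1.
rewrite (_ : a - d = (a - c) - (d - c)); last by ring.
by apply: le_trans (ler_normB _ _) _; lra.
Qed.

Lemma schwarz (V : normedModType R) (O : set V) (f : V -> R) x u v :
  open O -> O x -> Ck 2 O f ->
  'D_v (fun y => 'D_u f y) x = 'D_u (fun y => 'D_v f y) x.
Proof.
move=> oO Ox hf.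
have cont w w' : {for x, continuous (fun y => 'D_w' (fun y => 'D_w f y) y)}.
  by have [_ /(_ w)[_ [_ /(_ w')[_ [c _]]]]] := hf; exact: c.
apply/eqP; rewrite -subr_eq0 -normr_le0; apply/ler_addgt0Pr => e e0; rewrite add0r.
have e2 : 0 < e / 2 by rewrite divr_gt0.
have /nbhs_normP[del /= del0 hdel] : \forall y \near x, [/\ O y,
    `|'D_v (fun y => 'D_u f y) x - 'D_v (fun y => 'D_u f y) y| < e / 2 &
    `|'D_u (fun y => 'D_v f y) x - 'D_u (fun y => 'D_v f y) y| < e / 2].
  have /cvgrPdist_lt /(_ _ e2) h1 := cont u v.
  have /cvgrPdist_lt /(_ _ e2) h2 := cont v u.
  by apply: filterS3 (near_in_open oO Ox) h1 h2 => y; exact: And3.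
(* The summand 1 keeps [N] positive when u and v vanish and makes the inequality [uv] strict; with h
   N < del the whole rectangle of sides h u and h v lies in the ball. *)
pose N : R := `|u| + `|v| + 1.
have N0 : 0 < N by rewrite /N; have := normr_ge0 u; have := normr_ge0 v; lra.
pose h : R := del / 2 / N.
have h0 : 0 < h by rewrite !divr_gt0.
have hN : h * N < del.
  by rewrite /h divfK ?gt_eqF// ltr_pdivrMr// ltr_pMr// ltr1n.
have close s t w w' : `|w| + `|w'| < N -> 0 <= s <= h -> 0 <= t <= h ->
    `|x - (s *: w + (t *: w' + x))| < del.
  move=> wN /andP[s0 sh] /andP[t0 th]; rewrite addrA opprD addrCA subrr addr0 normrN.
  apply: le_lt_trans (ler_normD _ _) _; rewrite !normrZ (ger0_norm s0) (ger0_norm t0).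
  apply: le_lt_trans hN; have := normr_ge0 w; have := normr_ge0 w'.
  move=> w'0 w0.
  have h1 := ler_wpM2r w0 sh; have h2 := ler_wpM2r w'0 th.
  have h3 := ler_wpM2l (ltW h0) (ltW wN).
  by lra.
have uv : `|u| + `|v| < N by rewrite /N ltrDl.
have vu : `|v| + `|u| < N by rewrite addrC.
have [s [t [hs ht E1]]] := @second_difference _ O f x u v h h0 hf
  (fun s t hs ht => let: And3 o _ _ := hdel _ (close s t u v uv hs ht) in o).
have [s' [t' [hs' ht' E2]]] := @second_difference _ O f x v u h h0 hf
  (fun s t hs ht => let: And3 o _ _ := hdel _ (close s t v u vu hs ht) in o).
have [_ b1 _] := hdel _ (close s t u v uv hs ht).
have [_ _ b2] := hdel _ (close s' t' v u vu hs' ht').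
apply: (dist_le_halves b1 b2); apply: (mulIf2 h0 E1 E2).
by rewrite (addrCA (h *: u)); congr (_ + _); exact: addrAC.
Qed.

Lemma Ck_det (V : normedModType R) k (O : set V) n (A : V -> 'M[R]_n) : open O ->
  (forall i j, Ck k O (fun x => A x i j)) -> Ck k O (fun x => \det (A x)).
Proof.
move=> oO hA; apply: Ck_sum => // s; apply: Ck_mul => //; first exact: Ck_cst.
by apply: Ck_prod.
Qed.

(** By Cramer's rule the entries of the inverse are cofactors divided by the determinant. *)
Lemma Ck_invmx (V : normedModType R) k (O : set V) n (A : V -> 'M[R]_n) :
  open O -> (forall x, O x -> A x \in unitmx) ->
  (forall i j, Ck k O (fun x => A x i j)) ->
  forall i j, Ck k O (fun x => invmx (A x) i j).
Proof.
move=> oO uA hA i j.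
have : Ck k O (fun x => (\det (A x))^-1 * (\adj (A x)) i j).
  apply: Ck_mul => //.
    apply: Ck_inv => //; last exact: Ck_det.
    by move=> x /uA; rewrite unitmxE unitfE.
  have : Ck k O (fun x => cofactor (A x) j i).
    apply: Ck_mul => //; first exact: Ck_cst.
    apply: Ck_det => // a b.
    by apply: Ck_ext oO _ (hA (lift j a) (lift i b)) => x _; rewrite !mxE.
  by apply: Ck_ext => // x _; rewrite !mxE.
by apply: Ck_ext => // x Ox; rewrite /invmx uA// [RHS]mxE.
Qed.

End SmoothTheory.

(** * Connection and curvature in one chart *)

Ltac mx_abel :=
  repeat match goal with |- context [mulmx ?A ?B] =>
    move: (mulmx A B) => ? end;
  apply/matrixP => ? ?; rewrite !mxE; ring.

(** [C] and [D] stand for the connection matrices in directions c and d, [A] for the c-derivative of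
    [D], [B] for the d-derivative of [C]. The hypothesis equates the two mixed second derivatives of
    the metric, each expanded by metric compatibility. *)
Lemma curv_skew_alg (R : realType) n (A B C D H : 'M[R]_n) :
  A^T *m H + D^T *m (C^T *m H + H *m C) + ((C^T *m H + H *m C) *m D + H *m A) =
  B^T *m H + C^T *m (D^T *m H + H *m D) + ((D^T *m H + H *m D) *m C + H *m B) ->
  H *m (A - B + (C *m D - D *m C)) + (A - B + (C *m D - D *m C))^T *m H = 0.
Proof.
move/eqP; rewrite -subr_eq0 => /eqP <-.
rewrite !(raddfD, raddfN, raddfB) /= !trmx_mul.
rewrite !(mulmxDl, mulmxDr, mulmxBl, mulmxBr, mulNmx, mulmxN) !mulmxA.
mx_abel.
Qed.

Lemma eq_opp_of_add0 (R : realType) (a b : R) : a + b = 0 -> a = - b.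
Proof. by move/eqP; rewrite addr_eq0 => /eqP. Qed.

Section LocalMetric.
Context {R : realType}.
Implicit Types (x : 'cV[R]_4) (a b c d : 'I_4).

Definition christoffel (G : 'cV[R]_4 -> 'M[R]_4) x a b c : R :=
  2^-1 * \sum_d invmx (G x) a d *
    (partial b (fun y => G y d c) x + partial c (fun y => G y d b) x
     - partial d (fun y => G y b c) x).

Definition curv (Gam : 'cV[R]_4 -> 'I_4 -> 'I_4 -> 'I_4 -> R) x a b c d : R :=
  partial c (fun y => Gam y a d b) x - partial d (fun y => Gam y a c b) x
  + \sum_e (Gam x a c e * Gam x e d b - Gam x a d e * Gam x e c b).

(** The connection form along the c-th coordinate vector: the covariant derivative of v is its c-th
    partial derivative plus this matrix applied to v. *)
Definition conn_mx (Gam : 'cV[R]_4 -> 'I_4 -> 'I_4 -> 'I_4 -> R) c x : 'M[R]_4 :=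
  \matrix_(a, b) Gam x a c b.

Definition curv_mx (Gam : 'cV[R]_4 -> 'I_4 -> 'I_4 -> 'I_4 -> R) x c d : 'M[R]_4 :=
  \matrix_(a, b) curv Gam x a b c d.

Definition partial_mx c (F : 'cV[R]_4 -> 'M[R]_4) x : 'M[R]_4 :=
  \matrix_(a, b) partial c (fun y => F y a b) x.

(** Cartan's structure equation; it turns the later index computations into matrix identities. *)
Lemma curv_mxE Gam x c d : curv_mx Gam x c d =
  partial_mx c (conn_mx Gam d) x - partial_mx d (conn_mx Gam c) x
  + (conn_mx Gam c x *m conn_mx Gam d x - conn_mx Gam d x *m conn_mx Gam c x).
Proof.
apply/matrixP => a b; rewrite !mxE /curv sumrB; congr (_ - _ + _).
- by congr (partial c _ x); apply/funext => y; rewrite mxE.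
- by congr (partial d _ x); apply/funext => y; rewrite mxE.
by congr (_ - _); apply: eq_bigr => e _; rewrite !mxE.
Qed.

Variable O : set 'cV[R]_4.
Hypothesis oO : open O.

Lemma is_derive_partial (f : 'cV[R]_4 -> R) c x : smooth_on O f -> O x ->
  is_derive x (delta_mx c 0) f (partial c f x).
Proof. by move=> h Ox; apply: derivableP; exact: smooth_derivable h Ox. Qed.

Lemma is_derive_partial_mx (F : 'cV[R]_4 -> 'M[R]_4) c x :
  (forall a b, smooth_on O (fun y => F y a b)) -> O x ->
  is_derive x (delta_mx c 0) F (partial_mx c F x).
Proof.
by move=> h Ox; apply/is_derive_mxP => a b; rewrite mxE; exact: is_derive_partial.
Qed.

Lemma partial_near_eq (f h : 'cV[R]_4 -> R) c x : O x ->
  (forall y, O y -> f y = h y) -> partial c f x = partial c h x.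
Proof.
move=> Ox fh; apply: near_eq_derive.
by apply: filterS (near_in_open oO Ox) => y /fh.
Qed.

Lemma partial_comm (f : 'cV[R]_4 -> R) c d x : smooth_on O f -> O x ->
  partial c (partial d f) x = partial d (partial c f) x.
Proof. by move=> h Ox; exact: (schwarz _ _ oO Ox (h 2%N)). Qed.

Section Metric.
Variable G : 'cV[R]_4 -> 'M[R]_4.
Hypothesis sG : forall a b, smooth_on O (fun y => G y a b).
Hypothesis symG : forall x, O x -> (G x)^T = G x.
Hypothesis uG : forall x, O x -> G x \in unitmx.

Local Notation Gam := (christoffel G).

Lemma partial_sym x a b c : O x ->
  partial c (fun y => G y a b) x = partial c (fun y => G y b a) x.
Proof.
move=> Ox; apply: (partial_near_eq _ Ox) => y Oy.
by rewrite -{1}(symG Oy) mxE.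
Qed.

Lemma christoffel_sym x a b c : O x -> Gam x a b c = Gam x a c b.
Proof.
move=> Ox; rewrite /christoffel; congr (_ * _); apply: eq_bigr => d _.
by rewrite (partial_sym b c d Ox) [X in X - _]addrC.
Qed.

Lemma christoffel_smooth a b c : smooth_on O (fun x => Gam x a b c).
Proof.
move=> k; apply: Ck_mul => //; first exact: Ck_cst.
apply: Ck_sum => // d; apply: Ck_mul => //.
  by apply: Ck_invmx => // i j; exact: sG.
apply: Ck_add => //; last by apply: Ck_opp => //; exact: smooth_derive.
by apply: Ck_add => //; exact: smooth_derive.
Qed.

Lemma conn_mx_smooth c a b : smooth_on O (fun x => conn_mx Gam c x a b).
Proof.
move=> k; apply: Ck_ext oO _ (@christoffel_smooth a c b k) => x _.
by rewrite mxE.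
Qed.

Lemma lower_christoffel x a b c : O x ->
  (G x *m conn_mx Gam b x) a c =
  2^-1 * (partial b (fun y => G y a c) x + partial c (fun y => G y a b) x
     - partial a (fun y => G y b c) x).
Proof.
move=> Ox.
pose K : 'M[R]_4 := \matrix_(d, e) (2^-1 *
   (partial b (fun y => G y d e) x + partial e (fun y => G y d b) x
     - partial d (fun y => G y b e) x)).
have -> : conn_mx Gam b x = invmx (G x) *m K.
  apply/matrixP => i j; rewrite !mxE /christoffel mulr_sumr; apply: eq_bigr => d _.
  by rewrite !mxE mulrCA.
by rewrite mulKVmx ?uG// mxE.
Qed.

Lemma metric_compat x c : O x ->
  partial_mx c G x = (conn_mx Gam c x)^T *m G x + G x *m conn_mx Gam c x.
Proof.
move=> Ox.
have -> : (conn_mx Gam c x)^T *m G x = (G x *m conn_mx Gam c x)^T.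
  by rewrite trmx_mul (symG Ox).
apply/matrixP => a b; rewrite 2![in RHS]mxE !lower_christoffel// [LHS]mxE.
rewrite (partial_sym a b c Ox) (partial_sym b c a Ox) (partial_sym a c b Ox).
rewrite -mulrDr; set X := partial _ _ _; set Y := partial _ _ _.
by set Z := partial _ _ _; move: X Y Z => X Y Z; field.
Qed.

(* Koszul's formula *)
Lemma christoffel_unique x (D : 'I_4 -> 'M[R]_4) : O x ->
  (forall a b c, D c a b = D b a c) ->
  (forall c, partial_mx c G x = (D c)^T *m G x + G x *m D c) ->
  forall c, D c = conn_mx Gam c x.
Proof.
move=> Ox tf comp c.
apply: (can_inj (mulKmx (uG Ox))); apply/matrixP => a b.
rewrite lower_christoffel//.
have P e p q : partial e (fun y => G y p q) x = (G x *m D e) q p + (G x *m D e) p q.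
  have /matrixP /(_ p q) := comp e; rewrite mxE => ->.
  have -> : (D e)^T *m G x = (G x *m D e)^T by rewrite trmx_mul (symG Ox).
  by rewrite 2!mxE.
have S e p q : (G x *m D e) p q = (G x *m D q) p e.
  by rewrite !mxE; apply: eq_bigr => f _; rewrite tf.
rewrite !P (S b c a) (S b a c) (S a b c).
set X := (_ *m _) _ _; set Y := (_ *m _) _ _; set Z := (_ *m _) _ _.
by move: X Y Z => X Y Z; field.
Qed.

Lemma curv_skew x c d : O x ->
  G x *m curv_mx Gam x c d + (curv_mx Gam x c d)^T *m G x = 0.
Proof.
move=> Ox.
have sGam e := @conn_mx_smooth e.
have key e f : partial_mx e (partial_mx f G) x =
   (partial_mx e (conn_mx Gam f) x)^T *m G x
   + (conn_mx Gam f x)^T *m partial_mx e G x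
   + (partial_mx e G x *m conn_mx Gam f x
      + G x *m partial_mx e (conn_mx Gam f) x).
  have h1 := is_derive_partial_mx e (sGam f) Ox.
  have h2 := is_derive_partial_mx e sG Ox.
  have h3 := is_deriveD (is_derive_mulmx (is_derive_trmx h1) h2)
    (is_derive_mulmx h2 h1).
  have neq : \forall y \near x, (conn_mx Gam f y)^T *m G y + G y *m conn_mx Gam f y
      = partial_mx f G y.
    by apply: filterS (near_in_open oO Ox) => y Oy; rewrite metric_compat.
  have /is_derive_mxP h4 := near_eq_is_derive neq h3.
  apply/matrixP => a b; rewrite mxE; have [_ E] := h4 a b.
  exact: E.
have sym : partial_mx c (partial_mx d G) x = partial_mx d (partial_mx c G) x.
  apply/matrixP => a b.
  have E e f : partial e (fun y => partial_mx f G y a b) x =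
      partial e (partial f (fun y => G y a b)) x.
    by apply: (partial_near_eq _ Ox) => y _; rewrite mxE.
  by rewrite [LHS]mxE [RHS]mxE !E; exact: partial_comm.
move: sym; rewrite (key c d) (key d c) (metric_compat c Ox) (metric_compat d Ox).
rewrite (curv_mxE Gam x c d).
exact: curv_skew_alg.
Qed.

Lemma bianchi1 x a b c d : O x ->
  curv Gam x a b c d + curv Gam x a c d b + curv Gam x a d b c = 0.
Proof.
move=> Ox; rewrite /curv.
have E e p q : partial e (fun y => Gam y a p q) x = partial e (fun y => Gam y a q p) x.
  by apply: (partial_near_eq _ Ox) => y Oy; rewrite christoffel_sym.
rewrite (E c b d) (E d c b) (E b d c).
have F : \sum_e (Gam x a c e * Gam x e d b - Gam x a d e * Gam x e c b)
 + \sum_e (Gam x a d e * Gam x e b c - Gam x a b e * Gam x e d c)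
 + \sum_e (Gam x a b e * Gam x e c d - Gam x a c e * Gam x e b d) = 0.
  rewrite -!big_split /=; apply: big1 => e _.
  rewrite (christoffel_sym e b c Ox) (christoffel_sym e c d Ox).
  rewrite (christoffel_sym e b d Ox).
  move: (Gam x a c e) (Gam x e d b) (Gam x a d e) (Gam x e c b) (Gam x a b e)
    (Gam x e d c) => *; ring.
move: F; set S1 := \sum_e _; set S2 := \sum_e _; set S3 := \sum_e _.
set X := partial _ _ _; set Y := partial _ _ _; set Z := partial _ _ _.
by move=> F; rewrite (_ : _ + _ + _ = S1 + S2 + S3)//; move: X Y Z => *; ring.
Qed.

(** The symmetry is a linear combination of the four cyclic identities that start with a, b, c and
    d, after the two antisymmetries. *)
Lemma pair_symmetry (L : 'I_4 -> 'I_4 -> 'I_4 -> 'I_4 -> R) :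
  (forall a b c d, L a b c d = - L b a c d) ->
  (forall a b c d, L a b c d = - L a b d c) ->
  (forall a b c d, L a b c d + L a c d b + L a d b c = 0) ->
  forall a b c d, L a b c d = L c d a b.
Proof.
move=> s1 s2 bi a b c d.
have h1 := bi a b c d; have h2 := bi b c d a; have h3 := bi c d a b.
have h4 := bi d a b c.
have e1 := s1 a b c d; have e2 := s1 a c d b; have e3 := s1 a d b c.
have e4 := s1 b c d a; have e5 := s1 b d a c; have e6 := s1 c d a b.
have f1 := s2 a b c d; have f2 := s2 a c d b; have f3 := s2 a d b c.
have f4 := s2 b c d a; have f5 := s2 b d a c; have f6 := s2 c d a b.
have g1 := s2 b a c d; have g2 := s2 c a b d; have g3 := s2 d a b c.
have g4 := s2 c b a d; have g5 := s2 d b a c; have g6 := s2 d c a b.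
lra.
Qed.

Lemma curv_antisym x a b c d : curv Gam x a b c d = - curv Gam x a b d c.
Proof.
rewrite /curv; rewrite -[\sum_e _]opprK -sumrN.
under [in LHS]eq_bigr => e _ do rewrite opprB.
set S := \sum_e _; set X := partial _ _ _; set Y := partial _ _ _.
by move: S X Y => *; ring.
Qed.

(** Pair symmetry of the lowered tensor exchanges the endomorphism indices with the direction
    indices, so a vector killed by all curvature endomorphisms also gives zero when contracted with
    a direction index. *)
Lemma curv_contract x (k : 'cV[R]_4) : O x ->
  (forall c d, curv_mx Gam x c d *m k = 0) ->
  forall d, \sum_c k c 0 *: curv_mx Gam x c d = 0.
Proof.
move=> Ox hk d.
pose L a b c d := (G x *m curv_mx Gam x c d) a b.
have LE a b p q : L a b p q = \sum_e G x a e * curv Gam x e b p q.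
  by rewrite /L mxE; apply: eq_bigr => e _; rewrite mxE.
have s1 a b p q : L a b p q = - L b a p q.
  have /matrixP /(_ a b) := curv_skew p q Ox.
  have -> : (curv_mx Gam x p q)^T *m G x = (G x *m curv_mx Gam x p q)^T.
    by rewrite trmx_mul (symG Ox).
  rewrite [X in X = _ -> _]mxE [X in _ + X = _ -> _]mxE [X in _ = X -> _]mxE => E.
  exact: eq_opp_of_add0 E.
have s2 a b p q : L a b p q = - L a b q p.
  rewrite !LE -sumrN; apply: eq_bigr => e _.
  by rewrite curv_antisym mulrN.
have bi a b p q : L a b p q + L a p q b + L a q b p = 0.
  rewrite !LE -!big_split /=; apply: big1 => e _.
  by rewrite -!mulrDr bianchi1// mulr0.
have ps := pair_symmetry s1 s2 bi.
apply: (can_inj (mulKmx (uG Ox))); rewrite mulmx0 mulmx_sumr.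
apply/matrixP => a b; rewrite summxE mxE.
transitivity (- \sum_c L d c a b * k c 0).
  rewrite -sumrN; apply: eq_bigr => c _.
  by rewrite -scalemxAr mxE -/(L a b c d) ps s1 mulrN mulrC.
have /(congr1 (fun v => (G x *m v) d 0)) := hk a b.
by rewrite mulmxA mulmx0 !mxE => ->; rewrite oppr0.
Qed.

End Metric.
End LocalMetric.

(** * Pointwise algebra of projectively related metrics *)

Section PointAlgebra.
Context {R : realType}.
Implicit Types (u v z : 'cV[R]_4) (G H : 'M[R]_4).

Definition dotv u v : R := \sum_a u a 0 * v a 0.

Lemma dotvE u v : (u^T *m v) 0 0 = dotv u v.
Proof. by rewrite mxE; apply: eq_bigr => a _; rewrite mxE. Qed.

Lemma dotvC u v : dotv u v = dotv v u.
Proof. by apply: eq_bigr => a _; rewrite mulrC. Qed.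

Lemma dotvDr u v z : dotv u (v + z) = dotv u v + dotv u z.
Proof. by rewrite /dotv -big_split; apply: eq_bigr => a _; rewrite mxE mulrDr. Qed.

Lemma dotvZr u (t : R) v : dotv u (t *: v) = t * dotv u v.
Proof. by rewrite /dotv mulr_sumr; apply: eq_bigr => a _; rewrite mxE mulrCA. Qed.

Lemma dotvBr u v z : dotv u (v - z) = dotv u v - dotv u z.
Proof. by rewrite -scaleN1r dotvDr dotvZr mulN1r. Qed.

Lemma dotv_delta u a : dotv u (delta_mx a 0) = u a 0.
Proof.
rewrite /dotv (bigD1 a)//= mxE !eqxx mulr1 big1 ?addr0// => b ba.
by rewrite mxE (negbTE ba) mulr0.
Qed.

Lemma dotv_mulmx u (M : 'M[R]_4) v : dotv (M *m u) v = dotv u (M^T *m v).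
Proof. by rewrite -!dotvE trmx_mul mulmxA. Qed.

Lemma vec_neq0 v : v != 0 -> exists a, v a 0 != 0.
Proof.
move=> v0; apply/existsP; apply: contra_neqT v0 => /existsPn h.
by apply/matrixP => a j; rewrite ord1 mxE; apply/eqP; have := h a; rewrite negbK.
Qed.

Lemma mulmx_wedge u v z : wedge u v *m z = dotv v z *: u - dotv u z *: v.
Proof.
rewrite /wedge mulmxBl -!mulmxA; congr (_ - _).
  by rewrite [v^T *m z]mx11_scalar dotvE mul_mx_scalar.
by rewrite [u^T *m z]mx11_scalar dotvE mul_mx_scalar.
Qed.

(** Some 2 by 2 minor [D] of the pair is nonzero; Cramer's rule in these two coordinates gives the
    dual covectors. *)
Lemma wedge_dual u v : wedge u v != 0 ->
  exists f1 f2, [/\ dotv f1 u = 1, dotv f1 v = 0, dotv f2 u = 0 & dotv f2 v = 1].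
Proof.
move=> F0.
have [i [j D0]] : exists i j, u i 0 * v j 0 - v i 0 * u j 0 != 0.
  apply: contrapT => h; move/eqP: F0; apply; apply/matrixP => i j.
  rewrite !mxE !big_ord1 !mxE; apply/eqP; apply: contrapT => /negP h'.
  by apply: h; exists i, j.
set D := _ - _ in D0.
exists (D^-1 *: (v j 0 *: delta_mx i 0 - v i 0 *: delta_mx j 0)).
exists (D^-1 *: (u i 0 *: delta_mx j 0 - u j 0 *: delta_mx i 0)).
have E (p q : R) a b w : dotv (D^-1 *: (p *: delta_mx a 0 - q *: delta_mx b 0)) w =
    D^-1 * (p * w a 0 - q * w b 0).
  by rewrite dotvC dotvZr dotvBr !dotvZr !dotv_delta.
rewrite !E; split.
- by rewrite (_ : _ - _ = D) ?mulVf// /D; ring.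
- by rewrite (_ : _ - _ = 0) ?mulr0//; ring.
- by rewrite (_ : _ - _ = 0) ?mulr0//; ring.
- by rewrite (_ : _ - _ = D) ?mulVf// /D; ring.
Qed.

Lemma half_eq0 (t : R) : t = - t -> t = 0.
Proof. by move=> h; lra. Qed.

(* For a simple bivector the symmetric products of Eu, v and of Ev, u agree, and
   evaluating them on the dual covectors shows that u and v are eigenvectors. *)
Lemma simple_bivector_eigen G H u v : G^T = G -> H^T = H -> G \in unitmx ->
  wedge u v != 0 -> H *m wedge u v *m G = G *m wedge u v *m H ->
  exists a : R, H *m u = a *: (G *m u) /\ H *m v = a *: (G *m v).
Proof.
move=> sG sH uG F0 E.
have [f1 [f2 [f1u f1v f2u f2v]]] := wedge_dual F0.
pose U := invmx G *m (H *m u); pose W := invmx G *m (H *m v).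
have EU : G *m U = H *m u by rewrite /U mulKVmx.
have EW : G *m W = H *m v by rewrite /W mulKVmx.
have key z : dotv v z *: U - dotv u z *: W = dotv W z *: u - dotv U z *: v.
  have iGs : (invmx G)^T = invmx G by rewrite trmx_inv sG.
  have dU : dotv U z = dotv u (H *m (invmx G *m z)).
    by rewrite /U !dotv_mulmx iGs sH.
  have dW : dotv W z = dotv v (H *m (invmx G *m z)).
    by rewrite /W !dotv_mulmx iGs sH.
  have L : invmx G *m (H *m wedge u v *m G *m (invmx G *m z)) =
      dotv v z *: U - dotv u z *: W.
    rewrite -!mulmxA mulKVmx// mulmx_wedge !mulmxBr.
    by rewrite -!scalemxAr.
  have r : invmx G *m (G *m wedge u v *m H *m (invmx G *m z)) =
      dotv W z *: u - dotv U z *: v.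
    by rewrite -!mulmxA mulKmx// mulmx_wedge dU dW.
  by rewrite -L -r E.
have := key f2; rewrite (dotvC u) (dotvC v) f2u f2v scale1r scale0r subr0 => KU.
have := key f1; rewrite (dotvC u) (dotvC v) f1u f1v scale1r scale0r sub0r => KW.
(* Pairing [KU] with [f2] gives a number equal to its own negative; the coefficient of v thus
   vanishes and u is an eigenvector. *)
have U2 : dotv U f2 = 0.
  have := congr1 (dotv f2) KU; rewrite dotvBr !dotvZr f2u f2v mulr0 mulr1 sub0r.
  by rewrite (dotvC f2 U) => /half_eq0.
have W1 : dotv W f1 = 0.
  have := congr1 (dotv f1) KW; rewrite dotvBr -scaleN1r !dotvZr f1u f1v mulr0 mulr1 subr0.
  by rewrite (dotvC f1 W) mulN1r => /esym /half_eq0.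
rewrite U2 scale0r subr0 in KU; rewrite W1 scale0r sub0r in KW.
move/oppr_inj: KW => KW.
exists (dotv W f2); split; first by rewrite -EU KU scalemxAr.
rewrite -EW [in LHS]KW -scalemxAr; congr (_ *: _).
by rewrite KU dotvC dotvZr f1u mulr1.
Qed.

(** The matrix with rows z0, ..., z3 annihilates s, so it is singular, and a vector in its left
    kernel is the dependence. *)
Lemma four_dependent (s z0 z1 z2 z3 : 'cV[R]_4) : s != 0 ->
  dotv s z0 = 0 -> dotv s z1 = 0 -> dotv s z2 = 0 -> dotv s z3 = 0 ->
  exists c0 c1 c2 c3 : R,
    c0 *: z0 + c1 *: z1 + c2 *: z2 + c3 *: z3 = 0 /\
    ~~ [&& c0 == 0, c1 == 0, c2 == 0 & c3 == 0].
Proof.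
move=> s0 h0 h1 h2 h3.
pose zs := [:: z0; z1; z2; z3].
pose A : 'M[R]_4 := \matrix_(i, j) (nth 0 zs i) j 0.
have As : A *m s = 0.
  apply/matrixP => i j; rewrite ord1 !mxE.
  transitivity (dotv s (nth 0 zs i)).
    by rewrite dotvC; apply: eq_bigr => a _; rewrite mxE.
  by case: i => -[|[|[|[|]]]].
have /det0P[w w0 wA] : \det A == 0.
  apply: contra_neqT s0 => dA; have uA : A \in unitmx by rewrite unitmxE unitfE.
  by rewrite -[s](mulKmx uA) As mulmx0.
exists (w 0 0), (w 0 1), (w 0 2%:R), (w 0 3%:R); split.
  apply/matrixP => a j; rewrite ord1 !mxE.
  have /matrixP /(_ 0 a) := wA; rewrite !mxE => <-.
  rewrite !big_ord_recl big_ord0 addr0 !mxE /= !addrA.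
  by congr (_ + _ + _ + _); congr (w _ _ * _); apply: val_inj.
apply: contra w0 => /and4P[/eqP e0 /eqP e1 /eqP e2 /eqP e3].
apply/eqP/matrixP => i j; rewrite ord1 mxE.
case: j => -[|[|[|[|//]]]] hj.
- by rewrite -e0; congr (w _ _); apply: val_inj.
- by rewrite -e1; congr (w _ _); apply: val_inj.
- by rewrite -e2; congr (w _ _); apply: val_inj.
- by rewrite -e3; congr (w _ _); apply: val_inj.
Qed.

Lemma wedge_indep u v (a b : R) : wedge u v != 0 -> a *: u + b *: v = 0 ->
  a = 0 /\ b = 0.
Proof.
move=> F0 h; have [f1 [f2 [f1u f1v f2u f2v]]] := wedge_dual F0; split.
  have := congr1 (dotv f1) h; rewrite dotvDr !dotvZr f1u f1v mulr1 mulr0 addr0 => ->.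
  by rewrite -[0](scale0r u) dotvZr mul0r.
have := congr1 (dotv f2) h; rewrite dotvDr !dotvZr f2u f2v mulr1 mulr0 add0r => ->.
by rewrite -[0](scale0r u) dotvZr mul0r.
Qed.

Lemma wedge_lincomb u v (a b c d : R) :
  wedge (a *: u + b *: v) (c *: u + d *: v) = (a * d - b * c) *: wedge u v.
Proof.
by apply/matrixP => i j; rewrite !mxE !big_ord1 !mxE; ring.
Qed.

Lemma wedge_ann u v z : wedge u v != 0 -> wedge u v *m z = 0 ->
  dotv z u = 0 /\ dotv z v = 0.
Proof.
move=> F0; rewrite mulmx_wedge => h.
have [] := @wedge_indep u v (dotv v z) (- dotv u z) F0; first by rewrite scaleNr.
by rewrite (dotvC v) (dotvC u) => -> /eqP; rewrite oppr_eq0 => /eqP ->.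
Qed.

(** Both planes lie in the three-dimensional hyperplane orthogonal to k, so they share a nonzero
    vector and their eigenvalues agree. As the bivectors are not proportional, u2 or v2 lies outside
    the plane of u1 and v1, and together with u1 and v1 it spans the hyperplane. *)
Lemma class_C_eigen G H k u1 v1 u2 v2 : G^T = G -> H^T = H ->
  G \in unitmx -> k != 0 ->
  wedge u1 v1 != 0 -> wedge u2 v2 != 0 ->
  (forall t : R, wedge u2 v2 != t *: wedge u1 v1) ->
  wedge u1 v1 *m (G *m k) = 0 -> wedge u2 v2 *m (G *m k) = 0 ->
  H *m wedge u1 v1 *m G = G *m wedge u1 v1 *m H ->
  H *m wedge u2 v2 *m G = G *m wedge u2 v2 *m H ->
  exists a : R, forall z, dotv (G *m k) z = 0 -> H *m z = a *: (G *m z).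
Proof.
move=> sG sH uG k0 F1 F2 indep A1 A2 E1 E2.
have s0 : G *m k != 0.
  by apply: contra_neq k0 => h; rewrite -[k](mulKmx uG) h mulmx0.
set s := G *m k in A1 A2 s0 *.
have [su1 sv1] := wedge_ann F1 A1; have [su2 sv2] := wedge_ann F2 A2.
have [a1 [Hu1 Hv1]] := simple_bivector_eigen sG sH uG F1 E1.
have [a2 [Hu2 Hv2]] := simple_bivector_eigen sG sH uG F2 E2.
have Ginj z : G *m z = 0 -> z = 0.
  by move=> h; rewrite -[z](mulKmx uG) h mulmx0.
(* The dependence of the four vectors yields z in both planes; if z were 0, both halves of the
   dependence would be trivial. *)
have a12 : a1 = a2.
  have [c0 [c1 [c2 [c3 [dep ne]]]]] := four_dependent s0 su1 sv1 su2 sv2.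
  set z := c0 *: u1 + c1 *: v1.
  have zE : z = - (c2 *: u2 + c3 *: v2).
    by apply/eqP; rewrite -addr_eq0 /z addrA dep.
  have Hz1 : H *m z = a1 *: (G *m z).
    by rewrite /z !mulmxDr -!scalemxAr Hu1 Hv1 scalerDr !scalerA !(mulrC a1).
  have Hz2 : H *m z = a2 *: (G *m z).
    rewrite zE !mulmxN !mulmxDr -!scalemxAr Hu2 Hv2 scalerN scalerDr !scalerA.
    by rewrite !(mulrC a2).
  have /eqP : (a1 - a2) *: (G *m z) = 0 by rewrite scalerBl -Hz1 -Hz2 subrr.
  rewrite scaler_eq0 subr_eq0 => /orP[/eqP//|/eqP /Ginj zz].
  have [e0 e1] := wedge_indep F1 zz.
  have [e2 e3] := wedge_indep F2 (etrans (esym (opprK _)) (etrans (congr1 -%R (etrans (esym zE) zz)) (oppr0 _))).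
  by move: ne; rewrite e0 e1 e2 e3 !eqxx.
rewrite -a12 in Hu2 Hv2.
have span_t t : dotv s t = 0 -> H *m t = a1 *: (G *m t) ->
    ~ (exists a b : R, t = a *: u1 + b *: v1) ->
    forall z, dotv s z = 0 -> H *m z = a1 *: (G *m z).
  move=> st Ht nt z sz.
  have [c0 [c1 [c2 [c3 [dep ne]]]]] := four_dependent s0 su1 sv1 st sz.
  have c30 : c3 != 0.
    apply/eqP => c30; move: dep ne; rewrite c30 scale0r addr0 eqxx andbT => dep ne.
    case: (eqVneq c2 0) => [c20|c20].
      move: dep ne; rewrite c20 scale0r addr0 eqxx andbT => dep.
      by have [-> ->] := wedge_indep F1 dep; rewrite eqxx.
    apply: nt; exists (- (c2^-1 * c0)), (- (c2^-1 * c1)).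
    apply: (scalerI c20); rewrite scalerDr !scalerA !mulrN !mulrA mulfV// !mul1r !scaleNr.
    by apply/eqP; rewrite -opprD -addr_eq0 addrC dep.
  have zE : c3 *: z = - (c0 *: u1 + c1 *: v1 + c2 *: t).
    by apply/eqP; rewrite -addr_eq0 addrC dep.
  apply: (scalerI c30); rewrite scalemxAr zE scalerA mulrC -scalerA scalemxAr zE.
  rewrite !mulmxN !mulmxDr -!scalemxAr Hu1 Hv1 Ht scalerN !scalerDr !scalerA.
  by rewrite !(mulrC a1).
exists a1.
case: (pselect (exists a b : R, u2 = a *: u1 + b *: v1)) => [[a [b u2E]]|]; last first.
  exact: span_t.
case: (pselect (exists a b : R, v2 = a *: u1 + b *: v1)) => [[c [d v2E]]|]; last first.
  exact: span_t.
exfalso; have /eqP := indep (a * d - b * c); apply.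
by rewrite u2E v2E wedge_lincomb.
Qed.

End PointAlgebra.

Section ProjectiveAlgebra.
Context {R : realType}.

(** [C], [D] are connection matrices, [A], [B] their derivatives as in [curv_skew_alg]; p, q are the
    components of psi along ec, ed; [dp], [dq] are the partial derivatives of psi, and s, t their
    components along ed, ec. The first hypothesis is the absence of torsion. *)
Lemma proj_curv_alg (A B C D : 'M[R]_4) (p q : R) (s t : R)
    (psi dp dq ec ed : 'cV[R]_4) :
  C *m ed = D *m ec -> psi^T *m ec = p%:M -> psi^T *m ed = q%:M ->
  (A + s%:M + ed *m dp^T) - (B + t%:M + ec *m dq^T)
  + ((C + p%:M + ec *m psi^T) *m (D + q%:M + ed *m psi^T)
     - (D + q%:M + ed *m psi^T) *m (C + p%:M + ec *m psi^T)) =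
  A - B + (C *m D - D *m C) + (s - t)%:M
  + ed *m (dp - C^T *m psi - p *: psi)^T
  - ec *m (dq - D^T *m psi - q *: psi)^T.
Proof.
move=> CD pe qe.
rewrite !(raddfB, raddfN, raddfD) /= !linearZ /= !trmx_mul !trmxK.
rewrite !(mulmxDl, mulmxDr, mulmxBl, mulmxBr, mulmxN, mulNmx).
rewrite !mul_scalar_mx !mul_mx_scalar.
have e1 : (ec *m psi^T) *m (ed *m psi^T) = q *: (ec *m psi^T).
  by rewrite -!mulmxA (mulmxA psi^T) qe mul_scalar_mx -scalemxAr.
have e2 : (ed *m psi^T) *m (ec *m psi^T) = p *: (ed *m psi^T).
  by rewrite -!mulmxA (mulmxA psi^T) pe mul_scalar_mx -scalemxAr.
rewrite !mulmxA in e1 e2 *.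
rewrite e1 e2 CD !scale_scalar_mx (mulrC q p).
move: (s%:M) (t%:M) ((p * q)%:M) => ? ? ?.
mx_abel.
Qed.

Lemma tr_skew (G X : 'M[R]_4) : G \in unitmx ->
  G *m X + X^T *m G = 0 -> \tr X = 0.
Proof.
move=> uG h.
have E : G *m X = - (X^T *m G) by apply/eqP; rewrite -addr_eq0 h.
apply: half_eq0; rewrite -{1}[X](mulKmx uG) E mulmxN linearN /=.
by rewrite mxtrace_mulC mulmxK// mxtrace_tr.
Qed.

(* The symmetric product of the covectors H e_d and p equals that of h and P_d;
   since H is invertible and h nonzero, unique factorisation forces P = kappa H. *)
Lemma symprod_factor (H P : 'M[R]_4) (p h : 'cV[R]_4) : H \in unitmx -> h != 0 ->
  (forall d i j, H d i * p j 0 + p i 0 * H d j = h i 0 * P d j + P d i * h j 0) ->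
  exists kap : R, P = kap *: H.
Proof.
move=> uH h0 hyp.
have [ o ho] := vec_neq0 h0.
pose S := invmx H *m P.
(* Multiplication by the inverse of [H] replaces [H] by the identity; instances with indices in i
   and o, where h o is nonzero, then determine p and [S]. *)
have key a i j : (a == i)%:R * p j 0 + p i 0 * (a == j)%:R =
    h i 0 * S a j + S a i * h j 0.
  have h1 b : \sum_d invmx H a d * H d b = (a == b)%:R.
    have /matrixP /(_ a b) := mulVmx uH; rewrite !mxE => <-.
    by apply: eq_bigr => d _.
  rewrite -(h1 i) -(h1 j) /S !mxE !mulr_suml !mulr_sumr -!big_split /=.
  apply: eq_bigr => d _; have := hyp d i j.
  move: (invmx H a d) (H d i) (p j 0) (p i 0) (H d j) (h i 0) (P d j) (P d i) (h j 0).
  move=> c a1 a2 a3 a4 a5 a6 a7 a8 E.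
  rewrite (_ : c * a1 * a2 + a3 * (c * a4) = c * (a1 * a2 + a3 * a4)); last by ring.
  by rewrite E; ring.
pose kap := p o 0 / h o 0.
have pE i : p i 0 = kap * h i 0.
  case: (eqVneq i o) => [->|io]; first by rewrite /kap divfK.
  have := key i i i; rewrite eqxx mul1r mulr1 => k1.
  have := key i i o; rewrite eqxx (negbTE io) mul1r mulr0 addr0 => k2.
  have := key i o o; rewrite (negbTE io) mul0r mulr0 add0r => k3.
  rewrite mulrC -mulr2n in k3.
  have Sio : S i o = 0.
    by move/esym/eqP: k3; rewrite mulrn_eq0 /= mulf_eq0 (negbTE ho) orbF => /eqP.
  rewrite Sio mulr0 add0r in k2.
  have Sii : S i i = kap by rewrite /kap k2 mulfK.
  by move: k1; rewrite Sii mulrC => k1; lra.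
have SE a i : S a i = kap * (a == i)%:R.
  have := key a o o; have := key a i o.
  rewrite !pE => k1 k2.
  have Sao : S a o = kap * (a == o)%:R.
    apply: (mulIf ho); move: k2.
    by move: (S a o) ((a == o)%:R) (h o 0) => x1 x2 x3; lra.
  apply: (mulIf ho); move: k1; rewrite Sao.
  by move: (S a i) ((a == o)%:R) (h o 0) ((a == i)%:R) (h i 0) => x1 x2 x3 x4 x5; lra.
exists kap; rewrite -[P](mulKVmx uH) -/S.
have -> : S = kap%:M by apply/matrixP => a i; rewrite SE mxE mulr_natr.
by rewrite mul_mx_scalar.
Qed.

(* [P] stands for the Schouten-like tensor of psi; contracting with [k] makes it a
   multiple of [H] by [symprod_factor], and then its contributions cancel. *)
Lemma proj_curv_skew (G H : 'M[R]_4) (Ri Ri' : 'I_4 -> 'I_4 -> 'M[R]_4)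
    (P : 'I_4 -> 'cV[R]_4) (k : 'cV[R]_4) :
  G \in unitmx -> H \in unitmx -> H^T = H -> k != 0 ->
  (forall c d, G *m Ri c d + (Ri c d)^T *m G = 0) ->
  (forall c d, H *m Ri' c d + (Ri' c d)^T *m H = 0) ->
  (forall c d, Ri' c d = Ri c d + (P c d 0 - P d c 0)%:M
     + delta_mx d 0 *m (P c)^T - delta_mx c 0 *m (P d)^T) ->
  (forall d, \sum_c k c 0 *: Ri c d = 0) ->
  forall c d, H *m Ri c d + (Ri c d)^T *m H = 0.
Proof.
move=> uG uH sH k0 skG skH rel kR.
(* Endomorphisms skew for an invertible form are trace-free, and the trace of [rel] is 5 times this
   difference: 4 from the scalar matrix and 1 from the rank-one terms. *)
have w0 c d : P c d 0 - P d c 0 = 0.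
  have tP (e : 'I_4) (v : 'cV[R]_4) : \tr (delta_mx e 0 *m v^T) = v e 0.
    by rewrite mxtrace_mulC trace_mx11 dotvE dotv_delta.
  have := tr_skew uH (skH c d); rewrite rel !(linearD, linearN) /= !tP.
  by rewrite (tr_skew uG (skG c d)) mxtrace_scalar add0r -mulr_natr => ?; lra.
pose Q c d : 'M[R]_4 := \matrix_(i, j) (H d i * P c j 0 + P c i 0 * H d j
  - H c i * P d j 0 - P d i 0 * H c j).
have HR c d : H *m Ri c d + (Ri c d)^T *m H = - Q c d.
  have := skH c d; rewrite rel w0 [(0 : R)%:M](raddf0 _) addr0.
  have hs i j : H i j = H j i by rewrite -{1}sH mxE.
  have sp (e : 'I_4) (v : 'cV[R]_4) : H *m (delta_mx e 0 *m v^T)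
      + (delta_mx e 0 *m v^T)^T *m H = \matrix_(i, j) (H e i * v j 0 + v i 0 * H e j).
    have hd i j : (H *m (delta_mx e 0 *m v^T)) i j = H i e * v j 0.
      by rewrite mulmxA -colE mxE big_ord1 !mxE.
    have -> : (delta_mx e 0 *m v^T)^T *m H = (H *m (delta_mx e 0 *m v^T))^T.
      by rewrite [RHS]trmx_mul sH.
    apply/matrixP => i j; rewrite [LHS]mxE [X in _ + X]mxE !hd [RHS]mxE.
    by rewrite (hs i) (hs j) [X in _ + X]mulrC.
  have split3 (X Y Z : 'M[R]_4) : H *m (X + Y - Z) + (X + Y - Z)^T *m H =
      (H *m X + X^T *m H) + (H *m Y + Y^T *m H) - (H *m Z + Z^T *m H).
    rewrite !(raddfD, raddfB, raddfN) /= !(mulmxDr, mulmxDl, mulmxN, mulNmx).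
    mx_abel.
  rewrite split3 !sp => /eqP; rewrite subr_eq0 => /eqP E.
  apply: (addIr (\matrix_(i, j) (H d i * P c j 0 + P c i 0 * H d j))); rewrite E.
  by apply/matrixP => i j; rewrite !mxE; ring.
have [kap PE] : exists kap : R, (\matrix_(c, b) P c b 0) = kap *: H.
  pose p : 'cV[R]_4 := \sum_c k c 0 *: P c.
  have h0 : H *m k != 0.
    by apply: contra_neq k0 => h; rewrite -[k](mulKmx uH) h mulmx0.
  apply: (symprod_factor (p := p) uH h0) => d i j; rewrite ![in RHS]mxE.
  (* By [HR] this contraction is minus the symmetrised contraction of [Ri] with k, which [kR] makes
     zero. It is the symmetric product identity that [symprod_factor] takes as its hypothesis. *)
  have E : \sum_c k c 0 *: Q c d = 0.
    apply/eqP; rewrite -oppr_eq0 -sumrN; apply/eqP.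
    transitivity (H *m (\sum_c k c 0 *: Ri c d) + (\sum_c k c 0 *: Ri c d)^T *m H).
      rewrite mulmx_sumr raddf_sum mulmx_suml -big_split /=; apply: eq_bigr => c _.
      by rewrite -scalerN -HR [(_ *: _)^T]linearZ /= -scalemxAl -scalemxAr scalerDr.
    by rewrite kR trmx0 mulmx0 mul0mx addr0.
  have /matrixP /(_ i j) := E; rewrite summxE mxE => {}E.
  have pE b : p b 0 = \sum_c k c 0 * P c b 0.
    by rewrite /p summxE; apply: eq_bigr => c _; rewrite mxE.
  have hs a b : H a b = H b a by rewrite -{1}sH mxE.
  apply/eqP; rewrite -subr_eq0; apply/eqP; rewrite -[RHS]E !pE.
  rewrite !mulr_sumr !mulr_suml -!big_split /= -sumrB; apply: eq_bigr => c _.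
  by rewrite !mxE (hs i c) (hs j c); ring.
move=> c d; rewrite HR; apply/eqP; rewrite oppr_eq0; apply/eqP/matrixP => i j.
have PE' a b : P a b 0 = kap * H a b.
  by have /matrixP /(_ a b) := PE; rewrite !mxE.
by rewrite !mxE !PE'; ring.
Qed.

Lemma wedge0_colinear (u v : 'cV[R]_4) : v != 0 ->
  (forall i j, u i 0 * v j 0 = u j 0 * v i 0) -> exists t : R, u = t *: v.
Proof.
move=> v0 h; have [ o vo] := vec_neq0 v0; exists (u o 0 / v o 0).
apply/matrixP => i j; rewrite ord1 mxE; apply: (mulIf vo).
by rewrite h mulrAC divfK.
Qed.

(** Put q = G z and t = psi(z). After multiplication by the inverse of [H], the trace of the
    hypothesis gives 4 t q = (z . q) psi, and pairing this with z forces t = 0. What remains says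
    that G z is proportional to psi for all z in a hyperplane, if psi is nonzero; an invertible [G]
    cannot map three dimensions into a line. *)
Lemma projective_covector_eq0 (G H : 'M[R]_4) (k psi : 'cV[R]_4) (a : R) :
  G^T = G -> H^T = H -> G \in unitmx -> H \in unitmx -> k != 0 ->
  (forall z, dotv (G *m k) z = 0 -> H *m z = a *: (G *m z)) ->
  (forall z, dotv (G *m k) z = 0 -> forall c i j,
     ((H *m z) c 0 * psi i 0 + H c i * dotv psi z) * (G *m z) j 0 =
     ((H *m z) c 0 * psi j 0 + H c j * dotv psi z) * (G *m z) i 0) ->
  psi = 0.
Proof.
move=> sG sH uG uH k0 eig hyp.
have s0 : G *m k != 0.
  by apply: contra_neq k0 => h; rewrite -[k](mulKmx uG) h mulmx0.
set s := G *m k in eig hyp s0.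
have key z : dotv s z = 0 -> forall m i j,
    (z m 0 * psi i 0 + (m == i)%:R * dotv psi z) * (G *m z) j 0 =
    (z m 0 * psi j 0 + (m == j)%:R * dotv psi z) * (G *m z) i 0.
  move=> sz m i j.
  have h1 b : \sum_c invmx H m c * H c b = (m == b)%:R.
    have /matrixP /(_ m b) := mulVmx uH; rewrite !mxE => <-.
    by apply: eq_bigr => d _.
  have h2 : \sum_c invmx H m c * (H *m z) c 0 = z m 0.
    by have := mulKmx uH z => /matrixP /(_ m 0); rewrite mxE.
  rewrite -(h1 i) -(h1 j) -h2 !mulr_suml -!big_split !mulr_suml /=.
  apply: eq_bigr => c _; have := hyp z sz c i j.
  move: (invmx H m c) ((H *m z) c 0) (H c i) (H c j) ((G *m z) j 0) ((G *m z) i 0)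
    (dotv psi z) (psi i 0) (psi j 0) => x1 x2 x3 x4 x5 x6 x7 x8 x9 E.
  rewrite (_ : _ * x5 = x1 * ((x2 * x8 + x3 * x7) * x5)); last by ring.
  by rewrite E; ring.
have tau0 z : dotv s z = 0 -> dotv psi z = 0.
  move=> sz; case: (eqVneq z 0) => [->|z0].
    by rewrite -(scale0r 0) dotvZr mul0r.
  have q0 : G *m z != 0.
    by apply: contra_neq z0 => h; rewrite -[z](mulKmx uG) h mulmx0.
  set t := dotv psi z; set q := G *m z in q0 *.
  have e1 j : 4 * t * q j 0 = psi j 0 * dotv z q.
    have E : \sum_m (z m 0 * psi m 0 + (m == m)%:R * t) * q j 0 =
             \sum_m (z m 0 * psi j 0 + (m == j)%:R * t) * q m 0.
      by apply: eq_bigr => m _; exact: key.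
    have L : \sum_m (z m 0 * psi m 0 + (m == m)%:R * t) * q j 0 = 5 * t * q j 0.
      rewrite -mulr_suml big_split /= -/(dotv z psi) dotvC -/t; congr (_ * _).
      under eq_bigr do rewrite eqxx mul1r.
      by rewrite sumr_const card_ord -mulr_natr; ring.
    have r : \sum_m (z m 0 * psi j 0 + (m == j)%:R * t) * q m 0 =
        psi j 0 * dotv z q + t * q j 0.
      under eq_bigr do rewrite mulrDl.
      rewrite big_split /=; congr (_ + _).
        by rewrite /dotv mulr_sumr; apply: eq_bigr => m _; ring.
      rewrite (bigD1 j)//= eqxx mul1r big1 ?addr0// => m mj.
      by rewrite (negbTE mj) !mul0r.
    by move: E; rewrite L r => E; lra.
  have e2 : 4 * t * dotv z q = t * dotv z q.
    have : \sum_j z j 0 * (4 * t * q j 0) = \sum_j z j 0 * (psi j 0 * dotv z q).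
      by apply: eq_bigr => j _; rewrite e1.
    move=> E.
    have L : \sum_j z j 0 * (4 * t * q j 0) = 4 * t * dotv z q.
      by rewrite /dotv mulr_sumr; apply: eq_bigr => j _; ring.
    have r : \sum_j z j 0 * (psi j 0 * dotv z q) = t * dotv z q.
      by rewrite /t [dotv psi z]/dotv mulr_suml; apply: eq_bigr => j _; ring.
    by rewrite -L E r.
  have [ o qo] := vec_neq0 q0.
  case: (eqVneq (dotv z q) 0) => zq.
    have := e1 o; rewrite zq mulr0 => /eqP; rewrite mulf_eq0 (negbTE qo) orbF.
    by move/eqP => ?; lra.
  have /eqP : 3 * t * dotv z q = 0 by lra.
  by rewrite mulf_eq0 (negbTE zq) orbF => /eqP ?; lra.
apply/eqP/negP => /negP psi0.
have col z : dotv s z = 0 -> exists t : R, G *m z = t *: psi.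
  move=> sz; apply: wedge0_colinear => // i j.
  case: (eqVneq z 0) => [->|z0]; first by rewrite mulmx0 !mxE !mul0r.
  have [ o zo] := vec_neq0 z0; apply: (mulfI zo).
  have := key z sz o j i; rewrite (tau0 z sz) !mulr0 !addr0 => E.
  by rewrite mulrCA mulrC E; ring.
have [ o so] := vec_neq0 s0.
have [i [j [oi oj ij]]] : exists i j : 'I_4, [/\ o != i, o != j & i != j].
  by case: (eqVneq o 0) => [->|o0]; [exists 1, 2%:R|
    case: (eqVneq o 1) => [->|o1]; [exists 0, 2%:R|exists 0, 1]].
(* For i and j distinct from o these are two independent vectors of the hyperplane, whose images
   under [G] would both be multiples of psi. *)
pose z b : 'cV[R]_4 := s o 0 *: delta_mx b 0 - s b 0 *: delta_mx o 0.
have sz b : dotv s (z b) = 0 by rewrite dotvBr !dotvZr !dotv_delta mulrC subrr.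
have [ti Gi] := col _ (sz i); have [tj Gj] := col _ (sz j).
have E : tj *: z i = ti *: z j.
  rewrite -[z i](mulKmx uG) -[z j](mulKmx uG) Gi Gj -!scalemxAr !scalerA.
  by rewrite mulrC.
have zij b b' : o != b' -> z b b' 0 = s o 0 * (b' == b)%:R.
  by move=> ob'; rewrite !mxE !eqxx !andbT [b' == o]eq_sym (negbTE ob') mulr0 subr0.
have tj0 : tj = 0.
  have /matrixP /(_ i 0) := E; rewrite mxE [in X in _ = X -> _]mxE !zij// eqxx (negbTE ij).
  by rewrite !mulr0 mulr1 => /eqP; rewrite mulf_eq0 (negbTE so) orbF => /eqP.
have : z j = 0 by rewrite -[z j](mulKmx uG) Gj tj0 scale0r mulmx0.
move/matrixP => /(_ j 0); rewrite zij// eqxx mulr1 [X in _ = X -> _]mxE => /eqP.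
by rewrite (negbTE so).
Qed.

End ProjectiveAlgebra.

(** * Two projectively related metrics in one chart *)

Section LocalProjective.
Context {R : realType}.
Variable O : set 'cV[R]_4.
Hypothesis oO : open O.
Variables (G H : 'cV[R]_4 -> 'M[R]_4) (psi : 'cV[R]_4 -> 'cV[R]_4).
Hypothesis sG : forall a b, smooth_on O (fun y => G y a b).
Hypothesis symG : forall x, O x -> (G x)^T = G x.
Hypothesis uG : forall x, O x -> G x \in unitmx.
Hypothesis sH : forall a b, smooth_on O (fun y => H y a b).
Hypothesis symH : forall x, O x -> (H x)^T = H x.
Hypothesis uH : forall x, O x -> H x \in unitmx.
Hypothesis spsi : forall a, smooth_on O (fun y => psi y a 0).
Hypothesis rel : forall x, O x -> forall a b c,
  christoffel H x a b c =
  christoffel G x a b c + (a == b)%:R * psi x c 0 + (a == c)%:R * psi x b 0.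

Local Notation Gam := (christoffel G).
Local Notation Gam' := (christoffel H).

Lemma conn_mx_proj x c : O x -> conn_mx Gam' c x =
  conn_mx Gam c x + (psi x c 0)%:M + delta_mx c 0 *m (psi x)^T.
Proof.
move=> Ox; apply/matrixP => a b; rewrite !mxE rel// big_ord1 !mxE !eqxx andbT.
by rewrite addrAC (mulr_natl (psi x c 0)).
Qed.

Definition partial_psi c x : 'cV[R]_4 := \col_a partial c (fun y => psi y a 0) x.

(** Component a is the covariant derivative of psi_a in direction c, minus psi_c psi_a: the tensor
    that governs the projective change of curvature. *)
Definition schouten c x : 'cV[R]_4 :=
  partial_psi c x - (conn_mx Gam c x)^T *m psi x - psi x c 0 *: psi x.

Lemma partial_conn_proj x c d : O x -> partial_mx c (conn_mx Gam' d) x =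
  partial_mx c (conn_mx Gam d) x + (partial_psi c x d 0)%:M
  + delta_mx d 0 *m (partial_psi c x)^T.
Proof.
move=> Ox; apply/matrixP => a b.
rewrite [LHS]mxE [RHS]mxE [X in _ = X + _]mxE [X in _ = X + _ + _]mxE.
have h1 := is_derive_partial c (conn_mx_smooth oO sG uG d a b) Ox.
have h2 := is_derive_partial c (spsi d) Ox.
have h3 := is_derive_partial c (spsi b) Ox.
have h2' := is_derive_mulr (is_derive_cst ((a == b)%:R : R) x (delta_mx c 0)) h2.
have h3' := is_derive_mulr (is_derive_cst ((a == d)%:R : R) x (delta_mx c 0)) h3.
have [_ E] := is_deriveD (is_deriveD h1 h2') h3'.
rewrite (@partial_near_eq R O oO _ (fun y => conn_mx Gam d y a b
   + (a == b)%:R * psi y d 0 + (a == d)%:R * psi y b 0) c x Ox); last first.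
  move=> y Oy; rewrite conn_mx_proj// !mxE big_ord1 !mxE !eqxx andbT.
  by rewrite -(mulr_natl (psi y d 0)).
rewrite [LHS]E; congr (_ + _ + _).
  by rewrite mul0r add0r !mxE mulr_natl.
by rewrite mul0r add0r !mxE big_ord1 !mxE eqxx andbT.
Qed.

Lemma curv_proj x c d : O x ->
  curv_mx Gam' x c d = curv_mx Gam x c d
    + (schouten c x d 0 - schouten d x c 0)%:M
    + delta_mx d 0 *m (schouten c x)^T - delta_mx c 0 *m (schouten d x)^T.
Proof.
move=> Ox.
(* The connection terms are symmetric in c and d, so antisymmetrising leaves the exterior derivative
   of psi, the form that [proj_curv_alg] produces. *)
have -> : schouten c x d 0 - schouten d x c 0 =
    partial_psi c x d 0 - partial_psi d x c 0.
  rewrite !mxE.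
  have -> : \sum_j (conn_mx Gam d x)^T c j * psi x j 0 =
      \sum_j (conn_mx Gam c x)^T d j * psi x j 0.
    apply: eq_bigr => e _; rewrite !mxE.
    by rewrite (christoffel_sym oO symG _ _ _ Ox).
  by rewrite (mulrC (psi x d 0)); set S := \sum_j _; ring.
rewrite (curv_mxE Gam' x c d) (curv_mxE Gam x c d).
rewrite (partial_conn_proj c d Ox) (partial_conn_proj d c Ox).
rewrite (conn_mx_proj c Ox) (conn_mx_proj d Ox).
apply: proj_curv_alg.
- apply/matrixP => a j; rewrite -!colE !mxE.
  by rewrite (christoffel_sym oO symG _ _ _ Ox).
- by rewrite [LHS]mx11_scalar dotvE dotv_delta.
- by rewrite [LHS]mx11_scalar dotvE dotv_delta.
Qed.

Lemma curv_skew_proj x (k : 'cV[R]_4) : O x -> k != 0 ->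
  (forall c d, curv_mx Gam x c d *m k = 0) ->
  forall c d, H x *m curv_mx Gam x c d + (curv_mx Gam x c d)^T *m H x = 0.
Proof.
move=> Ox k0 hk.
apply: (@proj_curv_skew R (G x) (H x) (curv_mx Gam x) (curv_mx Gam' x)
  (fun c => schouten c x) k) => //.
- exact: uG.
- exact: uH.
- exact: symH.
- by move=> c d; exact: (curv_skew oO sG symG uG).
- by move=> c d; exact: (curv_skew oO sH symH uH).
- by move=> c d; exact: curv_proj.
- exact: (curv_contract oO sG symG uG Ox hk).
Qed.

Definition in_curv_range x (F : 'M[R]_4) := exists Phi : 'M[R]_4,
  F = \sum_c \sum_d Phi c d *: (curv_mx Gam x c d *m invmx (G x)).

(** F G is a linear combination of curvature endomorphisms. Hence it annihilates k and is skew for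
    [H]; with F antisymmetric, the latter is the commutation identity. *)
Lemma curv_range_props x (k : 'cV[R]_4) F : O x -> k != 0 ->
  (forall c d, curv_mx Gam x c d *m k = 0) ->
  in_curv_range x F -> F^T = - F ->
  F *m (G x *m k) = 0 /\ H x *m F *m G x = G x *m F *m H x.
Proof.
move=> Ox k0 hk [Phi FE] Fs.
pose X := \sum_c \sum_d Phi c d *: curv_mx Gam x c d.
have FX : F = X *m invmx (G x).
  rewrite FE /X mulmx_suml; apply: eq_bigr => c _.
  by rewrite mulmx_suml; apply: eq_bigr => d _; rewrite scalemxAl.
have XF : X = F *m G x by rewrite FX mulmxKV ?uG.
have Xk : X *m k = 0.
  rewrite /X mulmx_suml; apply: big1 => c _; rewrite mulmx_suml; apply: big1 => d _.
  by rewrite -scalemxAl hk scaler0.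
have HX : H x *m X + X^T *m H x = 0.
  rewrite /X mulmx_sumr [(\sum_(_ < _) _)^T]raddf_sum /= mulmx_suml -big_split /=; apply: big1 => c _.
  rewrite mulmx_sumr [(\sum_(_ < _) _)^T]raddf_sum /= mulmx_suml -big_split /=; apply: big1 => d _.
  rewrite [(_ *: _)^T]linearZ /= -scalemxAl -scalemxAr -scalerDr.
  by rewrite (curv_skew_proj Ox k0 hk) scaler0.
split; first by rewrite mulmxA -XF.
move: HX; rewrite XF trmx_mul Fs (symG Ox) mulmxN mulNmx => /eqP.
by rewrite subr_eq0 mulmxA => /eqP.
Qed.

Lemma class_C_eigen_proj x (k : 'cV[R]_4) u1 v1 u2 v2 : O x -> k != 0 ->
  (forall c d, curv_mx Gam x c d *m k = 0) ->
  wedge u1 v1 != 0 -> wedge u2 v2 != 0 ->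
  (forall t : R, wedge u2 v2 != t *: wedge u1 v1) ->
  in_curv_range x (wedge u1 v1) -> in_curv_range x (wedge u2 v2) ->
  exists a : R, forall z, dotv (G x *m k) z = 0 -> H x *m z = a *: (G x *m z).
Proof.
move=> Ox k0 hk F1 F2 ind r1 r2.
have sk (u v : 'cV[R]_4) : (wedge u v)^T = - wedge u v.
  by rewrite /wedge raddfB /= !trmx_mul !trmxK opprB.
have [a1 e1] := curv_range_props Ox k0 hk r1 (sk _ _).
have [a2 e2] := curv_range_props Ox k0 hk r2 (sk _ _).
by apply: (class_C_eigen _ _ _ k0 F1 F2 ind a1 a2 e1 e2);
  [exact: symG|exact: symH|exact: uG].
Qed.

Lemma is_derive_dotv (V : normedModType R) (s : V -> 'cV[R]_4) x v ds y :
  is_derive x v s ds -> is_derive x v (fun t => dotv (s t) y) (dotv ds y).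
Proof.
move=> /is_derive_mxP h; apply: is_derive_bigsum => a.
have := is_derive_mulr (h a 0) (is_derive_cst (y a 0) x v).
by rewrite mulr0 addr0.
Qed.

Lemma is_derive_scale_cst (V : normedModType R) (f : V -> R) x v df (y : 'cV[R]_4) :
  is_derive x v f df -> is_derive x v (fun t => f t *: y) (df *: y).
Proof.
move=> h; apply/is_derive_mxP => a b; rewrite mxE.
have := is_derive_mulr h (is_derive_cst (y a b) x v); rewrite mulr0 addr0.
by apply: is_derive_ext => t; rewrite mxE.
Qed.

Lemma is_derive_mx_line (F : 'cV[R]_4 -> 'M[R]_4) c x :
  (forall a b, smooth_on O (fun y => F y a b)) -> O x ->
  is_derive (0 : R) 1 (fun t : R => F (t *: delta_mx c 0 + x)) (partial_mx c F x).
Proof.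
move=> sF Ox.
have h : is_derive ((0 : R) *: delta_mx c 0 + x) (delta_mx c 0) F (partial_mx c F x).
  by rewrite scale0r add0r; exact: is_derive_partial_mx sF Ox.
by move/is_derive_line: h.
Qed.

(** [A] and [B] are the derivatives of H z and G z, where q = G z and H z = a q. In the derivative
    of (H z) ^ (G z) = 0 the part a B of [A] cancels against the second term and the multiple of q
    drops out, leaving Y ^ q = 0. *)
Lemma eigen_derive_alg (a p : R) (A B q Y : 'cV[R]_4) i j :
  A = a *: B + (2 * p * a) *: q + Y ->
  A i 0 * q j 0 + (a * q i 0) * B j 0 = A j 0 * q i 0 + (a * q j 0) * B i 0 ->
  Y i 0 * q j 0 = Y j 0 * q i 0.
Proof.
move=> -> h; apply/eqP; rewrite -subr_eq0; apply/eqP.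
move/eqP: h; rewrite -subr_eq0 => /eqP <-.
by rewrite !mxE; ring.
Qed.

(** The field k is parallel for [G], so its hyperplanes are preserved and the covariant derivative
    of a vector moving in them stays in them, where [H] is again a multiple of [G]. The only
    surviving contribution to the derivative comes from psi, as [H] is parallel for the other
    connection. *)
Lemma eigen_derive x0 (k : R -> 'cV[R]_4) c (z : 'cV[R]_4) : O x0 ->
  k 0 != 0 ->
  is_derive (0 : R) 1 k (- (conn_mx Gam c x0 *m k 0)) ->
  (\forall t \near (0 : R), exists a : R, forall z,
     dotv (G (t *: delta_mx c 0 + x0) *m k t) z = 0 ->
     H (t *: delta_mx c 0 + x0) *m z = a *: (G (t *: delta_mx c 0 + x0) *m z)) ->
  dotv (G x0 *m k 0) z = 0 -> forall i j,
  ((H x0 *m z) c 0 * psi x0 i 0 + H x0 c i * dotv (psi x0) z) * (G x0 *m z) j 0 =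
  ((H x0 *m z) c 0 * psi x0 j 0 + H x0 c j * dotv (psi x0) z) * (G x0 *m z) i 0.
Proof.
move=> Ox k0 dk eig sz i j.
pose X (t : R) : 'cV[R]_4 := t *: delta_mx c 0 + x0.
have X0 : X 0 = x0 by rewrite /X scale0r add0r.
pose s t := G (X t) *m k t.
have s0 : s 0 = G x0 *m k 0 by rewrite /s X0.
have s0n : s 0 != 0.
  rewrite s0; apply: contra_neq k0 => h.
  by rewrite -[k 0](mulKmx (uG Ox)) h mulmx0.
have [y sy] : exists y, dotv (s 0) y = 1.
  have [b sb] := vec_neq0 s0n; exists ((s 0 b 0)^-1 *: delta_mx b 0).
  by rewrite dotvZr dotv_delta mulVf.
have dG : is_derive (0 : R) 1 (fun t => G (X t)) (partial_mx c G x0).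
  exact: is_derive_mx_line.
have dH : is_derive (0 : R) 1 (fun t => H (X t)) (partial_mx c H x0).
  exact: is_derive_mx_line.
pose C := conn_mx Gam c x0.
(* The covector of k is parallel too: the term of the metric derivative that involves [C] on the
   right cancels against the derivative of k. *)
have ds : is_derive (0 : R) 1 s (C^T *m s 0).
  have := is_derive_mulmx dG dk; rewrite X0.
  move/is_derive_eq; apply.
  rewrite (metric_compat oO symG uG c Ox) -/C mulmxDl mulmxN.
  by rewrite -(mulmxA (G x0)) addrK s0 mulmxA.
(* This extends z to a curve that lies in the hyperplane of [s t] for every t; it starts at z
   because y is normalised at 0. *)
pose zt t := dotv (s t) y *: z - dotv (s t) z *: y.
have z0 : zt 0 = z by rewrite /zt sy scale1r s0 sz scale0r subr0.
pose dz := dotv (C^T *m s 0) y *: z - dotv (C^T *m s 0) z *: y.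
have dzt : is_derive (0 : R) 1 zt dz.
  by apply: is_deriveB; apply: is_derive_scale_cst; exact: is_derive_dotv.
have szt t : dotv (s t) (zt t) = 0 by rewrite dotvBr !dotvZr mulrC subrr.
(* The covariant derivative of [zt] at 0. *)
pose del := dz + C *m z.
have sdel : dotv (s 0) del = 0.
  rewrite dotvDr dotvBr !dotvZr sy -{1}s0 in sz *; rewrite sz.
  by rewrite mulr0 mulr1 sub0r dotv_mulmx trmxK addrC subrr.
have [a Ea] : exists a : R, forall z, dotv (s 0) z = 0 ->
    H x0 *m z = a *: (G x0 *m z).
  by have := nbhs_singleton eig; rewrite -/(X 0) X0 -s0.
have dHz := is_derive_mulmx dH dzt; have dGz := is_derive_mulmx dG dzt.
rewrite !z0 !X0 in dHz dGz.
set A : 'cV[R]_4 := _ + _ in dHz; set B : 'cV[R]_4 := _ + _ in dGz.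
have dHzi b : is_derive (0 : R) 1 (fun t => (H (X t) *m zt t) b 0) (A b 0).
  by move/is_derive_mxP: dHz; exact.
have dGzi b : is_derive (0 : R) 1 (fun t => (G (X t) *m zt t) b 0) (B b 0).
  by move/is_derive_mxP: dGz; exact.
have d1 := is_derive_mulr (dHzi i) (dGzi j).
have d2 := is_derive_mulr (dHzi j) (dGzi i).
have Ederiv : A i 0 * (G x0 *m z) j 0 + (H x0 *m z) i 0 * B j 0 =
              A j 0 * (G x0 *m z) i 0 + (H x0 *m z) j 0 * B i 0.
  have near_eq : \forall t \near (0 : R),
      (H (X t) *m zt t) i 0 * (G (X t) *m zt t) j 0 =
      (H (X t) *m zt t) j 0 * (G (X t) *m zt t) i 0.
    apply: filterS eig => t [b Eb].
    have -> : H (X t) *m zt t = b *: (G (X t) *m zt t) by apply: Eb; exact: szt.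
    rewrite (mxE scalemx_key) [in RHS](mxE scalemx_key).
    by rewrite -!mulrA; congr (_ * _); exact: mulrC.
  have [_ e1] := near_eq_is_derive near_eq d1; have [_ e2] := d2.
  by move: e1; rewrite e2 z0 X0 => ->.
have Hz : H x0 *m z = a *: (G x0 *m z) by apply: Ea; rewrite s0.
have Hdel : H x0 *m del = a *: (G x0 *m del) by exact: Ea.
pose Y := (H x0 *m z) c 0 *: psi x0 + dotv (psi x0) z *: (H x0 *m delta_mx c 0).
have BE : B = C^T *m (G x0 *m z) + G x0 *m del.
  rewrite /B (metric_compat oO symG uG c Ox) -/C mulmxDl /del (mulmxDr (G x0) dz) !mulmxA.
  mx_abel.
have AE : A = C^T *m (H x0 *m z) + H x0 *m del + (2 * psi x0 c 0) *: (H x0 *m z) + Y.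
  rewrite /A (metric_compat oO symH uH c Ox) (conn_mx_proj c Ox) -/C.
  rewrite !(raddfD, raddfN) /= tr_scalar_mx trmx_mul trmxK.
  have e1 : psi x0 *m (delta_mx c 0)^T *m H x0 *m z = (H x0 *m z) c 0 *: psi x0.
    rewrite -!mulmxA [(delta_mx c 0)^T *m _]mx11_scalar dotvE dotvC dotv_delta.
    by rewrite mul_mx_scalar.
  have e2 : H x0 *m (delta_mx c 0 *m (psi x0)^T) *m z =
      dotv (psi x0) z *: (H x0 *m delta_mx c 0).
    by rewrite -!mulmxA [(psi x0)^T *m z]mx11_scalar dotvE mul_mx_scalar -scalemxAr.
  rewrite !mulmxDl e1 e2 /Y mul_scalar_mx mul_mx_scalar -!scalemxAl !mulmxA.
  move: ((H x0 *m z) c 0 *: psi x0) (dotv (psi x0) z *: (H x0 *m delta_mx c 0)) => ? ?.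
  mx_abel.
have YE b : Y b 0 = (H x0 *m z) c 0 * psi x0 b 0 + H x0 c b * dotv (psi x0) z.
  rewrite /Y mxE (mxE scalemx_key) [X in _ + X](mxE scalemx_key) -colE.
  by rewrite [(col _ _) _ _]mxE -{2}(symH Ox) [(H x0)^T _ _]mxE [X in _ + X]mulrC.
rewrite -!YE.
apply: (@eigen_derive_alg a (psi x0 c 0) A B).
  by rewrite AE BE Hdel Hz -scalemxAr scalerDr scalerA.
move: Ederiv; rewrite Hz (mxE scalemx_key) [X in _ = _ + X * _](mxE scalemx_key).
exact.
Qed.

Lemma local_covector_eq0 x0 (k0 : 'cV[R]_4) (a : R) : O x0 -> k0 != 0 ->
  (forall z, dotv (G x0 *m k0) z = 0 -> H x0 *m z = a *: (G x0 *m z)) ->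
  (forall c, exists k : R -> 'cV[R]_4, [/\ k 0 = k0,
    is_derive (0 : R) 1 k (- (conn_mx Gam c x0 *m k0)) &
    \forall t \near (0 : R), exists a : R, forall z,
     dotv (G (t *: delta_mx c 0 + x0) *m k t) z = 0 ->
     H (t *: delta_mx c 0 + x0) *m z = a *: (G (t *: delta_mx c 0 + x0) *m z)]) ->
  psi x0 = 0.
Proof.
move=> Ox k0n eig hk.
apply: (@projective_covector_eq0 R (G x0) (H x0) k0 (psi x0) a) => //.
- exact: symG.
- exact: symH.
- exact: uG.
- exact: uH.
move=> z sz c i j; have [k [kE dk ev]] := hk c.
by apply: (@eigen_derive x0 k c z) => //; rewrite kE.
Qed.

End LocalProjective.

(** * Linear flows and their dependence on a parameter *)

Section MatrixContinuity.
Context {R : realType}.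

Lemma cvg_bigsum (T : Type) (F : set_system T) (FF : Filter F) n
    (f : 'I_n -> T -> R) (l : 'I_n -> R) :
  (forall k, f k x @[x --> F] --> l k) ->
  \sum_k f k x @[x --> F] --> \sum_k l k.
Proof.
elim: n f l => [|n ih] f l h.
  rewrite big_ord0 (_ : (fun _ => _) = cst 0); first exact: cvg_cst.
  by apply/funext => x; rewrite big_ord0.
rewrite big_ord_recl (_ : (fun _ => _) =
    f ord0 \+ (fun x => \sum_(k < n) f (lift ord0 k) x)); last first.
  by apply/funext => x; rewrite big_ord_recl.
by apply: cvgD; [exact: h|exact: ih].
Qed.

Lemma for_continuous_mulmx (p q r : nat) (A : R -> 'M[R]_(p, q))
    (B : R -> 'M[R]_(q, r)) (t : R) :
  {for t, continuous A} -> {for t, continuous B} ->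
  {for t, continuous (fun t => A t *m B t)}.
Proof.
move=> /continuous_mxP cA /continuous_mxP cB; apply/continuous_mxP => i j.
rewrite /prop_for /continuous_at mxE.
rewrite (_ : (fun _ => _) = (fun t => \sum_k A t i k * B t k j)); last first.
  by apply/funext => u; rewrite mxE.
by apply: cvg_bigsum => k; apply: cvgM; [exact: cA|exact: cB].
Qed.

Lemma is_derive_continuous p q (A : R -> 'M[R]_(p, q)) (t : R) d :
  is_derive t 1 A d -> {for t, continuous A}.
Proof.
by move=> [h _]; apply: differentiable_continuous; exact/derivable1_diffP.
Qed.

Lemma continuous_mulmx (p q r : nat) (A : R -> 'M[R]_(p, q)) (B : R -> 'M[R]_(q, r)) :
  continuous A -> continuous B -> continuous (fun t => A t *m B t).
Proof. by move=> cA cB t; exact: for_continuous_mulmx (cA t) (cB t). Qed.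

End MatrixContinuity.

Section LinearFlow.
Context {R : realType} {n : nat}.
Local Notation mx := 'M[R]_n.

Lemma norm_scalar1 : `|1%:M : mx| <= 1.
Proof.
apply: mx_norm_leP => // i j; rewrite mxE.
by case: (i == j); rewrite ?normr1 ?normr0.
Qed.

(** The sup norm is submultiplicative only up to the factor n, so multiplication by a coefficient of
    size K has Lipschitz constant n K; adding 1 makes it positive as [picard] demands. *)
Definition flow_bound (K t : R) : R := 1 + picard_weight (n%:R * K + 1) t.

Lemma ratio_le1 (a w : R) : 0 <= a -> 0 <= w -> a / (a + 1) * w <= w.
Proof.
move=> a0 w0; rewrite ler_piMl// ler_pdivrMr ?mul1r; last by lra.
by lra.
Qed.

Lemma linear_ode (f : R -> mx -> mx) (K : R) : 0 <= K ->
  (forall x : R -> mx, continuous x -> continuous (fun t => f t (x t))) ->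
  (forall t x y, f t x - f t y = f t (x - y)) ->
  (forall t x, `|f t x| <= n%:R * K * `|x|) ->
  exists X : R -> mx, [/\ X 0 = 1%:M, forall t : R, is_derive t 1 X (f t (X t)) &
    forall t, `|X t| <= flow_bound K t].
Proof.
move=> K0 cf lin bd.
have nK : 0 <= n%:R * K by rewrite mulr_ge0.
have [||||X [X0 dX bX]] := @picard R n n f 1%:M (n%:R * K + 1) (n%:R * K).
- by rewrite ltr_wpDl.
- exact: cf.
- by move=> t x y; rewrite lin; apply: le_trans (bd _ _) _; rewrite ler_wpM2r// lerDl.
- move=> t; apply: le_trans (bd _ _) _.
  by rewrite ler_piMr// norm_scalar1.
exists X; split => // t.
rewrite -[X t](subrK 1%:M); apply: le_trans (ler_normD _ _) _.
rewrite /flow_bound addrC lerD ?norm_scalar1//.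
apply: le_trans (bX t) _; apply: ratio_le1 => //.
exact/ltW/picard_weight_gt0.
Qed.

(** The inverse is obtained as the solution of the adjoint equation, since [B] times [Phi] has
    derivative 0. In this way it gets the same explicit bound as [Phi]. *)
Lemma linear_flow (M : R -> mx) (K : R) : 0 <= K -> continuous M ->
  (forall t, `|M t| <= K) ->
  exists PhiB : (R -> mx) * (R -> mx), let Phi := PhiB.1 in let B := PhiB.2 in
    [/\ Phi 0 = 1%:M, B 0 = 1%:M,
    forall t : R, is_derive t 1 Phi (M t *m Phi t),
    forall t : R, is_derive t 1 B (- (B t *m M t)) &
    forall t, [/\ B t *m Phi t = 1%:M, `|Phi t| <= flow_bound K t &
                  `|B t| <= flow_bound K t]].
Proof.
move=> K0 cM bM.
have [|||Phi [Phi0 dPhi bPhi]] := @linear_ode (fun t X => M t *m X) K K0.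
- by move=> x cx; exact: continuous_mulmx.
- by move=> t x y; rewrite mulmxBr.
- move=> t x; apply: le_trans (norm_mulmx_le _ _) _.
  by rewrite ler_wpM2r// ler_wpM2l.
have [|||B [B0 dB bB]] := @linear_ode (fun t X => - (X *m M t)) K K0.
- move=> x cx; have := continuous_mulmx cx cM => c t; apply: cvgN; exact: c.
- by move=> t x y; rewrite mulmxBl opprB opprK addrC.
- move=> t x; rewrite normrN; apply: le_trans (norm_mulmx_le _ _) _.
  by rewrite mulrAC ler_wpM2r// ler_wpM2l.
exists (Phi, B); split => // t; split => //.
have dBP (u : R) : is_derive u 1 (fun t => B t *m Phi t) 0.
  have := is_derive_mulmx (dB u) (dPhi u).
  by rewrite mulNmx mulmxA addrC subrr.
apply/matrixP => i j.
have d0 (u : R) : is_derive u 1 (fun t => (B t *m Phi t) i j) 0.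
  by have /is_derive_mxP /(_ i j) := dBP u; rewrite mxE.
have H := @is_derive0_eq R (fun t => (B t *m Phi t) i j) (- `|t| - 1)
  (fun u _ => d0 u) t 0.
rewrite H; first by rewrite Phi0 B0 mulmx1.
- by have := ler_norm (- t); rewrite normrN; lra.
- by have := normr_ge0 t; lra.
Qed.

End LinearFlow.

Section FlowParameter.
Context {R : realType} {n : nat}.
Local Notation mx := 'M[R]_n.
Variables (rho T : R).
Hypotheses (rho0 : 0 < rho) (T0 : 0 <= T).
Implicit Types f g : R -> R -> mx.

(* Uniformly in [|t| <= T]: boundedness, Lipschitz dependence on the parameter [s],
   and differentiability in [s] with derivative [g] and quadratic error. *)
Definition ubd f := exists2 C, 0 <= C &
  forall s t, `|s| < rho -> `|t| <= T -> `|f s t| <= C.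
Definition ulip f := exists2 C, 0 <= C & forall s s' t, `|s| < rho -> `|s'| < rho ->
  `|t| <= T -> `|f s' t - f s t| <= C * `|s' - s|.
Definition uquad f g := exists2 C, 0 <= C & forall s s' t, `|s| < rho -> `|s'| < rho ->
  `|t| <= T -> `|f s' t - f s t - (s' - s) *: g s t| <= C * `|s' - s| ^+ 2.

Lemma ubd_mul f g : ubd f -> ubd g -> ubd (fun s t => f s t *m g s t).
Proof.
move=> [C C0 h] [D D0 k]; exists (n%:R * C * D); first by rewrite !mulr_ge0.
move=> s t hs ht; apply: le_trans (norm_mulmx_le _ _) _.
by rewrite ler_pM ?mulr_ge0// ?ler_wpM2l// ?h ?k.
Qed.

Lemma ulip_mul f g : ubd f -> ubd g -> ulip f -> ulip g ->
  ulip (fun s t => f s t *m g s t).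
Proof.
move=> [C C0 h] [D D0 k] [C' C'0 h'] [D' D'0 k'].
exists (n%:R * C' * D + n%:R * C * D').
  by rewrite addr_ge0// !mulr_ge0.
move=> s s' t hs hs' ht.
rewrite (_ : _ - _ = (f s' t - f s t) *m g s' t + f s t *m (g s' t - g s t)); last first.
  by rewrite mulmxBl mulmxBr addrA subrK.
apply: le_trans (ler_normD _ _) _; rewrite mulrDl; apply: lerD.
  apply: le_trans (norm_mulmx_le _ _) _.
  rewrite [leRHS]mulrAC -(mulrA n%:R C') ler_pM ?mulr_ge0// ?k// ler_wpM2l// h'//.
apply: le_trans (norm_mulmx_le _ _) _.
by rewrite -(mulrA (n%:R * C) D') ler_pM ?mulr_ge0// ?ler_wpM2l// ?h// k'.
Qed.

Lemma quad_ulip f g : ubd g -> uquad f g -> ulip f.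
Proof.
move=> [C C0 h] [D D0 k]; exists (C + D * (rho + rho)).
  by rewrite addr_ge0// mulr_ge0// addr_ge0// ltW.
move=> s s' t hs hs' ht; rewrite -[f s' t - _](subrK ((s' - s) *: g s t)).
apply: le_trans (ler_normD _ _) _; rewrite addrC mulrDl; apply: lerD.
  by rewrite normrZ mulrC ler_wpM2r// h.
apply: le_trans (k s s' t hs hs' ht) _; rewrite -mulrA ler_wpM2l// expr2 ler_wpM2r//.
by apply: le_trans (ler_normB _ _) _; rewrite lerD// ltW.
Qed.

Lemma bound_from0 (E dE : R -> mx) (c t : R) : 0 <= c -> `|t| <= T -> E 0 = 0 ->
  (forall u : R, `|u| <= T -> is_derive u 1 E (dE u)) ->
  (forall u, `|u| <= T -> `|dE u| <= c) -> `|E t| <= c * T.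
Proof.
move=> c0 tT E0 hE hc.
have lin (u : R) : is_derive u 1 (fun u : R => c * u) c.
  have := is_deriveZ c (is_derive_id u (1 : R)).
  by rewrite [_%:A]mulr1.
have := tT; rewrite ler_norml => /andP[t1 t2].
case: (leP 0 t) => [t0|/ltW t0].
  have B u : 0 <= u <= t -> `|u| <= T.
    by move=> /andP[u0 ut]; rewrite (ger0_norm u0) (le_trans ut).
  have := @derive_mx_bound R n n E dE (fun u => c * u) (cst c) 0 t t0
    (fun u hu => hE u (B u hu)) (fun u _ => lin u) (fun u hu => hc u (B u hu)).
  by rewrite E0 !subr0 mulr0 subr0 => h; apply: le_trans h _; rewrite ler_wpM2l.
have B u : t <= u <= 0 -> `|u| <= T.
  move=> /andP[ut u0]; rewrite (ler0_norm u0) lerNl; exact: le_trans ut.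
have := @derive_mx_bound R n n E dE (fun u => c * u) (cst c) t 0 t0
  (fun u hu => hE u (B u hu)) (fun u _ => lin u) (fun u hu => hc u (B u hu)).
rewrite E0 !sub0r normrN mulr0 sub0r => h; apply: le_trans h _.
by rewrite -mulrN ler_wpM2l// lerNl.
Qed.

Lemma ubd_primitive f F : ubd f -> (forall s, `|s| < rho -> F s 0 = 0) ->
  (forall s t : R, `|s| < rho -> `|t| <= T -> is_derive t 1 (F s) (f s t)) -> ubd F.
Proof.
move=> [C C0 h] F0 dF; exists (C * T); first exact: mulr_ge0.
move=> s t hs ht; apply: (@bound_from0 (F s) (f s)) => //.
- exact: F0.
- by move=> u hu; exact: dF.
- by move=> u hu; exact: h.
Qed.

Lemma ulip_primitive f F : ulip f -> (forall s, `|s| < rho -> F s 0 = 0) ->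
  (forall s t : R, `|s| < rho -> `|t| <= T -> is_derive t 1 (F s) (f s t)) -> ulip F.
Proof.
move=> [C C0 h] F0 dF; exists (C * T); first exact: mulr_ge0.
move=> s s' t hs hs' ht; rewrite mulrAC.
apply: (@bound_from0 (F s' - F s) (fun u => f s' u - f s u)) => //.
- exact: mulr_ge0.
- by rewrite !fctE !F0// subrr.
- by move=> u hu; apply: is_deriveB; exact: dF.
- by move=> u hu; exact: h.
Qed.

Lemma quad_is_derive (p q : nat) (f : R -> 'M[R]_(p, q)) s d (C e : R) : 0 < e -> 0 <= C ->
  (forall s', `|s' - s| < e -> `|f s' - f s - (s' - s) *: d| <= C * `|s' - s| ^+ 2) ->
  is_derive s 1 f d.
Proof.
move=> e0 C0 h.
have H : (h^-1 *: ((f \o shift s) (h *: (1 : R)) - f s)) @[h --> (0 : R)^'] --> d.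
  apply/cvgrPdist_le => eps eps0.
  have C1 : 0 < C + 1 by rewrite ltr_wpDl.
  have m0 : 0 < Num.min e (eps / (C + 1)) by rewrite lt_min e0 divr_gt0.
  near=> u.
  have u0 : u != 0 by near: u; exact: nbhs_dnbhs_neq.
  have um : `|u| < Num.min e (eps / (C + 1)).
    by near: u; exact: dnbhs0_lt.
  move: um; rewrite lt_min => /andP[ue ueps].
  have := h (u + s); rewrite addrK => /(_ ue) hu.
  rewrite /= [_%:A]mulr1.
  rewrite (_ : d - _ = - (u^-1 *: (f (u + s) - f s - u *: d))); last first.
    by rewrite [in RHS]scalerBr scalerA mulVf// scale1r opprB.
  rewrite normrN normrZ normfV ler_pdivrMl ?normr_gt0//.
  apply: le_trans hu _; rewrite expr2 mulrCA ler_wpM2l//.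
  have : (C + 1) * `|u| <= eps by rewrite mulrC -ler_pdivlMr// ltW.
  by apply: le_trans; rewrite ler_wpM2r// lerDl.
apply: DeriveDef; last exact: cvg_lim H.
by apply/cvg_ex; exists d.
Unshelve. all: by end_near. Qed.

Lemma flow_bound_mono (K t : R) : 0 <= K -> `|t| <= T ->
  @flow_bound R n K t <= 1 + 2 * expR (2 * (n%:R * K + 1) * T).
Proof.
move=> K0 tT; rewrite /flow_bound lerD2l /picard_weight.
have L0 : 0 <= 2 * (n%:R * K + 1) by rewrite mulr_ge0// addr_ge0// mulr_ge0.
move: tT; rewrite ler_norml => /andP[t1 t2].
rewrite [2 * expR _]mulr_natl mulr2n; apply: lerD; rewrite ler_expR.
  by rewrite ler_wpM2l.
by rewrite mulNr -mulrN ler_wpM2l// lerNl.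
Qed.

Lemma flow_diff_alg (B M M' N P P' W : mx) (h : R) :
  - (B *m M') *m (P' - P - h *: W) + B *m (M' *m P' - M *m P - h *: (M *m W + N *m P)) =
  B *m ((M' - M - h *: N) *m P + h *: ((M' - M) *m W)).
Proof.
rewrite mulNmx -mulmxA -mulmxN -mulmxDr; congr (_ *m _).
rewrite !(mulmxBl, mulmxBr) -scalemxAr -scalemxAl.
do ?[match goal with |- context [mulmx ?A ?B] => move: (mulmx A B) => ? end].
by apply/matrixP => i j; rewrite !mxE; ring.
Qed.

(** Variation of constants: multiplying the error of the first-order expansion in the parameter by
    the inverse flow removes its homogeneous part. Each term left is of second order in s' - s once
    [M] is differentiable in the parameter. *)
Lemma flow_difference (M N Phi B W : R -> R -> mx) s s' :
  (forall t : R, is_derive t 1 (Phi s) (M s t *m Phi s t)) ->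
  (forall t : R, is_derive t 1 (Phi s') (M s' t *m Phi s' t)) ->
  (forall t : R, is_derive t 1 (B s') (- (B s' t *m M s' t))) ->
  (forall t : R, is_derive t 1 (W s) (M s t *m W s t + N s t *m Phi s t)) ->
  forall t : R, is_derive t 1
    (fun t => B s' t *m (Phi s' t - Phi s t - (s' - s) *: W s t))
    (B s' t *m ((M s' t - M s t - (s' - s) *: N s t) *m Phi s t +
       (s' - s) *: ((M s' t - M s t) *m W s t))).
Proof.
move=> h1 h2 h3 h4 t.
have d := is_deriveB (is_deriveB (h2 t) (h1 t)) (is_deriveZ (s' - s) (h4 t)).
have := is_derive_mulmx (h3 t) d.
move/is_derive_eq; apply.
exact: flow_diff_alg.
Qed.

(** The candidate [W] solves the variational equation; it is [Phi] times a primitive of B N Phi. The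
    quadratic estimate for [Phi] comes from integrating [flow_difference], and continuity of [W]
    from the Lipschitz dependence of all its factors. *)
Lemma flow_parameter (M N : R -> R -> mx) (K : R) : 0 <= K ->
  (forall s, `|s| < rho -> continuous (M s)) ->
  (forall s, `|s| < rho -> continuous (N s)) ->
  (forall s t, `|s| < rho -> `|M s t| <= K) ->
  uquad M N -> ulip N -> ubd N ->
  exists Phi B W : R -> R -> mx, forall s, `|s| < rho ->
    [/\ Phi s 0 = 1%:M /\ B s 0 = 1%:M /\ W s 0 = 0,
       forall t, B s t *m Phi s t = 1%:M,
       forall t : R, is_derive t 1 (Phi s) (M s t *m Phi s t),
       forall t : R, is_derive t 1 (W s) (M s t *m W s t + N s t *m Phi s t) &
       forall t, `|t| <= T -> is_derive s 1 (fun s => Phi s t) (W s t) /\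
          {for s, continuous (fun s => W s t)}].
Proof.
move=> K0 cM cN bM qMN lN bN.
have /choice[PB hPB] : forall s, exists PB : (R -> mx) * (R -> mx), `|s| < rho ->
    let Phi := PB.1 in let B := PB.2 in
    [/\ Phi 0 = 1%:M, B 0 = 1%:M,
    forall t : R, is_derive t 1 Phi (M s t *m Phi t),
    forall t : R, is_derive t 1 B (- (B t *m M s t)) &
    forall t, [/\ B t *m Phi t = 1%:M, `|Phi t| <= @flow_bound R n K t &
                  `|B t| <= @flow_bound R n K t]].
  move=> s; case: (pselect (`|s| < rho)) => hs; last by exists (cst 0, cst 0).
  have [PB h] := linear_flow K0 (cM s hs) (fun t => bM s t hs).
  by exists PB.
pose Phi s := (PB s).1; pose B s := (PB s).2.
have BPhi s t : `|s| < rho -> B s t *m Phi s t = 1%:M.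
  by move=> /hPB[_ _ _ _ /(_ t)[]].
have PhiB s t : `|s| < rho -> Phi s t *m B s t = 1%:M.
  by move=> hs; apply: mulmx1C; exact: BPhi.
have dPhi s (t : R) : `|s| < rho -> is_derive t 1 (Phi s) (M s t *m Phi s t).
  by move=> /hPB[].
have dB s (t : R) : `|s| < rho -> is_derive t 1 (B s) (- (B s t *m M s t)).
  by move=> /hPB[].
have /choice[F hF] : forall s, exists F : R -> mx, `|s| < rho -> F 0 = 0 /\
    forall t : R, is_derive t 1 F (B s t *m N s t *m Phi s t).
  move=> s; case: (pselect (`|s| < rho)) => hs; last by exists (cst 0).
  have c : continuous (fun t => B s t *m N s t *m Phi s t).
    apply: continuous_mulmx; first apply: continuous_mulmx.
    - exact: (fun t => is_derive_continuous (dB s t hs)).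
    - exact: cN.
    - exact: (fun t => is_derive_continuous (dPhi s t hs)).
  by have [F hF] := primitive_mx 0 c; exists F.
pose W s t := Phi s t *m F s t.
have dW s (t : R) : `|s| < rho ->
    is_derive t 1 (W s) (M s t *m W s t + N s t *m Phi s t).
  move=> hs; have [_ dF] := hF s hs.
  have := is_derive_mulmx (dPhi s t hs) (dF t).
  by rewrite !mulmxA PhiB// mul1mx -mulmxA.
pose CF := 1 + 2 * expR (2 * (n%:R * K + 1) * T).
have CF0 : 0 <= CF by rewrite addr_ge0// mulr_ge0// expR_ge0.
have bPhi : ubd Phi.
  exists CF => // s t hs ht; have [_ _ _ _ /(_ t)[_ h _]] := hPB s hs.
  by apply: le_trans h _; exact: flow_bound_mono.
have bB : ubd B.
  exists CF => // s t hs ht; have [_ _ _ _ /(_ t)[_ _ h]] := hPB s hs.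
  by apply: le_trans h _; exact: flow_bound_mono.
have bF : ubd F.
  apply: (ubd_primitive (ubd_mul (ubd_mul bB bN) bPhi)).
    by move=> s /hF[].
  by move=> s t /hF[_ h] _; exact: h.
have bW : ubd W by exact: ubd_mul.
have lM : ulip M by exact: quad_ulip qMN.
have qPhi : uquad Phi W.
  have [C1 C10 h1] := bPhi; have [C2 C20 h2] := bB; have [C3 C30 h3] := bW.
  have [C4 C40 h4] := lM; have [C5 C50 h5] := qMN.
  pose c := n%:R * C2 * (n%:R * C5 * C1 + n%:R * C4 * C3).
  have c0 : 0 <= c.
    by apply: mulr_ge0; [exact: mulr_ge0|apply: addr_ge0; do 2?exact: mulr_ge0 => //;
      apply: mulr_ge0 => //; exact: mulr_ge0].
  exists (n%:R * C1 * (c * T)); first by apply: mulr_ge0; exact: mulr_ge0.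
  move=> s s' t hs hs' ht.
  set D := _ - _ - _.
  have -> : D = Phi s' t *m (B s' t *m D) by rewrite mulmxA PhiB// mul1mx.
  apply: le_trans (norm_mulmx_le _ _) _.
  have hE : `|B s' t *m D| <= c * `|s' - s| ^+ 2 * T.
    apply: (@bound_from0 (fun t => B s' t *m (Phi s' t - Phi s t - (s' - s) *: W s t))
      _ _ _ _ ht _
      (fun u _ => @flow_difference M N Phi B W s s' (fun t => dPhi s t hs)
        (fun t => dPhi s' t hs') (fun t => dB s' t hs') (fun t => dW s t hs) u)).
    - by rewrite mulr_ge0// exprn_ge0.
    - have P0 u : `|u| < rho -> Phi u 0 = 1%:M by move=> /hPB[].
      have [F0 _] := hF s hs.
      by rewrite /W F0 !P0// mulmx0 scaler0 subr0 subrr mulmx0.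
    - move=> u hu; apply: le_trans (norm_mulmx_le _ _) _.
      rewrite /c -(mulrA (n%:R * C2)); apply: ler_pM; rewrite ?mulr_ge0//.
        by rewrite ler_wpM2l// h2.
      rewrite mulrDl; apply: le_trans (ler_normD _ _) _; apply: lerD.
        apply: le_trans (norm_mulmx_le _ _) _; rewrite [leRHS]mulrAC.
        apply: ler_pM; rewrite ?mulr_ge0//; last exact: h1.
        by rewrite -(mulrA n%:R C5) ler_wpM2l// h5.
      rewrite normrZ; apply: le_trans (ler_wpM2l _ (norm_mulmx_le _ _)) _ => //.
      rewrite (_ : n%:R * C4 * C3 * _ = `|s' - s| * (n%:R * (C4 * `|s' - s|) * C3)).
        rewrite ler_wpM2l// ler_pM ?mulr_ge0//; last exact: h3.
        by rewrite ler_wpM2l// h4.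
      by move: (`|s' - s|) => x; ring.
  rewrite (_ : n%:R * C1 * (c * T) * _ = n%:R * C1 * (c * `|s' - s| ^+ 2 * T)).
    by rewrite ler_pM ?mulr_ge0// ler_wpM2l// h1.
  by move: (`|s' - s|) => x; ring.
have lPhi : ulip Phi by exact: quad_ulip qPhi.
have lB : ulip B.
  have [C1 C10 h1] := bB; have [C2 C20 h2] := lPhi.
  exists (n%:R * (n%:R * C1 * C2) * C1); first by rewrite !mulr_ge0.
  move=> s s' t hs hs' ht.
  (* The resolvent identity transfers the Lipschitz estimate from the flow to its inverse. *)
  rewrite (_ : _ - _ = B s' t *m (Phi s t - Phi s' t) *m B s t); last first.
    by rewrite mulmxBr mulmxBl BPhi// mul1mx -mulmxA PhiB// mulmx1.
  apply: le_trans (norm_mulmx_le _ _) _; rewrite [leRHS]mulrAC -(mulrA n%:R (_ * C1 * C2)).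
  apply: ler_pM; rewrite ?mulr_ge0//; last exact: h1.
  rewrite ler_wpM2l//; apply: le_trans (norm_mulmx_le _ _) _.
  rewrite -(mulrA (n%:R * C1)); apply: ler_pM; rewrite ?mulr_ge0//.
    by rewrite ler_wpM2l// h1.
  by rewrite distrC h2.
have lF : ulip F.
  apply: (ulip_primitive (ulip_mul (ubd_mul bB bN) bPhi (ulip_mul bB bN lB lN) lPhi)).
    by move=> s /hF[].
  by move=> s t /hF[_ h] _; exact: h.
have lW : ulip W by exact: ulip_mul.
exists Phi, B, W => s hs; split.
- have [P0 B0 _ _ _] := hPB s hs; have [F0 _] := hF s hs.
  by split; [exact: P0|split; [exact: B0|rewrite /W F0 mulmx0]].
- by move=> t; exact: BPhi.
- by move=> t; exact: dPhi.
- by move=> t; exact: dW.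
move=> t ht.
have e0 : 0 < rho - `|s| by rewrite subr_gt0.
have near_s s' : `|s' - s| < rho - `|s| -> `|s'| < rho.
  by move=> h; have := ler_normD (s' - s) s; rewrite subrK; lra.
split.
  have [C C0 h] := qPhi.
  by apply: (quad_is_derive e0 C0) => s' /near_s hs'; exact: h.
have [C C0 h] := lW.
apply/cvgrPdist_lt => eps eps0.
have C1 : 0 < C + 1 by rewrite ltr_wpDl.
have h1 : \forall s' \near s, `|s - s'| < rho - `|s|.
  by apply/nbhs_normP; exists (rho - `|s|).
have h2 : \forall s' \near s, `|s - s'| < eps / (C + 1).
  by apply/nbhs_normP; exists (eps / (C + 1)) => //=; rewrite divr_gt0.
apply: filterS2 h1 h2 => s'; rewrite distrC => /near_s hs' h2.
rewrite distrC; apply: le_lt_trans (h s s' t hs hs' ht) _.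
rewrite ltr_pdivlMr// mulrC in h2; apply: le_lt_trans h2.
by rewrite distrC ler_wpM2r// lerDl.
Qed.

End FlowParameter.

Section Clip.
Context {R : realType}.

(* Precomposing with [clip r] extends a coefficient defined on [-r, r] to a bounded
   continuous one on the line, to which the global existence results apply. *)
Definition clip (r t : R) : R := Num.max (- r) (Num.min r t).

Lemma clip_id r t : `|t| <= r -> clip r t = t.
Proof.
by rewrite ler_norml => /andP[h1 h2]; rewrite /clip (min_idPr h2) (max_idPr h1).
Qed.

Lemma clip_le r t : 0 <= r -> `|clip r t| <= r.
Proof.
move=> r0; rewrite ler_norml /clip le_max lexx /= ge_max ge_min lexx /=.
by rewrite andbT; lra.
Qed.

Lemma clip_lip r s t : `|clip r s - clip r t| <= `|s - t|.
Proof.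
wlog st : s t / s <= t.
  move=> H; case: (leP s t) => [/H//|/ltW /H].
  by rewrite distrC (distrC t s).
rewrite (distrC s) (ger0_norm (_ : 0 <= t - s)) ?subr_ge0//.
have cases (u : R) : [\/ clip r u = - r /\ (u <= - r \/ r <= - r),
    clip r u = r /\ r <= u /\ - r <= r | clip r u = u /\ - r <= u <= r].
  rewrite /clip; case: (leP r u) => h1.
    by case: (leP (- r) r) => h2; [apply: Or32|apply: Or31; split => //; right; lra].
  by case: (leP (- r) u) => h2; [apply: Or33; split => //=; exact: ltW|apply: Or31; split => //; left; lra].
rewrite ler_norml.
case: (cases s) => -[-> hs]; case: (cases t) => -[-> ht]; apply/andP; split; lra.
Qed.

Lemma clip_continuous r : continuous (clip r).
Proof.
move=> t; apply/cvgrPdist_lt => e e0.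
have : \forall s \near t, `|t - s| < e by apply/nbhs_normP; exists e.
by apply: filterS => s; apply: le_lt_trans; exact: clip_lip.
Qed.

End Clip.

Section LocalEstimates.
Context {R : realType}.

Lemma local_bound (O : set 'cV[R]_4) x0 (I : finType) (f : I -> 'cV[R]_4 -> R) :
  open O -> O x0 -> (forall i, {for x0, continuous (f i)}) ->
  exists r K : R, [/\ 0 < r, 0 <= K &
    forall y, `|y - x0| < r -> O y /\ forall i, `|f i y| <= K].
Proof.
move=> oO Ox cf.
pose K := \sum_i (`|f i x0| + 1).
have Ki i : `|f i x0| + 1 <= K.
  rewrite /K (bigD1 i)//= lerDl; apply: sumr_ge0 => j _.
  by rewrite addr_ge0.
have h : \forall y \near x0, forall i, `|f i y| <= K.
  apply: near_forall_fin => i.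
  have /cvgrPdist_lt /(_ _ ltr01) := cf i.
  apply: filterS => y hy; apply: le_trans (Ki i).
  have := ler_normB (f i x0) (f i x0 - f i y); rewrite opprB addrCA subrr addr0.
  by move/le_trans; apply; rewrite lerD2l ltW.
have /nbhs_normP[r /= r0 hr] : \forall y \near x0, O y /\ forall i, `|f i y| <= K.
  by apply: filterS2 (near_in_open oO Ox) h.
exists r, K; split => //.
  by rewrite /K; apply: sumr_ge0 => i _; rewrite addr_ge0.
by move=> y hy; apply: hr; rewrite /= distrC.
Qed.

Lemma Ck_id k (O : set R) : Ck k O (fun t : R => t).
Proof.
case: k => [|k]; first by split => // x _; exact: cvg_id.
split; first by move=> x _; exact: cvg_id.
move=> v; split; first by move=> x _; exact: derivable_id.
have -> : (fun x : R => 'D_v (fun t : R => t) x) = (fun=> v).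
  by apply/funext => x; rewrite derive_id.
exact: Ck_cst.
Qed.

Lemma is_derive_affine_comp p q (A : R -> 'M[R]_(p, q)) (u0 h t : R) d :
  is_derive (u0 + t * h) 1 A d -> is_derive t 1 (fun s => A (u0 + s * h)) (h *: d).
Proof.
move=> /is_derive_mxP hA; apply/is_derive_mxP => i j.
have hg : is_derive t 1 (fun s : R => u0 + s * h) h.
  have := is_deriveD (is_derive_cst u0 t 1)
    (is_derive_mulr (is_derive_id t (1 : R)) (is_derive_cst h t 1)).
  by rewrite mulr0 addr0 mul1r add0r.
have := @is_derive1_comp R (fun y => A y i j) (fun s => u0 + s * h) t _ _ (hA i j) hg.
by move/is_derive_eq; apply; rewrite !mxE mulrC.
Qed.

Lemma is_derive_lineZ (v y : 'cV[R]_4) (u0 h t : R) :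
  is_derive t 1 (fun s : R => (u0 + s * h) *: v + y) (h *: v).
Proof.
apply/is_derive_mxP => i j; rewrite mxE.
have h1 : is_derive t 1 (fun s : R => u0 + s * h) h.
  have := is_deriveD (is_derive_cst u0 t 1)
    (is_derive_mulr (is_derive_id t (1 : R)) (is_derive_cst h t 1)).
  by rewrite mulr0 addr0 mul1r add0r.
have := is_deriveD (is_derive_mulr h1 (is_derive_cst (v i j) t 1))
  (is_derive_cst (y i j) t 1).
rewrite mulr0 !addr0; apply: is_derive_ext => s.
by rewrite !fctE !mxE.
Qed.

Lemma line_smooth (v y : 'cV[R]_4) (u0 h : R) :
  smooth_on [set: R] (fun s : R => (u0 + s * h) *: v + y).
Proof.
move=> k; apply/Ck_mxP; first exact: openT.
move=> i j.
have : Ck k [set: R] (fun s : R => (u0 + s * h) * v i j + y i j).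
  apply: Ck_add; [exact: openT| |exact: Ck_cst].
  apply: Ck_mul; [exact: openT| |exact: Ck_cst].
  apply: Ck_add; [exact: openT|exact: Ck_cst|].
  by apply: Ck_mul; [exact: openT|exact: Ck_id|exact: Ck_cst].
by apply: Ck_ext; [exact: openT|move=> x _; rewrite !mxE].
Qed.

End LocalEstimates.

(** * Parallel transport *)

Section AtlasMetric.
Context {R : realType} {M : topologicalType} {A : atlas R M}.
Variable g : lorentz_metric A.
Implicit Types (i j : chart A).

Lemma open_cimg i : open (cimg i).
Proof. exact: cimg_open. Qed.

Lemma gcomp_unit i x : cimg i x -> g i x \in unitmx.
Proof.
move=> Ox; have [e [ue E]] := @gcomp_signature _ _ _ g i x Ox.
have : @lorentz_gram R \in unitmx.
  rewrite unitmxE det_diag unitfE; apply/prodf_neq0 => a _; rewrite mxE.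
  by case: (a == 0); rewrite ?oppr_eq0 oner_eq0.
by rewrite -E !unitmx_mul => /andP[/andP[_ ->]].
Qed.

Lemma conn_continuous i x c : cimg i x ->
  {for x, continuous (conn_mx (christoffel (g i)) c)}.
Proof.
move=> Ox; apply/continuous_mxP => a b.
have h := conn_mx_smooth (@open_cimg i) (@gcomp_smooth _ _ _ g i) (@gcomp_unit i) c a b.
exact: (Ck_continuous (h 0%N) Ox).
Qed.

Lemma line_flow i (y : 'cV[R]_4) c (r K : R) : 0 <= r -> 0 <= K ->
  (forall u, `|u| <= r -> cimg i (u *: delta_mx c 0 + y)) ->
  (forall u, `|u| <= r ->
     `|conn_mx (christoffel (g i)) c (u *: delta_mx c 0 + y)| <= K) ->
  exists PhiB : (R -> 'M[R]_4) * (R -> 'M[R]_4), let Phi := PhiB.1 in let B := PhiB.2 in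
    [/\ Phi 0 = 1%:M, B 0 = 1%:M,
    forall u : R, `|u| <= r -> is_derive u 1 Phi
      (- (conn_mx (christoffel (g i)) c (u *: delta_mx c 0 + y) *m Phi u)),
    forall u : R, `|u| <= r -> is_derive u 1 B
      (B u *m conn_mx (christoffel (g i)) c (u *: delta_mx c 0 + y)) &
    forall u, B u *m Phi u = 1%:M].
Proof.
move=> r0 K0 hO hK.
pose Mt (u : R) := - conn_mx (christoffel (g i)) c (clip r u *: delta_mx c 0 + y).
have cM : continuous Mt.
  move=> u; apply: cvgN.
  apply: (@continuous_comp _ _ _ (fun u => clip r u *: delta_mx c 0 + y)).
    apply: cvgD; last exact: cvg_cst.
    by apply: cvgZr_tmp; exact: clip_continuous.
  by apply: conn_continuous; apply: hO; exact: clip_le.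
have bM u : `|Mt u| <= K by rewrite normrN; apply: hK; exact: clip_le.
have [[Phi B] [P0 B0 dP dB h]] := linear_flow K0 cM bM.
exists (Phi, B); split => //.
- move=> u hu; have := dP u; rewrite /Mt clip_id// mulNmx.
  exact.
- move=> u hu; have := dB u; rewrite /Mt clip_id// mulmxN opprK.
  exact.
- by move=> u; have [] := h u.
Qed.

(** [Phi] transports from parameter 0, so transport from u0 to u1 goes back to 0 by [B u0] and
    forward by [Phi u1]. The segment is reparametrised affinely by [0, 1], as [transport_curve]
    requires. *)
Lemma line_transport i (y : 'cV[R]_4) c (r : R) (Phi B : R -> 'M[R]_4) (u0 u1 : R) :
  (forall u, `|u| <= r -> cimg i (u *: delta_mx c 0 + y)) ->
  (forall u : R, `|u| <= r -> is_derive u 1 Phi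
      (- (conn_mx (christoffel (g i)) c (u *: delta_mx c 0 + y) *m Phi u))) ->
  (forall u, B u *m Phi u = 1%:M) ->
  `|u0| <= r -> `|u1| <= r ->
  transport (levi_civita g) i (cinv i (u0 *: delta_mx c 0 + y))
    i (cinv i (u1 *: delta_mx c 0 + y)) (Phi u1 *m B u0).
Proof.
move=> hO dPhi BPhi hu0 hu1.
pose x (t : R) : 'cV[R]_4 := (u0 + t * (u1 - u0)) *: delta_mx c 0 + y.
have x0 : u0 *: delta_mx c 0 + y = x 0 by rewrite /x mul0r addr0.
have x1 : u1 *: delta_mx c 0 + y = x 1 by rewrite /x mul1r [u0 + _]addrC subrK.
have seg (t : R) : 0 <= t <= 1 -> `|u0 + t * (u1 - u0)| <= r.
  move=> /andP[t0 t1].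
  rewrite (_ : _ + _ = (1 - t) * u0 + t * u1); last by ring.
  apply: le_trans (ler_normD _ _) _; rewrite !normrM (ger0_norm t0).
  rewrite ger0_norm ?subr_ge0//.
  have t1' : 0 <= 1 - t by rewrite subr_ge0.
  have h1 := ler_wpM2l t1' hu0; have h2 := ler_wpM2l t0 hu1.
  by lra.
rewrite x0 x1; apply: transport_curve.
- exact: line_smooth.
- by move=> t ht; apply: hO; exact: seg.
move=> v; pose V (t : R) := Phi (u0 + t * (u1 - u0)) *m (B u0 *m v).
exists V; split.
- move=> t ht.
  have dx : derive1 x t = (u1 - u0) *: delta_mx c 0.
    by rewrite derive1E; have [_ ->] := is_derive_lineZ (delta_mx c 0) y u0 (u1 - u0) t.
  have h1 := is_derive_affine_comp (dPhi _ (seg t ht)).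
  have := is_derive_mulmx h1 (is_derive_cst (B u0 *m v) t 1).
  rewrite mulmx0 addr0 scalerN mulNmx -scalemxAl.
  move/is_derive_eq; apply; congr (- _).
  rewrite -mulmxA -/(V t) dx; apply/matrixP => a b; rewrite ord1 !mxE mulr_sumr.
  rewrite [RHS](bigD1 c)//= [X in _ = _ + X]big1 ?addr0; last first.
    move=> b' nb; apply: big1 => c' _; rewrite !mxE (negbTE nb) mulr0 mulr0 mul0r.
    by [].
  apply: eq_bigr => c' _; rewrite !mxE !eqxx mulr1 mulrA.
  by rewrite [X in X * _ = _]mulrC.
- by rewrite /V mul0r addr0 mulmxA (mulmx1C (BPhi u0)) mul1mx.
- by rewrite /V mul1r [u0 + _]addrC subrK mulmxA.
Qed.

End AtlasMetric.

Section Charts.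
Context {R : realType} {M : topologicalType} {A : atlas R M}.
Implicit Types (i j : chart A).

Lemma cimg_cinv i x : cimg i x -> cdom i (cinv i x) /\ cmap i (cinv i x) = x.
Proof. by case=> p ip <-; rewrite cmapK. Qed.

Lemma cimg_cmap i p : cdom i p -> cimg i (cmap i p).
Proof. by move=> ip; exists p. Qed.

Definition overlap i j : set 'cV[R]_4 := cmap i @` (cdom i `&` cdom j).

Lemma open_chart_image i (U : set M) : open U -> open (cmap i @` (cdom i `&` U)).
Proof.
move=> oU; rewrite openE => _ [p [ip jp] <-].
have Ox : cimg i (cmap i p) by exact: cimg_cmap.
have c := cinv_continuous Ox.
have h1 : \forall y \near cmap i p, U (cinv i y).
  apply: c; rewrite cmapK//; apply: open_nbhs_nbhs; split => //.
apply: filterS2 (near_in_open (@open_cimg _ _ _ i) Ox) h1 => y Oy jy.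
have [iy E] := cimg_cinv Oy.
by exists (cinv i y).
Qed.

Lemma open_overlap i j : open (overlap i j).
Proof. exact/open_chart_image/cdom_open. Qed.

Lemma overlap_cmap i j p : cdom i p -> cdom j p -> overlap i j (cmap i p).
Proof. by move=> ip jp; exists p. Qed.

Lemma transition_comp_smooth i j b :
  smooth_on (overlap i j) (fun x => cmap j (cinv i x) b 0).
Proof.
move=> k; have := transition_smooth i j k.
by move/(Ck_mxP _ _ (@open_overlap i j)); exact.
Qed.

Lemma jac_inverse i j p : cdom i p -> cdom j p -> jac j i p *m jac i j p = 1%:M.
Proof.
move=> ip jp; apply/matrixP => b a.
pose F (x : 'cV[R]_4) := cmap j (cinv i x); pose x0 := cmap i p.
have Ox : overlap i j x0 by exact: overlap_cmap.
have Fx0 : F x0 = cmap j p by rewrite /F /x0 cmapK.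
have Oy : overlap j i (F x0) by rewrite Fx0; exact: overlap_cmap.
have dF : is_derive x0 (delta_mx a 0) F (\col_d jac i j p d a).
  apply/is_derive_mxP => d k; rewrite ord1 !mxE.
  exact: is_derive_partial (@transition_comp_smooth i j d) Ox.
have h := is_derive_chain (@open_overlap j i) Oy (@transition_comp_smooth j i b 1%N) dF.
have E : \forall x \near x0, cmap i (cinv j (F x)) b 0 = x b 0.
  apply: filterS (near_in_open (@open_overlap i j) Ox) => _ [q [iq jq] <-].
  by rewrite /F cmapK// cmapK.
have [_ E1] := near_eq_is_derive E h.
rewrite !mxE; transitivity ('D_(delta_mx a 0) (fun x : 'cV[R]_4 => x b 0) x0); last first.
  have /is_derive_mxP /(_ b 0)[_ ->] := is_derive_id x0 (delta_mx a 0).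
  by rewrite !mxE eqxx andbT.
rewrite E1; apply: eq_bigr => d _; rewrite !mxE mulrC; congr (_ * _).
by rewrite Fx0.
Qed.

End Charts.

(** * Reaching every point by invertible parallel transport *)

Section Reach.
Context {R : realType} {M : topologicalType} {A : atlas R M}.
Variable g : lorentz_metric A.
Implicit Types (i j : chart A).

(** [transport] has no constructor for reversing a path, so the reverse transport is carried along
    with the proof that it inverts the forward one. *)
Definition bitransport i p j q (P Q : 'M[R]_4) :=
  [/\ transport (levi_civita g) i p j q P, transport (levi_civita g) j q i p Q &
      Q *m P = 1%:M].

Lemma bitransport_comp i p j q k r P Q P' Q' :
  bitransport i p j q P Q -> bitransport j q k r P' Q' ->
  bitransport i p k r (P' *m P) (Q *m Q').
Proof.
case=> h1 h2 h3 [h4 h5 h6]; split.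
- exact: transport_comp h1 h4.
- exact: transport_comp h5 h2.
- by rewrite mulmxA -(mulmxA Q) h6 mulmx1.
Qed.

Lemma bitransport_chart i j p : cdom i p -> cdom j p ->
  bitransport i p j p (jac i j p) (jac j i p).
Proof.
by move=> ip jp; split; [exact: transport_chart|exact: transport_chart|
  exact: jac_inverse].
Qed.

Lemma bitransport_line i (y : 'cV[R]_4) c (r : R) (Phi B : R -> 'M[R]_4) (u0 u1 : R) :
  (forall u, `|u| <= r -> cimg i (u *: delta_mx c 0 + y)) ->
  (forall u : R, `|u| <= r -> is_derive u 1 Phi
      (- (conn_mx (christoffel (g i)) c (u *: delta_mx c 0 + y) *m Phi u))) ->
  (forall u, B u *m Phi u = 1%:M) ->
  `|u0| <= r -> `|u1| <= r ->
  bitransport i (cinv i (u0 *: delta_mx c 0 + y))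
    i (cinv i (u1 *: delta_mx c 0 + y)) (Phi u1 *m B u0) (Phi u0 *m B u1).
Proof.
move=> hO dPhi BPhi h0 h1; split.
- exact: line_transport h0 h1.
- exact: line_transport h1 h0.
- by rewrite mulmxA -(mulmxA (Phi u0)) BPhi mulmx1 (mulmx1C (BPhi u0)).
Qed.

(** Balls of the sup norm are cubes, so the path from y to z that replaces one coordinate after
    another stays inside; [mix k] is its k-th corner. *)
Lemma ball_bitransport i x0 : cimg i x0 -> exists r : R, [/\ 0 < r,
  forall y, `|y - x0| < r -> cimg i y &
  forall y z, `|y - x0| < r -> `|z - x0| < r ->
    exists P Q, bitransport i (cinv i y) i (cinv i z) P Q].
Proof.
move=> Ox.
have [|r [K [r0 K0 hK]]] := @local_bound R (cimg i) x0 ('I_4 * 'I_4 * 'I_4)%type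
  (fun abc y => conn_mx (christoffel (g i)) abc.2 y abc.1.1 abc.1.2)
  (@open_cimg _ _ _ i) Ox.
  move=> [[a b] c] /=.
  by have /continuous_mxP /(_ a b) := @conn_continuous _ _ _ g i x0 c Ox.
exists r; split => //; first by move=> y /hK[].
move=> y z hy hz.
pose mix k : 'cV[R]_4 := \col_a (if (a < k)%N then z a 0 else y a 0).
have comp_lt (v : 'cV[R]_4) a : `|v - x0| < r -> `|v a 0 - x0 a 0| < r.
  by move=> h; have := mx_norm_ge (v - x0) a 0; rewrite !mxE => /le_lt_trans; apply.
have H k : (k <= 4)%N -> exists P Q, bitransport i (cinv i y) i (cinv i (mix k)) P Q.
  elim: k => [_|k ih k4].
    exists (jac i i (cinv i y)), (jac i i (cinv i y)).
    have -> : mix 0 = y by apply/matrixP => a b; rewrite mxE ord1.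
    have [iy _] := cimg_cinv (hK y hy).1.
    exact: bitransport_chart.
  have [P [Q PQ]] := ih (ltnW k4).
  pose c := Ordinal k4.
  (* The base point of the leg takes its c-th coordinate from the centre, so that both ends have
     parameters below r in absolute value and fit the symmetric interval of [line_flow]. *)
  pose w : 'cV[R]_4 := \col_a (if a == c then x0 a 0 else mix k a 0).
  pose u0 := y c 0 - x0 c 0; pose u1 := z c 0 - x0 c 0.
  have e0 : u0 *: delta_mx c 0 + w = mix k.
    apply/matrixP => a b; rewrite ord1 !mxE eqxx andbT.
    case: (eqVneq a c) => [->|_] /=; last by rewrite mulr0 add0r.
    by rewrite ltnn mulr1 subrK.
  have e1 : u1 *: delta_mx c 0 + w = mix k.+1.
    apply/matrixP => a b; rewrite ord1 !mxE eqxx andbT.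
    case: (eqVneq a c) => [->|ac] /=; first by rewrite ltnSn mulr1 subrK.
    have ak : (nat_of_ord a == k) = false.
      by apply: contraNF ac => /eqP e; apply/eqP/val_inj.
    by rewrite mulr0 add0r [in RHS]ltnS [in RHS]leq_eqVlt ak.
  pose r' := Num.max `|u0| `|u1|.
  have r'r : r' < r by rewrite /r' gt_max !comp_lt.
  have inball u : `|u| <= r' -> `|u *: delta_mx c 0 + w - x0| < r.
    move=> ur; apply: mx_norm_lt => // a b; rewrite ord1 !mxE eqxx andbT.
    case: (eqVneq a c) => [->|_] /=.
      by rewrite mulr1 addrK (le_lt_trans ur).
    by rewrite mulr0 add0r; case: ifP => _; exact: comp_lt.
  have r'0 : 0 <= r' by rewrite /r' le_max normr_ge0.
  have [||[Phi B] /= [_ _ dPhi _ BPhi]] := @line_flow _ _ _ g i w c r' K r'0 K0.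
  - by move=> u /inball /hK[].
  - move=> u /inball /hK[_ h]; apply: mx_norm_leP => // a b.
    exact: (h (a, b, c)).
  have hO u : `|u| <= r' -> cimg i (u *: delta_mx c 0 + w) by move=> /inball /hK[].
  have b0 : `|u0| <= r' by rewrite /r' le_max lexx.
  have b1 : `|u1| <= r' by rewrite /r' le_max lexx orbT.
  have := bitransport_line hO dPhi BPhi b0 b1; rewrite e0 e1 => h.
  by eexists; eexists; exact: bitransport_comp PQ h.
have := H 4 (leqnn 4).
by rewrite (_ : mix 4 = z)//; apply/matrixP => a b; rewrite mxE ltn_ord ord1.
Qed.

(** The set of reachable points is open and closed, because any two points of a small chart ball are
    joined by a transport. *)
Lemma reachable (m : M) i : connected [set: M] -> cdom i m ->
  forall q j, cdom j q -> exists P Q, bitransport i m j q P Q.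
Proof.
move=> conn im.
pose S := [set q | forall j, cdom j q -> exists P Q, bitransport i m j q P Q].
have any q j : cdom j q -> (exists P Q, bitransport i m j q P Q) -> S q.
  move=> jq [P [Q h]] j' j'q; have h' := bitransport_chart jq j'q.
  by eexists; eexists; exact: bitransport_comp h h'.
have nb q : exists j, cdom j q /\ exists2 N, nbhs q N &
    forall p, N p -> cdom j p /\ forall p', N p' ->
      exists P Q, bitransport j p j p' P Q.
  have [j jq] := cdom_cover A q; exists j; split => //.
  have [r [r0 _ hr]] := ball_bitransport (cimg_cmap jq).
  exists (cdom j `&` [set p | `|cmap j p - cmap j q| < r]).
    apply: filterI; first by apply: open_nbhs_nbhs; split => //; exact: cdom_open.
    have /cvgrPdist_lt /(_ _ r0) := cmap_continuous jq.
    by apply: filterS => p; rewrite distrC.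
  move=> p [jp hp]; split => // p' [jp' hp'].
  by have := hr _ _ hp hp'; rewrite !cmapK.
have Sm : S m.
  apply: (any m i im); exists (jac i i m), (jac i i m); exact: bitransport_chart.
have ST : S = [set: M].
  apply: conn; first by exists m.
    exists S; last by rewrite setTI.
    rewrite openE => q Sq; have [j [jq [N Nq hN]]] := nb q.
    have Nqq := nbhs_singleton Nq.
    apply: filterS Nq => p Np; have [P [Q h]] := Sq j jq.
    have [jp _] := hN p Np; apply: (any p j jp).
    have [_ hN'] := hN q Nqq; have [P' [Q' h']] := hN' p Np.
    by eexists; eexists; exact: bitransport_comp h h'.
  exists S; last by rewrite setTI.
  move=> q clq; have [j [jq [N Nq hN]]] := nb q.
  have [p [Sp Np]] := clq N Nq.
  have [jp hN'] := hN p Np; have [P [Q h]] := Sp j jp.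
  have [P' [Q' h']] := hN' q (nbhs_singleton Nq).
  by apply: (any q j jq); eexists; eexists; exact: bitransport_comp h h'.
by move=> q j jq; have Sq : S q by [rewrite ST]; exact: Sq.
Qed.

End Reach.

Section Taylor.
Context {R : realType}.

Lemma lip_of_derive (rho K : R) (f df : R -> R) :
  (forall u : R, `|u| < rho -> is_derive u 1 f (df u)) ->
  (forall u : R, `|u| < rho -> `|df u| <= K) ->
  forall s s', `|s| < rho -> `|s'| < rho -> `|f s' - f s| <= K * `|s' - s|.
Proof.
move=> hf hK.
have lin (u : R) : is_derive u 1 (fun u : R => K * u) K.
  have := is_deriveZ K (is_derive_id u (1 : R)).
  by rewrite [_%:A]mulr1.
have main s s' : `|s| < rho -> `|s'| < rho -> s <= s' -> `|f s' - f s| <= K * (s' - s).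
  move=> hs hs' ss'.
  have B u : s <= u <= s' -> `|u| < rho.
    move=> /andP[su us']; move: hs hs'; rewrite !ltr_norml => /andP[h1 _] /andP[_ h2].
    by rewrite (lt_le_trans h1 su) (le_lt_trans us' h2).
  have := @le_increment_of_derive R f (fun u => K * u) df (cst K) s s' ss'
    (fun u hu => hf u (B u hu)) (fun u _ => lin u) (fun u hu => hK u (B u hu)).
  by rewrite -mulrBr.
move=> s s' hs hs'; case: (leP s s') => ss'.
  by rewrite (ger0_norm (_ : 0 <= s' - s)) ?subr_ge0//; exact: main.
have ds : 0 <= s - s' by rewrite subr_ge0 ltW.
rewrite distrC (distrC s') (ger0_norm ds).
by apply: main => //; exact: ltW.
Qed.

Lemma taylor2 (rho K : R) (f df ddf : R -> R) : 0 <= K ->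
  (forall u : R, `|u| < rho -> is_derive u 1 f (df u)) ->
  (forall u : R, `|u| < rho -> is_derive u 1 df (ddf u)) ->
  (forall u : R, `|u| < rho -> `|ddf u| <= K) ->
  forall s s', `|s| < rho -> `|s'| < rho ->
  `|f s' - f s - (s' - s) * df s| <= K * `|s' - s| ^+ 2.
Proof.
move=> K0 hf hdf hK s s' hs hs'.
have lip := lip_of_derive hdf hK.
have lin (u : R) : is_derive u 1 (fun u : R => u * df s) (df s).
  have := is_derive_mulr (is_derive_id u (1 : R)) (is_derive_cst (df s) u 1).
  by rewrite mulr0 addr0 mul1r.
have lin2 (c u : R) : is_derive u 1 (fun u : R => c * u) c.
  have := is_deriveZ c (is_derive_id u (1 : R)).
  by rewrite [_%:A]mulr1.
pose C := K * `|s' - s|.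
have dphi (u : R) : `|u| < rho -> is_derive u 1 (fun u => f u - u * df s) (df u - df s).
  by move=> hu; exact: (is_deriveB (hf u hu) (lin u)).
have E : f s' - f s - (s' - s) * df s = (f s' - s' * df s) - (f s - s * df s).
  by ring.
rewrite E expr2 mulrA -/C.
case: (leP s s') => ss'.
  have B u : s <= u <= s' -> `|u| < rho /\ `|u - s| <= `|s' - s|.
    move=> /andP[su us']; split.
      move: hs hs'; rewrite !ltr_norml => /andP[h1 _] /andP[_ h2].
      by rewrite (lt_le_trans h1 su) (le_lt_trans us' h2).
    by rewrite !ger0_norm ?subr_ge0// lerB.
  have := @le_increment_of_derive R (fun u => f u - u * df s) (fun u => C * u)
    (fun u => df u - df s) (cst C) s s' ss'
    (fun u hu => dphi u (B u hu).1) (fun u _ => lin2 C u) _.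
  rewrite -mulrBr (ger0_norm (_ : 0 <= s' - s)) ?subr_ge0//; apply.
  move=> u /B[h1 h2]; apply: le_trans (lip s u hs h1) _.
  by rewrite ler_wpM2l.
have B u : s' <= u <= s -> `|u| < rho /\ `|u - s| <= `|s' - s|.
  move=> /andP[su us']; split.
    move: hs hs'; rewrite !ltr_norml => /andP[_ h1] /andP[h2 _].
    by rewrite (lt_le_trans h2 su) (le_lt_trans us' h1).
  rewrite !(distrC _ s) !ger0_norm ?subr_ge0//; last exact: ltW.
  by rewrite lerB.
have := @le_increment_of_derive R (fun u => f u - u * df s) (fun u => C * u)
  (fun u => df u - df s) (cst C) s' s (ltW ss')
  (fun u hu => dphi u (B u hu).1) (fun u _ => lin2 C u) _.
have ds : 0 <= s - s' by rewrite subr_ge0 ltW.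
rewrite -mulrBr distrC (distrC s' s) (ger0_norm ds).
apply => u /B[h1 h2]; apply: le_trans (lip s u hs h1) _.
by rewrite ler_wpM2l.
Qed.

Lemma Ck1_of_derive p q (f df : R -> 'M[R]_(p, q)) :
  (forall t : R, is_derive t 1 f (df t)) -> continuous df -> Ck 1 [set: R] f.
Proof.
move=> h cdf.
have hv (t v : R) : is_derive t v f (v *: df t).
  have [h1 h2] := h t.
  have d : differentiable f t by exact/derivable1_diffP.
  apply: DeriveDef; first exact: diff_derivable.
  rewrite deriveE// -[X in 'd f t X](mulr1 v) [LHS](linearZ_LR _ v 1).
  by rewrite -deriveE// h2.
split; first by move=> t _; exact: is_derive_continuous (h t).
move=> v; split; first by move=> t _; have [] := hv t v.
split => // t _.
have -> : (fun x : R => 'D_v f x) = (fun x => v *: df x).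
  by apply/funext => x; have [_ ->] := hv x v.
by apply: cvgZl_tmp; exact: cdf.
Qed.

Lemma is_derive_comp_scalar p q (A : R -> 'M[R]_(p, q)) (s : R -> R) (t ds : R) d :
  is_derive (s t) 1 A d -> is_derive t 1 s ds ->
  is_derive t 1 (fun u => A (s u)) (ds *: d).
Proof.
move=> /is_derive_mxP hA hs; apply/is_derive_mxP => i j.
have := @is_derive1_comp R (fun y => A y i j) s t _ _ (hA i j) hs.
by move/is_derive_eq; apply; rewrite !mxE mulrC.
Qed.

End Taylor.

(** * Holonomy and curvature *)

Section Rectangle.
Context {R : realType} {M : topologicalType} {A : atlas R M}.
Variable g : lorentz_metric A.
Variables (j : chart A) (x0 : 'cV[R]_4).
Hypothesis Ox0 : cimg j x0.
Variables (c d : 'I_4).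

Local Notation O := (cimg j).
Local Notation Gam := (christoffel (g j)).
Local Notation ec := (delta_mx c 0 : 'cV[R]_4).
Local Notation ed := (delta_mx d 0 : 'cV[R]_4).

Let oO : open O := @open_cimg _ _ _ j.

Lemma Gam_smooth e a b : smooth_on O (fun y => conn_mx Gam e y a b).
Proof.
exact: (conn_mx_smooth oO (@gcomp_smooth _ _ _ g j) (@gcomp_unit _ _ _ g j)).
Qed.

Lemma partial_mx_continuous e (F : 'cV[R]_4 -> 'M[R]_4) y :
  (forall a b, smooth_on O (fun y => F y a b)) -> O y ->
  {for y, continuous (partial_mx e F)}.
Proof.
move=> sF Oy; apply/continuous_mxP => a b.
have -> : (fun z => partial_mx e F z a b) = (partial e (fun z => F z a b)).
  by apply/funext => z; rewrite mxE.
exact: (Ck_continuous (smooth_derive (delta_mx e 0) (sF a b) 0%N) Oy).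
Qed.

Definition pt (s t : R) : 'cV[R]_4 := s *: ec + (t *: ed + x0).

Lemma norm_delta (e : 'I_4) : `|delta_mx e 0 : 'cV[R]_4| <= 1.
Proof.
apply: mx_norm_leP => // a b; rewrite mxE.
by case: (_ && _); rewrite ?normr1 ?normr0.
Qed.

Lemma pt_close s t r : `|s| <= r / 3 -> `|t| <= r / 3 -> 0 < r ->
  `|pt s t - x0| < r.
Proof.
move=> hs ht r0; rewrite /pt addrA addrK.
apply: le_lt_trans (ler_normD _ _) _; rewrite !normrZ.
have h1 : `|s| * `|ec| <= `|s| by rewrite ler_piMr// norm_delta.
have h2 : `|t| * `|ed| <= `|t| by rewrite ler_piMr// norm_delta.
by lra.
Qed.

(** Bounds on the first two derivatives in direction c give, by Taylor's formula, the quadratic and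
    Lipschitz estimates in the parameter that [flow_parameter] asks for. *)
Lemma rectangle_bounds : exists r K : R, [/\ 0 < r, 0 <= K &
  forall y, `|y - x0| < r -> [/\ O y,
    forall e, `|conn_mx Gam e y| <= K,
    forall e, `|partial_mx c (conn_mx Gam e) y| <= K &
    forall e a b, `|partial c (partial c (fun z => conn_mx Gam e z a b)) y| <= K]].
Proof.
pose I3 := ('I_4 * 'I_4 * 'I_4)%type.
pose f0 (k : I3) y := conn_mx Gam k.1.1 y k.1.2 k.2.
pose f1 (k : I3) y := partial c (fun z => conn_mx Gam k.1.1 z k.1.2 k.2) y.
pose f2 (k : I3) y := partial c (partial c (fun z => conn_mx Gam k.1.1 z k.1.2 k.2)) y.
have c0 k : {for x0, continuous (f0 k)}.
  exact: (Ck_continuous (Gam_smooth _ _ _ 0%N) Ox0).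
have c1 k : {for x0, continuous (f1 k)}.
  exact: (Ck_continuous (smooth_derive _ (Gam_smooth _ _ _) 0%N) Ox0).
have c2 k : {for x0, continuous (f2 k)}.
  exact: (Ck_continuous (smooth_derive _ (smooth_derive _ (Gam_smooth _ _ _)) 0%N) Ox0).
have [r0 [K0 [r00 K00 h0]]] := local_bound oO Ox0 c0.
have [r1 [K1 [r10 K10 h1]]] := local_bound oO Ox0 c1.
have [r2 [K2 [r20 K20 h2]]] := local_bound oO Ox0 c2.
exists (Num.min r0 (Num.min r1 r2)), (K0 + K1 + K2); split.
- by rewrite !lt_min r00 r10.
- by rewrite !addr_ge0.
move=> y; rewrite !lt_min => /and3P[y0 y1 y2].
have [Oy b0] := h0 y y0; have [_ b1] := h1 y y1; have [_ b2] := h2 y y2.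
split => //.
- move=> e; apply: mx_norm_leP => [|a b]; first by rewrite !addr_ge0.
  apply: le_trans (b0 (e, a, b)) _.
  by rewrite -addrA lerDl addr_ge0.
- move=> e; apply: mx_norm_leP => [|a b]; first by rewrite !addr_ge0.
  rewrite mxE; apply: le_trans (b1 (e, a, b)) _.
  by rewrite addrAC lerDr addr_ge0.
- move=> e a b; apply: le_trans (b2 (e, a, b)) _.
  by rewrite lerDr addr_ge0.
Qed.

Variables (r K : R).
Hypotheses (r0 : 0 < r) (K0 : 0 <= K).
Hypothesis bounds : forall y, `|y - x0| < r -> [/\ O y,
    forall e, `|conn_mx Gam e y| <= K,
    forall e, `|partial_mx c (conn_mx Gam e) y| <= K &
    forall e a b, `|partial c (partial c (fun z => conn_mx Gam e z a b)) y| <= K].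

(* [Phi s] is transport along the line with base point [pt s 0] in direction [d],
   [B s] its inverse and [W s] its derivative in [s]. *)
Definition flow_data (Phi B W : R -> R -> 'M[R]_4) := forall s, `|s| < r / 3 ->
    [/\ Phi s 0 = 1%:M /\ B s 0 = 1%:M /\ W s 0 = 0,
       forall t, B s t *m Phi s t = 1%:M,
       forall t : R, `|t| <= r / 3 ->
         is_derive t 1 (Phi s) (- (conn_mx Gam d (pt s t) *m Phi s t)),
       forall t : R, `|t| <= r / 3 ->
         is_derive t 1 (W s) (- (conn_mx Gam d (pt s t) *m W s t)
            - partial_mx c (conn_mx Gam d) (pt s t) *m Phi s t) &
       forall t, `|t| <= r / 3 -> is_derive s 1 (fun s => Phi s t) (W s t) /\
          {for s, continuous (fun s => W s t)}].

Lemma flow_family : exists Phi B W : R -> R -> 'M[R]_4, flow_data Phi B W.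
Proof.
pose tau := r / 3.
have tau0 : 0 < tau by rewrite divr_gt0.
have ct (t : R) : `|clip tau t| <= tau by apply: clip_le; exact: ltW.
pose Mf s t := - conn_mx Gam d (pt s (clip tau t)).
pose Nf s t := - partial_mx c (conn_mx Gam d) (pt s (clip tau t)).
have ball s t : `|s| < tau -> `|pt s (clip tau t) - x0| < r.
  by move=> hs; apply: pt_close => //; exact: ltW.
have cpt s : continuous (fun t => pt s (clip tau t)).
  move=> t; apply: cvgD; first exact: cvg_cst.
  apply: cvgD; last exact: cvg_cst.
  by apply: cvgZr_tmp; exact: clip_continuous.
have cM s : `|s| < tau -> continuous (Mf s).
  move=> hs t; apply: cvgN.
  apply: (@continuous_comp _ _ _ (fun t => pt s (clip tau t))); first exact: cpt.
  by apply: conn_continuous; have [] := bounds (ball s t hs).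
have cN s : `|s| < tau -> continuous (Nf s).
  move=> hs t; apply: cvgN.
  apply: (@continuous_comp _ _ _ (fun t => pt s (clip tau t))); first exact: cpt.
  apply: partial_mx_continuous; first exact: Gam_smooth.
  by have [] := bounds (ball s t hs).
have bM s t : `|s| < tau -> `|Mf s t| <= K.
  by move=> hs; rewrite normrN; have [_ h _ _] := bounds (ball s t hs); exact: h.
have bN : ubd tau tau Nf.
  exists K => // s t hs _; rewrite normrN.
  by have [_ _ h _] := bounds (ball s t hs); exact: h.
pose f a b t (s : R) := conn_mx Gam d (s *: ec + (clip tau t *: ed + x0)) a b.
pose df a b t (s : R) :=
  partial c (fun z => conn_mx Gam d z a b) (s *: ec + (clip tau t *: ed + x0)).
pose ddf a b t (s : R) := partial c (partial c (fun z => conn_mx Gam d z a b))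
  (s *: ec + (clip tau t *: ed + x0)).
have hf a b t (s : R) : `|s| < tau -> is_derive s 1 (f a b t) (df a b t s).
  move=> hs; have [Oy _ _ _] := bounds (ball s t hs).
  by have /is_derive_line := is_derive_partial c (Gam_smooth d a b) Oy.
have hdf a b t (s : R) : `|s| < tau -> is_derive s 1 (df a b t) (ddf a b t s).
  move=> hs; have [Oy _ _ _] := bounds (ball s t hs).
  have h := is_derive_partial c (smooth_derive (delta_mx c 0) (Gam_smooth d a b)) Oy.
  by move/is_derive_line: h.
have hddf a b t (s : R) : `|s| < tau -> `|ddf a b t s| <= K.
  by move=> hs; have [_ _ _ h] := bounds (ball s t hs); exact: h.
have qMN : uquad tau tau Mf Nf.
  exists K => // s s' t hs hs' _; apply: mx_norm_leP; first by rewrite mulr_ge0.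
  move=> a b.
  have := taylor2 K0 (hf a b t) (hdf a b t) (hddf a b t) hs hs'.
  have -> : (Mf s' t - Mf s t - (s' - s) *: Nf s t) a b =
      - (f a b t s' - f a b t s - (s' - s) * df a b t s).
    have alg (X X' Y : 'M[R]_4) (h : R) : (- X' - - X - h *: (- Y)) a b =
        - (X' a b - X a b - h * Y a b) by rewrite !mxE; ring.
    rewrite alg; congr (- (_ - _ * _)).
    by rewrite mxE.
  by rewrite normrN.
have lN : ulip tau tau Nf.
  exists K => // s s' t hs hs' _; apply: mx_norm_leP; first by rewrite mulr_ge0.
  move=> a b.
  have := lip_of_derive (hdf a b t) (hddf a b t) hs hs'.
  have -> : (Nf s' t - Nf s t) a b = - (df a b t s' - df a b t s).
    by rewrite !mxE opprD !opprK.
  by rewrite normrN.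
have [Phi [B [W h]]] := flow_parameter tau0 (ltW tau0) K0 cM cN bM qMN lN bN.
exists Phi, B, W => s hs; have [h1 h2 h3 h4 h5] := h s hs; split => //.
- by move=> t ht; have := h3 t; rewrite /Mf clip_id// mulNmx; exact.
- by move=> t ht; have := h4 t; rewrite /Mf /Nf clip_id// !mulNmx; exact.
Qed.

Lemma for_continuousD (p q : nat) (X Y : R -> 'M[R]_(p, q)) (t : R) :
  {for t, continuous X} -> {for t, continuous Y} ->
  {for t, continuous (fun t => X t + Y t)}.
Proof. exact: cvgD. Qed.

Lemma for_continuousN (p q : nat) (X : R -> 'M[R]_(p, q)) (t : R) :
  {for t, continuous X} -> {for t, continuous (fun t => - X t)}.
Proof. exact: cvgN. Qed.

Lemma is_derive_mulmx3 (p q l : nat) (X : R -> 'M[R]_(p, q)) (Y : R -> 'M[R]_(q, q))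
    (Z : R -> 'M[R]_(q, l)) (u : R) dX dY dZ :
  is_derive u 1 X dX -> is_derive u 1 Y dY -> is_derive u 1 Z dZ ->
  is_derive u 1 (fun u => X u *m Y u *m Z u)
    ((dX *m Y u + X u *m dY) *m Z u + X u *m Y u *m dZ).
Proof. by move=> hX hY hZ; exact: is_derive_mulmx (is_derive_mulmx hX hY) hZ. Qed.

(* Transport around the coordinate rectangle with sides [s] and [t], conjugated to
   the base point [m], is a C^1 curve in [s] inside the holonomy group; the matrix
   below is, up to invertible factors, its velocity at [s = 0]. *)
Lemma loop_derivative_kills (i : chart A) (m : M) (P Q : 'M[R]_4) (w : 'cV[R]_4)
    (Phi B W : R -> R -> 'M[R]_4) (t : R) :
  bitransport g i m j (cinv j x0) P Q ->
  (forall X, holonomy_algebra g i m X -> X *m w = 0) ->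
  flow_data Phi B W ->
  `|t| <= r / 3 ->
  (conn_mx Gam c (t *: ed + x0) *m Phi 0 t + W 0 t
     - Phi 0 t *m conn_mx Gam c x0) *m (P *m w) = 0.
Proof.
move=> PQ hw hfam ht.
(* Any positive number strictly below r / 3 would do: [flow_data] holds on an open interval, while
   the sides are transported over a closed one. *)
pose eps := r / 6.
have eps0 : 0 < eps by rewrite divr_gt0.
have eps3 : eps < r / 3 by rewrite /eps; have := r0; lra.
have small0 : `|0 : R| < r / 3 by rewrite normr0 divr_gt0.
have ptO s v : `|s| <= r / 3 -> `|v| <= r / 3 -> O (pt s v).
  by move=> hs hv; have [] := bounds (pt_close hs hv r0).
have flowA v : `|v| <= r / 3 -> exists AB : (R -> 'M[R]_4) * (R -> 'M[R]_4),
    let Aa := AB.1 in let Bb := AB.2 in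
    [/\ Aa 0 = 1%:M, Bb 0 = 1%:M,
    forall u : R, `|u| <= eps -> is_derive u 1 Aa
      (- (conn_mx Gam c (u *: ec + (v *: ed + x0)) *m Aa u)),
    forall u : R, `|u| <= eps -> is_derive u 1 Bb
      (Bb u *m conn_mx Gam c (u *: ec + (v *: ed + x0))) &
    forall u, Bb u *m Aa u = 1%:M].
  move=> hv; apply: (line_flow (ltW eps0) K0).
    by move=> u hu; apply: ptO => //; exact: le_trans hu (ltW eps3).
  move=> u hu.
  have h := pt_close (le_trans hu (ltW eps3)) hv r0.
  by have [_ h' _ _] := bounds h; exact: h'.
have [[A0 B0] /= [A00 B00 dA0 dB0 BA0]] := flowA 0 (ltW small0).
have [[At Bt] /= [At0 Bt0 dAt dBt BAt]] := flowA t ht.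
(* Three sides of the rectangle: along c at height 0, up along d, and back along c at height t. The
   fourth side, down along d, is [B 0 t]. *)
pose E u := Bt u *m Phi u t *m A0 u.
pose dE u := (Bt u *m conn_mx Gam c (pt u t) *m Phi u t + Bt u *m W u t) *m A0 u
   + Bt u *m Phi u t *m - (conn_mx Gam c (pt u 0) *m A0 u).
have hE (u : R) : `|u| <= eps -> is_derive u 1 E (dE u).
  move=> hu; have hu3 := le_lt_trans hu eps3.
  have [_ _ _ _ /(_ t ht)[dPhi _]] := hfam u hu3.
  exact: is_derive_mulmx3 (dBt u hu) dPhi (dA0 u hu).
have cdE (u : R) : `|u| <= eps -> {for u, continuous dE}.
  move=> hu; have hu3 := le_lt_trans hu eps3.
  have [_ _ _ _ /(_ t ht)[dPhi cW]] := hfam u hu3.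
  have cPhi := is_derive_continuous dPhi.
  have cBt := is_derive_continuous (dBt u hu).
  have cA0 := is_derive_continuous (dA0 u hu).
  have cG v : `|v| <= r / 3 -> {for u, continuous (fun u => conn_mx Gam c (pt u v))}.
    move=> hv; apply: (@continuous_comp _ _ _ (fun u => pt u v)).
      by apply: cvgD; [apply: cvgZr_tmp; exact: cvg_id|exact: cvg_cst].
    by apply: conn_continuous; apply: ptO => //; exact: ltW.
  have c1 := for_continuous_mulmx (for_continuous_mulmx cBt (cG t ht)) cPhi.
  have c2 := for_continuous_mulmx cBt cW.
  have c3 := for_continuous_mulmx (for_continuousD c1 c2) cA0.
  have c4 := for_continuousN (for_continuous_mulmx (cG 0 (ltW small0)) cA0).
  exact: for_continuousD c3 (for_continuous_mulmx (for_continuous_mulmx cBt cPhi) c4).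
(* Curves in [lie_algebra] are defined on the whole line; the substitution of eps sin s for the side
   length keeps the loop in the chart and has nonzero velocity eps at 0. *)
have sin_small (s : R) : `|eps * sin s| <= eps.
  rewrite normrM (ger0_norm (ltW eps0)).
  by apply: ler_piMr; [exact: ltW|exact: sin_max].
have hloop u : `|u| <= eps ->
    transport (levi_civita g) j (cinv j x0) j (cinv j x0) (B 0 t *m E u).
  move=> hu; have hu3 := le_lt_trans hu eps3.
  have z0 (e : 'I_4) (y : 'cV[R]_4) : (0 : R) *: delta_mx e 0 + y = y.
    by rewrite scale0r add0r.
  have n0 : `|0 : R| <= eps by rewrite normr0 ltW.
  have pA v : `|v| <= r / 3 ->
      forall s, `|s| <= eps -> O (s *: ec + (v *: ed + x0)).
    by move=> hv s hs; apply: ptO => //; exact: le_trans hs (ltW eps3).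
  have T1 := line_transport (pA 0 (ltW small0)) dA0 BA0 n0 hu.
  rewrite B00 mulmx1 !z0 in T1.
  have pB s : `|s| < r / 3 -> forall v, `|v| <= r / 3 -> O (v *: ed + (s *: ec + x0)).
    by move=> hs v hv; rewrite addrCA; apply: ptO => //; exact: ltW.
  have dB s : `|s| < r / 3 -> forall v : R, `|v| <= r / 3 -> is_derive v 1 (Phi s)
      (- (conn_mx Gam d (v *: ed + (s *: ec + x0)) *m Phi s v)).
    by move=> hs v hv; rewrite addrCA; have [_ _ h _ _] := hfam s hs; exact: h.
  have [[_ [Bu0 _]] BPu _ _ _] := hfam u hu3.
  have T2 := line_transport (pB u hu3) (dB u hu3) BPu (ltW small0) ht.
  rewrite Bu0 mulmx1 z0 addrCA in T2.
  have T3 := line_transport (pA t ht) dAt BAt hu n0.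
  rewrite At0 mul1mx z0 in T3.
  have [[P0 _] BP0 _ _ _] := hfam 0 small0.
  have T4 := line_transport (pB 0 small0) (dB 0 small0) BP0 ht (ltW small0).
  rewrite P0 mul1mx !z0 in T4.
  have := transport_comp (transport_comp (transport_comp T1 T2) T3) T4.
  by rewrite /E !mulmxA.
have [tP tQ QP] := PQ.
pose cc s := Q *m (B 0 t *m E (eps * sin s)) *m P.
pose dcc s := Q *m (B 0 t *m ((eps * cos s) *: dE (eps * sin s))) *m P.
have dsin (s : R) : is_derive s 1 (fun s => eps * sin s) (eps * cos s).
  have := is_derive_mulr (is_derive_cst eps s 1) (is_derive_sin s).
  by rewrite mul0r add0r.
have hcc (s : R) : is_derive s 1 cc (dcc s).
  have h := @is_derive_comp_scalar R 4 4 E (fun s => eps * sin s) s _ _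
    (hE _ (sin_small s)) (dsin s).
  have h1 := is_derive_mulmx (is_derive_cst (B 0 t) s 1) h.
  have h2 := is_derive_mulmx (is_derive_cst Q s 1) h1.
  have h3 := is_derive_mulmx h2 (is_derive_cst P s 1).
  move: h3; rewrite mulmx0 addr0 !mul0mx !add0r.
  exact.
have cdcc : continuous dcc.
  move=> s; apply: for_continuous_mulmx; last exact: cst_continuous.
  apply: for_continuous_mulmx; first exact: cst_continuous.
  apply: for_continuous_mulmx; first exact: cst_continuous.
  apply: cvgZ.
    by apply: cvgM; [exact: cvg_cst|exact: continuous_cos].
  apply: (@continuous_comp _ _ _ (fun s => eps * sin s)); last exact: cdE.
  by apply: cvgM; [exact: cvg_cst|exact: continuous_sin].
have [[P00 _] BP0 _ _ _] := hfam 0 small0.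
have inH : holonomy_algebra g i m (dcc 0).
  exists cc; split.
  - move=> s; rewrite /holonomy_group /= /cc -mulmxA.
    exact: transport_comp (transport_comp tP (hloop _ (sin_small s))) tQ.
  - by rewrite /cc sin0 mulr0 /E Bt0 A00 mul1mx mulmx1 BP0 mulmx1 QP.
  - exact: Ck1_of_derive hcc cdcc.
  - by rewrite derive1E; have [_ ->] := hcc 0.
have := hw _ inH; rewrite /dcc sin0 cos0 mulr0 mulr1 /dE Bt0 A00 !mul1mx !mulmx1.
rewrite -!mulmxA => h0.
(* The invertible factors [Q] and [B 0 t] and the scalar [eps] are stripped off in turn. *)
have h1 := congr1 (mulmx P) h0.
rewrite mulmx0 mulmxA (mulmx1C QP) mul1mx in h1.
have h2 := congr1 (mulmx (Phi 0 t)) h1.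
rewrite mulmx0 mulmxA (mulmx1C (BP0 t)) mul1mx -scalemxAl in h2.
move/eqP: h2; rewrite scaler_eq0 (gt_eqF eps0) /= => /eqP.
by rewrite /pt !scale0r !add0r mulmxN.
Qed.

End Rectangle.

Section HolonomyCurvature.
Context {R : realType} {M : topologicalType} {A : atlas R M}.
Variable g : lorentz_metric A.
Implicit Types (i j : chart A).

(** [G1], [G2] are the connection matrices in directions c and d, [dG1] the d-derivative of [G1] and
    [dG2] the c-derivative of [G2]. The hypothesis is the derivative at t = 0 of the loop identity,
    and it equals minus the curvature applied to k. *)
Lemma curvature_alg (dG1 G1 G2 dG2 : 'M[R]_4) (k : 'cV[R]_4) :
  ((dG1 *m 1%:M + G1 *m - (G2 *m 1%:M)) + (- (G2 *m 0) - dG2 *m 1%:M)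
    - (- (G2 *m 1%:M) *m G1)) *m k = 0 ->
  (dG2 - dG1 + (G1 *m G2 - G2 *m G1)) *m k = 0.
Proof.
rewrite !mulmx1 mulmx0 oppr0 add0r mulmxN mulNmx opprK => h.
rewrite -[LHS]opprK -mulNmx -[RHS]oppr0; congr (- _); rewrite -[RHS]h.
by congr (_ *m _); apply/matrixP => a b; rewrite !mxE; ring.
Qed.

(** [loop_derivative_kills] is the derivative in one side of the rectangle and holds for all small
    lengths t of the other; differentiating it at t = 0 produces the curvature. *)
Lemma holonomy_kills_curvature i m (w : 'cV[R]_4) j q P Q : cdom j q ->
  bitransport g i m j q P Q ->
  (forall X, holonomy_algebra g i m X -> X *m w = 0) ->
  forall c d, curv_mx (christoffel (g j)) (cmap j q) c d *m (P *m w) = 0.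
Proof.
move=> jq PQ hw c d.
pose x0 := cmap j q; have Ox : cimg j x0 by exact: cimg_cmap.
have PQ0 : bitransport g i m j (cinv j x0) P Q by rewrite /x0 cmapK.
have [r [K [r0 K0 bounds]]] := @rectangle_bounds _ _ _ g j x0 Ox c.
have [Phi [B [W fam]]] := @flow_family _ _ _ g j x0 c d r K r0 K0 bounds.
have kill t := @loop_derivative_kills _ _ _ g j x0 c d r K r0 K0 bounds
  i m P Q w Phi B W t PQ0 hw fam.
have small0 : `|0 : R| < r / 3 by rewrite normr0 divr_gt0.
have [[P0 [_ W0]] _ dP dW _] := fam 0 small0.
have pt0 : pt x0 c d 0 0 = x0 by rewrite /pt !scale0r !add0r.
have dG := @is_derive_mx_line R (cimg j) (conn_mx (christoffel (g j)) c) d x0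
  (@Gam_smooth _ _ _ g j c) Ox.
have h1 := is_derive_mulmx dG (dP 0 (ltW small0)).
have h2 := is_derive_mulmx (dP 0 (ltW small0))
  (is_derive_cst (conn_mx (christoffel (g j)) c x0) (0 : R) 1).
have h3 := is_deriveB (is_deriveD h1 (dW 0 (ltW small0))) h2.
have h4 := is_derive_mulmx h3 (is_derive_cst (P *m w) (0 : R) 1).
have near0 : \forall t \near (0 : R), `|t| <= r / 3.
  apply/nbhs_normP; exists (r / 3); first by rewrite /= divr_gt0.
  by move=> t /=; rewrite sub0r normrN => /ltW.
have neq : \forall t \near (0 : R),
   (conn_mx (christoffel (g j)) c (t *: delta_mx d 0 + x0) *m Phi 0 t + W 0 t
     - Phi 0 t *m conn_mx (christoffel (g j)) c x0) *m (P *m w) =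
   cst (0 : 'cV[R]_4) t.
  by apply: filterS near0 => t ht; exact: kill.
have h5 := near_eq_is_derive neq h4.
have [_ E] := h5.
rewrite derive_cst !mulmx0 !addr0 P0 W0 pt0 scale0r add0r in E.
rewrite curv_mxE; apply: curvature_alg.
exact/esym.
Qed.

(** The vector w is the tetrad member orthogonal to both factors of each generator: y for R10, the
    null vector l for R11, and the timelike u for R13. *)
Lemma holonomy_annihilated :
  holonomy_R10 g \/ holonomy_R11 g \/ holonomy_R13 g ->
  exists i m (w : 'cV[R]_4), [/\ cdom i m, w != 0 &
    forall X, holonomy_algebra g i m X -> X *m w = 0].
Proof.
have gen i m (eta e : 'M[R]_4) (s : seq 'M[R]_4) (o : 'I_4) : cdom i m ->
    let G := g i (cmap i m) in
    is_tetrad G eta e -> spans (holonomy_algebra g i m) s ->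
    (forall X, X \in s -> exists a b, [/\ X = wedge_endo G e a b,
       eta a o = 0 & eta b o = 0]) ->
    exists i m (w : 'cV[R]_4), [/\ cdom i m, w != 0 &
      forall X, holonomy_algebra g i m X -> X *m w = 0].
  move=> im G [ue E] sp hs; exists i, m, (col o e); split => //.
    apply/eqP => h; have := mulVmx ue => /(congr1 (fun M => M *m delta_mx o (0 : 'I_1))).
    rewrite -mulmxA -colE h mulmx0 mul1mx => /matrixP /(_ o 0).
    by rewrite !mxE !eqxx => /esym /eqP; rewrite oner_eq0.
  move=> X /sp Xs.
  have key Y : Y \in s -> Y *m col o e = 0.
    move=> /hs[a [b [-> ea eb]]].
    have dot p : (col p e)^T *m (G *m col o e) = (eta p o)%:M.
      have -> : eta p o = ((col p e)^T *m (G *m col o e)) 0 0.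
        have cE : G *m col o e = col o (G *m e) by rewrite !colE mulmxA.
        rewrite -E -mulmxA tr_col cE [LHS]mxE [RHS]mxE.
        by apply: eq_bigr => l _; rewrite [row _ _ _ _]mxE [col _ _ _ _]mxE.
      exact: mx11_scalar.
    rewrite /wedge_endo /wedge -mulmxA mulmxBl -!mulmxA !dot ea eb.
    by rewrite !mul_mx_scalar !scale0r subrr.
  have Xs' : X \in <<in_tuple s>>%VS by [].
  rewrite (coord_span Xs') mulmx_suml; apply: big1 => l _.
  by rewrite -scalemxAl key ?scaler0// mem_nth.
case=> [|[|]].
- move=> [m [i [e [im te sp]]]].
  apply: (gen i m null_gram e _ 3 im te sp) => X; rewrite !inE => /or3P[] /eqP ->.
  + by exists 0, 1; split => //; rewrite mxE.
  + by exists 0, 2; split => //; rewrite mxE.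
  + by exists 1, 2; split => //; rewrite mxE.
- move=> [m [i [e [im te sp]]]].
  apply: (gen i m null_gram e _ 0 im te sp) => X; rewrite !inE => /or3P[] /eqP ->.
  + by exists 0, 2; split => //; rewrite mxE.
  + by exists 0, 3; split => //; rewrite mxE.
  + by exists 2, 3; split => //; rewrite mxE.
- move=> [m [i [e [im te sp]]]].
  apply: (gen i m lorentz_gram e _ 0 im te sp) => X; rewrite !inE => /or3P[] /eqP ->.
  + by exists 1, 2; split => //; rewrite !mxE mulr0n.
  + by exists 2, 3; split => //; rewrite !mxE mulr0n.
  + by exists 1, 3; split => //; rewrite !mxE mulr0n.
Qed.

End HolonomyCurvature.

(** * Geodesics and the projective relation *)

Section ChartChange.
Context {R : realType} {M : topologicalType} {A : atlas R M}.
Variable g : lorentz_metric A.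
Variables (i j : chart A).

Definition trans (x : 'cV[R]_4) : 'cV[R]_4 := cmap j (cinv i x).
Definition jacf (x : 'cV[R]_4) : 'M[R]_4 :=
  \matrix_(b, a) partial a (fun y => trans y b 0) x.

Local Notation U := (overlap i j).
Let oU : open U := @open_overlap _ _ _ i j.

Lemma overlapP x : U x -> [/\ cimg i x, cimg j (trans x), cdom i (cinv i x),
  cdom j (cinv i x) & cmap i (cinv i x) = x].
Proof.
case=> p [ip jp] <-; rewrite /trans cmapK//; split => //; exact: cimg_cmap.
Qed.

Lemma jacf_jac x : U x -> jacf x = jac i j (cinv i x).
Proof. by move=> /overlapP[_ _ _ _ E]; rewrite /jac E. Qed.

Lemma jacf_unit x : U x -> jacf x \in unitmx.
Proof.
move=> Ux; have [_ _ ip jp _] := overlapP Ux; rewrite jacf_jac//.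
by have /mulmx1_unit[] := jac_inverse ip jp.
Qed.

Lemma jacf_smooth b a : smooth_on U (fun x => jacf x b a).
Proof.
move=> k; have := smooth_derive (delta_mx a 0) (@transition_comp_smooth _ _ _ i j b) k.
by apply: Ck_ext => // x _; rewrite mxE.
Qed.

Lemma metric_trans x : U x -> g i x = (jacf x)^T *m g j (trans x) *m jacf x.
Proof.
move=> Ux; have [_ _ ip jp E] := overlapP Ux.
by have := gcomp_tensor g ip jp; rewrite E -jacf_jac.
Qed.

Lemma is_derive_trans x (v : 'cV[R]_4) : U x -> is_derive x v trans (jacf x *m v).
Proof.
move=> Ux; apply/is_derive_mxP => b k; rewrite ord1.
have h := @transition_comp_smooth _ _ _ i j b.
have dv : derivable (fun y => cmap j (cinv i y) b 0) x v by exact: smooth_derivable h Ux.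
have := derivableP dv.
move/is_derive_eq; apply.
rewrite (derive_partials v oU Ux (h 1%N)) mxE; apply: eq_bigr => a _.
by rewrite mxE mulrC.
Qed.

Definition conn_along c x : 'M[R]_4 :=
  \sum_e jacf x e c *: conn_mx (christoffel (g j)) e (trans x).

Lemma metric_pull_derive x c : U x ->
  is_derive x (delta_mx c 0) (fun y => g j (trans y))
    ((conn_along c x)^T *m g j (trans x) + g j (trans x) *m conn_along c x).
Proof.
move=> Ux; have [_ Oy _ _ _] := overlapP Ux.
have -> : (conn_along c x)^T *m g j (trans x) + g j (trans x) *m conn_along c x =
    \sum_e jacf x e c *: partial_mx e (g j) (trans x).
  rewrite /conn_along [(\sum_(_ < _) _)^T]raddf_sum mulmx_suml mulmx_sumr -big_split /=.
  apply: eq_bigr => e _.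
  rewrite (metric_compat (@open_cimg _ _ _ j) (@gcomp_sym _ _ _ g j)
    (@gcomp_unit _ _ _ g j) e Oy).
  by rewrite [(_ *: _)^T]linearZ /= -scalemxAl -scalemxAr scalerDr.
apply/is_derive_mxP => a b; rewrite summxE.
have := is_derive_chain (@open_cimg _ _ _ j) Oy (@gcomp_smooth _ _ _ g j a b 1%N)
  (is_derive_trans (delta_mx c 0) Ux).
move/is_derive_eq; apply; apply: eq_bigr => e _.
by rewrite -colE [col _ _ _ _]mxE [RHS]mxE [partial_mx _ _ _ _ _]mxE.
Qed.

Lemma compat_alg (J dJ S G D : 'M[R]_4) : J *m D = dJ + S *m J ->
  (dJ^T *m G + J^T *m (S^T *m G + G *m S)) *m J + J^T *m G *m dJ =
  D^T *m (J^T *m G *m J) + J^T *m G *m J *m D.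
Proof.
move=> h.
have -> : D^T *m (J^T *m G *m J) = (J *m D)^T *m G *m J by rewrite trmx_mul !mulmxA.
have -> : J^T *m G *m J *m D = J^T *m G *m (J *m D) by rewrite !mulmxA.
rewrite h [(dJ + _)^T]raddfD /= trmx_mul !(mulmxDl, mulmxDr) !mulmxA.
mx_abel.
Qed.

(** A geodesic is built in one chart but must satisfy its equation in all of them, which requires
    this transformation law. The pulled-back connection [D] is symmetric and compatible with the
    metric, so [christoffel_unique] identifies it. *)
Lemma christoffel_trans x c : U x ->
  jacf x *m conn_mx (christoffel (g i)) c x =
  partial_mx c jacf x + conn_along c x *m jacf x.
Proof.
move=> Ux; have [Ox Oy _ _ _] := overlapP Ux.
have uJ := jacf_unit Ux.
pose D c := invmx (jacf x) *m (partial_mx c jacf x + conn_along c x *m jacf x).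
have JD e : jacf x *m D e = partial_mx e jacf x + conn_along e x *m jacf x.
  by rewrite /D mulKVmx.
have tf a b e : D e a b = D b a e.
  suff H : D e *m delta_mx b (0 : 'I_1) = D b *m delta_mx e 0.
    by move/matrixP: H => /(_ a 0); rewrite -!colE !mxE.
  apply: (can_inj (mulKmx uJ)); rewrite (mulmxA _ (D e)) (mulmxA _ (D b)) (JD e) (JD b) -!colE.
  apply/matrixP => q k; rewrite [LHS]mxE [RHS]mxE [LHS]mxE [RHS]mxE; congr (_ + _).
    rewrite [LHS]mxE [RHS]mxE.
    have E p r : partial p (fun y => jacf y q r) x =
        partial p (partial r (fun y => trans y q 0)) x.
      by apply: (partial_near_eq oU _ Ux) => y _; rewrite mxE.
    by rewrite !E; exact: (partial_comm oU _ _ (@transition_comp_smooth _ _ _ i j q) Ux).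
  have F p r : (conn_along p x *m jacf x) q r =
      \sum_e \sum_f jacf x e p * jacf x f r * christoffel (g j) (trans x) q e f.
    rewrite mxE exchange_big /=; apply: eq_bigr => f _.
    rewrite /conn_along summxE mulr_suml; apply: eq_bigr => e' _.
    by rewrite [X in X * _ = _]mxE [conn_mx _ _ _ _ _]mxE mulrAC.
  rewrite !F exchange_big /=; apply: eq_bigr => f _; apply: eq_bigr => e' _.
  rewrite (christoffel_sym (@open_cimg _ _ _ j) (@gcomp_sym _ _ _ g j) _ _ _ Oy).
  by rewrite [X in X * _]mulrC.
have comp e : partial_mx e (g i) x = (D e)^T *m g i x + g i x *m D e.
  have dJ := is_derive_partial_mx e jacf_smooth Ux.
  have h := is_derive_mulmx (is_derive_mulmx (is_derive_trmx dJ) (metric_pull_derive e Ux)) dJ.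
  have neq : \forall y \near x, (jacf y)^T *m g j (trans y) *m jacf y = g i y.
    by apply: filterS (near_in_open oU Ux) => y Uy; rewrite metric_trans.
  have /is_derive_mxP h' := near_eq_is_derive neq h.
  rewrite [in RHS](metric_trans Ux) -(compat_alg (g j (trans x)) (JD e)).
  by apply/matrixP => a b; rewrite [LHS]mxE; have [_ E] := h' a b; exact: E.
have H := christoffel_unique (@gcomp_sym _ _ _ g i)
  (@gcomp_unit _ _ _ g i) Ox tf comp.
by rewrite -H JD.
Qed.

End ChartChange.

(** * Polarisation of the difference of two connections *)

Section ProjectiveTensor.
Context {R : realType}.

Lemma proj_tensor_alg (T : 'I_4 -> 'I_4 -> 'I_4 -> R) :
  (forall a b c, T a b c = T a c b) ->
  (forall v : 'cV[R]_4, v != 0 -> exists mu : R, forall a,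
     \sum_b \sum_c T a b c * v b 0 * v c 0 = mu * v a 0) ->
  forall a b c, T a b c =
    (a == b)%:R * (2^-1 * T c c c) + (a == c)%:R * (2^-1 * T b b b).
Proof.
move=> sym hyp.
have quad (a b c : 'I_4) (s t : R) : b != c ->
    \sum_p \sum_q T a p q * (s *: delta_mx b (0 : 'I_1) + t *: delta_mx c 0) p 0
       * (s *: delta_mx b 0 + t *: delta_mx c 0 : 'cV[R]_4) q 0 =
    s * s * T a b b + 2 * s * t * T a b c + t * t * T a c c.
  move=> bc.
  have cb : (c == b) = false by rewrite eq_sym (negbTE bc).
  have lin (f : 'I_4 -> R) : \sum_q f q *
      (s *: delta_mx b 0 + t *: delta_mx c 0 : 'cV[R]_4) q 0 = s * f b + t * f c.
    rewrite (bigD1 b)//= (bigD1 c) 1?eq_sym//= big1; last first.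
      move=> q /andP[qb qc]; rewrite !mxE (negbTE qb) (negbTE qc) /=.
      by rewrite !mulr0 addr0 mulr0.
    rewrite !mxE !eqxx (negbTE bc) cb /=; ring.
  under eq_bigr do rewrite lin.
  have -> : \sum_p (s * (T a p b * (s *: delta_mx b (0 : 'I_1) + t *: delta_mx c 0) p 0)
      + t * (T a p c * (s *: delta_mx b (0 : 'I_1) + t *: delta_mx c 0) p 0)) =
      s * (s * T a b b + t * T a c b) + t * (s * T a b c + t * T a c c).
    by rewrite big_split /= -!mulr_sumr !lin.
  by rewrite (sym a c b); ring.
have e_neq0 (b c : 'I_4) (t : R) : b != c ->
    (1 *: delta_mx b 0 + t *: delta_mx c 0 : 'cV[R]_4) != 0.
  move=> bc; apply/eqP => /matrixP /(_ b 0).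
  rewrite !mxE !eqxx (negbTE bc) /= mulr0 addr0 mulr1 => /eqP.
  by rewrite oner_eq0.
have other (b : 'I_4) : exists c : 'I_4, b != c.
  by case: (eqVneq b 0) => [->|b0]; [exists 1|exists 0].
have diag a b : a != b -> T a b b = 0.
  move=> ab; have ba : b != a by rewrite eq_sym.
  (* With coefficient 0 the test vector is the basis vector of b, whose a-th component vanishes. *)
  have [mu h] := hyp _ (e_neq0 b a 0 ba).
  have := h a; rewrite quad// !mxE (negbTE ab) /=.
  by rewrite !(mul0r, mulr0, mul1r, addr0) => ->; rewrite ?mulr0.
have main (b c : 'I_4) : b != c ->
    (forall a, a != b -> a != c -> T a b c = 0) /\ T c b c = 2^-1 * T b b b.
  move=> bc; have cb : c != b by rewrite eq_sym.
  (* The test vectors are the sum and the difference of the basis vectors of b and c. Their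
     components in b and c express both T b b b and 2 T c b c as half the sum of the two factors. *)
  have [mu h] := hyp _ (e_neq0 b c 1 bc).
  have [nu k] := hyp _ (e_neq0 b c (- 1) bc).
  have v (t : R) a : (1 *: delta_mx b (0 : 'I_1) + t *: delta_mx c 0) a 0 =
      (a == b)%:R + t * (a == c)%:R.
    by rewrite !mxE !eqxx !andbT mul1r.
  split.
    move=> a ab ac; have := h a; rewrite quad// v (negbTE ab) (negbTE ac).
    by rewrite (diag a b ab) (diag a c ac) /= !mulr0n => ?; lra.
  have hb := h b; have hc := h c; have kb := k b; have kc := k c.
  rewrite !quad// !v !eqxx ?(negbTE bc) ?(negbTE cb) in hb hc kb kc.
  rewrite (diag b c bc) in hb kb; rewrite (diag c b cb) in hc kc.
  rewrite /= ?mulr0n ?mulr1n in hb hc kb kc.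
  by lra.
move=> a b c.
case: (eqVneq b c) => [->|bc].
  case: (eqVneq a c) => [->|ac]; first by rewrite mulr1n !mul1r; lra.
  by rewrite (diag a c ac) !mul0r addr0.
case: (eqVneq a b) => [->|ab].
  rewrite (negbTE bc) mulr1n mul1r mul0r addr0 sym.
  by have [_ ->] := main c b ltac:(by rewrite eq_sym).
case: (eqVneq a c) => [->|ac].
  by rewrite mulr1n mul1r mul0r add0r; have [_ ->] := main b c bc.
have [h _] := main b c bc.
by rewrite (h a ab ac) /= !mulr0n !mul0r addr0.
Qed.

End ProjectiveTensor.

(** * Local solutions of the geodesic equation *)

Section GeodesicODE.
Context {R : realType}.

Lemma convex_lip (O : set 'cV[R]_4) (f : 'cV[R]_4 -> R) x0 (r K : R) : open O ->
  smooth_on O f -> 0 <= K ->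
  (forall y, `|y - x0| < r -> O y /\ forall a, `|partial a f y| <= K) ->
  forall y z, `|y - x0| < r -> `|z - x0| < r -> `|f z - f y| <= 4 * K * `|z - y|.
Proof.
move=> oO sf K0 hK y z hy hz.
have ball (t : R) : 0 <= t <= 1 -> `|t *: (z - y) + y - x0| < r.
  move=> /andP[t0 t1].
  have -> : t *: (z - y) + y - x0 = (1 - t) *: (y - x0) + t *: (z - x0).
    by apply/matrixP => a b; rewrite !mxE; ring.
  apply: le_lt_trans (ler_normD _ _) _; rewrite !normrZ (ger0_norm t0).
  rewrite ger0_norm ?subr_ge0//.
  case: (eqVneq t 1) => [->|tn1]; first by rewrite subrr mul0r add0r mul1r.
  have t1' : 0 < 1 - t by rewrite subr_gt0 lt_neqAle tn1.
  have h1 : (1 - t) * `|y - x0| < (1 - t) * r by rewrite ltr_pM2l.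
  have h2 : t * `|z - x0| <= t * r by rewrite ler_wpM2l// ltW.
  by lra.
pose phi (t : R) := f (t *: (z - y) + y).
pose dphi (t : R) := 'D_(z - y) f (t *: (z - y) + y).
have hphi (t : R) : 0 <= t <= 1 -> is_derive t 1 phi (dphi t).
  move=> ht; have [Oy _] := hK _ (ball t ht).
  have dv : derivable f (t *: (z - y) + y) (z - y) by exact: smooth_derivable sf Oy.
  by have /is_derive_line := derivableP dv.
pose C := 4 * K * `|z - y|.
have bphi t : 0 <= t <= 1 -> `|dphi t| <= C.
  move=> ht; have [Oy hb] := hK _ (ball t ht).
  rewrite /dphi (derive_partials (z - y) oO Oy (sf 1%N)).
  apply: le_trans (ler_norm_sum _ _ _) _.
  apply: le_trans (_ : \sum_(a < 4) `|z - y| * K <= _).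
    apply: ler_sum => a _; rewrite normrM; apply: ler_pM => //.
      exact: mx_norm_ge.
    exact: hb.
  rewrite sumr_const card_ord /C; move: `|z - y| => N.
  by rewrite (_ : N * K *+ 4 = 4 * K * N)// -mulr_natr; ring.
have lin (t : R) : is_derive t 1 (fun t : R => C * t) C.
  have := is_deriveZ C (is_derive_id t (1 : R)).
  by rewrite [_%:A]mulr1.
have := @le_increment_of_derive R phi (fun t => C * t) dphi (cst C) 0 1 ler01 hphi
  (fun t _ => lin t) bphi.
by rewrite /phi scale1r scale0r add0r subrK mulr1 mulr0 subr0.
Qed.

(* Bounded Lipschitz functions of the state, whose two columns are position and
   velocity. *)
Definition bdlip (f : 'M[R]_(4, 2) -> R) := exists C, [/\ 0 <= C,
  forall X, `|f X| <= C & forall X Y, `|f X - f Y| <= C * `|X - Y|].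

Lemma bdlip_cst c : bdlip (fun=> c).
Proof.
exists `|c|; split => // X Y.
by rewrite subrr normr0 mulr_ge0.
Qed.

Lemma bdlip_add f h : bdlip f -> bdlip h -> bdlip (fun X => f X + h X).
Proof.
move=> [C [C0 b l]] [D [D0 b' l']]; exists (C + D); split.
- exact: addr_ge0.
- by move=> X; apply: le_trans (ler_normD _ _) _; rewrite lerD.
move=> X Y; rewrite opprD addrACA mulrDl.
by apply: le_trans (ler_normD _ _) _; rewrite lerD.
Qed.

Lemma bdlip_mul f h : bdlip f -> bdlip h -> bdlip (fun X => f X * h X).
Proof.
move=> [C [C0 b l]] [D [D0 b' l']]; exists (C * D + C * D); split.
- by rewrite addr_ge0// mulr_ge0.
- move=> X; rewrite normrM; apply: le_trans (ler_pM _ _ (b X) (b' X)) _ => //.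
  by rewrite lerDl mulr_ge0.
move=> X Y; rewrite (_ : _ - _ = (f X - f Y) * h X + f Y * (h X - h Y)); last by ring.
apply: le_trans (ler_normD _ _) _; rewrite !normrM mulrDl; apply: lerD.
  apply: le_trans (ler_pM _ _ (l X Y) (b' X)) _ => //.
  by rewrite mulrAC.
by apply: le_trans (ler_pM _ _ (b Y) (l' X Y)) _ => //; rewrite mulrA.
Qed.

Lemma bdlip_opp f : bdlip f -> bdlip (fun X => - f X).
Proof.
move=> [C [C0 b l]]; exists C; split => //.
  by move=> X; rewrite normrN.
by move=> X Y; rewrite -opprD normrN.
Qed.

Lemma bdlip_sum (I : finType) (f : I -> 'M[R]_(4, 2) -> R) :
  (forall i, bdlip (f i)) -> bdlip (fun X => \sum_i f i X).
Proof.
move=> h.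
suff H (s : seq I) : bdlip (fun X => \sum_(i <- s) f i X) by exact: H.
elim: s => [|i s ih].
  rewrite (_ : (fun _ => _) = (fun=> 0)); first exact: bdlip_cst.
  by apply/funext => X; rewrite big_nil.
rewrite (_ : (fun _ => _) = (fun X => f i X + \sum_(i <- s) f i X)).
  exact: bdlip_add.
by apply/funext => X; rewrite big_cons.
Qed.

Lemma bdlip_common (I : finType) (f : I -> 'M[R]_(4, 2) -> R) : (forall i, bdlip (f i)) ->
  exists C, [/\ 0 <= C, forall i X, `|f i X| <= C &
    forall i X Y, `|f i X - f i Y| <= C * `|X - Y|].
Proof.
move=> /choice[C hC]; exists (\sum_i C i).
have C0 i : 0 <= C i by have [] := hC i.
have le i : C i <= \sum_i C i.
  by rewrite (bigD1 i)//= lerDl; apply: sumr_ge0.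
split; first exact: sumr_ge0.
- by move=> i X; have [_ h _] := hC i; apply: le_trans (h X) _.
- move=> i X Y; have [_ _ h] := hC i; apply: le_trans (h X Y) _.
  by rewrite ler_wpM2r.
Qed.

Variable O : set 'cV[R]_4.
Hypothesis oO : open O.
Variable Gam : 'cV[R]_4 -> 'I_4 -> 'I_4 -> 'I_4 -> R.
Hypothesis sGam : forall a b c, smooth_on O (fun x => Gam x a b c).

Definition accel (x v : 'cV[R]_4) : 'cV[R]_4 :=
  \col_a (- \sum_b \sum_c Gam x a b c * v b 0 * v c 0).

(** Clipping position and velocity componentwise around the initial data makes the right-hand side
    bounded and globally Lipschitz, so [picard] applies; near time 0 the clipping is inactive. *)
Lemma geodesic_local (x0 v0 : 'cV[R]_4) : O x0 -> v0 != 0 ->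
  exists (del : R) (x v : R -> 'cV[R]_4), [/\ 0 < del, x 0 = x0, v 0 = v0 &
    forall t : R, `|t| < del -> [/\ O (x t), v t != 0, is_derive t 1 x (v t) &
      is_derive t 1 v (accel (x t) (v t))]].
Proof.
move=> Ox v0n.
pose I3 := ('I_4 * 'I_4 * 'I_4)%type; pose I4 := (I3 * 'I_4)%type.
pose f0 (k : I3) y := Gam y k.1.1 k.1.2 k.2.
pose f1 (k : I4) y := partial k.2 (f0 k.1) y.
have c0 k : {for x0, continuous (f0 k)}.
  exact: (Ck_continuous (sGam _ _ _ 0%N) Ox).
have c1 k : {for x0, continuous (f1 k)}.
  exact: (Ck_continuous (smooth_derive _ (sGam _ _ _) 0%N) Ox).
have [r1 [K1 [r10 K10 h1]]] := local_bound oO Ox c0.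
have [r2 [K2 [r20 K20 h2]]] := local_bound oO Ox c1.
pose r := Num.min r1 r2.
have r0 : 0 < r by rewrite lt_min r10.
have r20' : 0 < r / 2 by rewrite divr_gt0.
pose pos (X : 'M[R]_(4, 2)) : 'cV[R]_4 := \col_a (x0 a 0 + clip (r / 2) (X a 0 - x0 a 0)).
pose vel (X : 'M[R]_(4, 2)) : 'cV[R]_4 := \col_a (v0 a 0 + clip 1 (X a 1 - v0 a 0)).
have pos_ball X : `|pos X - x0| < r.
  apply: mx_norm_lt => // a b; rewrite ord1 !mxE addrC addKr.
  apply: le_lt_trans (clip_le _ (ltW r20')) _.
  by rewrite ltr_pdivrMr// ltr_pMr// ltr1n.
have pos_lip X Y : `|pos X - pos Y| <= `|X - Y|.
  apply: mx_norm_leP => // a b; rewrite ord1 !mxE opprD addrACA subrr add0r.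
  apply: le_trans (clip_lip _ _ _) _; rewrite opprB addrA subrK.
  by have := mx_norm_ge (X - Y) a 0; rewrite !mxE.
have bdlip_vel a : bdlip (fun X => vel X a 0).
  exists (`|v0 a 0| + 1); split; first by rewrite addr_ge0.
    move=> X; rewrite mxE; apply: le_trans (ler_normD _ _) _.
    by rewrite lerD2l clip_le.
  move=> X Y; rewrite !mxE opprD addrACA subrr add0r.
  apply: le_trans (clip_lip _ _ _) _; rewrite opprB addrA subrK.
  have h := mx_norm_ge (X - Y) a 1; rewrite !mxE in h; apply: le_trans h _.
  by rewrite ler_peMl// lerDr.
have bdlip_Gam a b c : bdlip (fun X => Gam (pos X) a b c).
  exists (K1 + 4 * K2); split; first by rewrite addr_ge0// mulr_ge0.
    move=> X; have := pos_ball X; rewrite lt_min => /andP[/h1[_ h] _].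
    by apply: le_trans (h (a, b, c)) _; rewrite lerDl mulr_ge0.
  move=> X Y.
  have lip := @convex_lip O (fun y => Gam y a b c) x0 r2 K2 oO (sGam a b c) K20 _
    (pos Y) (pos X) _ _.
  apply: le_trans (lip _ _ _) _.
  - by move=> y /h2[Oy h]; split => // e; exact: (h ((a, b, c), e)).
  - by have := pos_ball Y; rewrite lt_min => /andP[].
  - by have := pos_ball X; rewrite lt_min => /andP[].
  apply: le_trans (_ : 4 * K2 * `|X - Y| <= _); first by rewrite ler_wpM2l// mulr_ge0.
  by rewrite ler_wpM2r// lerDr.
pose F (X : 'M[R]_(4, 2)) : 'M[R]_(4, 2) :=
  \matrix_(a, k) (if k == 0 then vel X a 0 else accel (pos X) (vel X) a 0).
have blF (ak : 'I_4 * 'I_2) : bdlip (fun X => F X ak.1 ak.2).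
  case: ak => a k /=.
  case: (eqVneq k 0) => [->|k0].
    by rewrite (_ : (fun X => _) = (fun X => vel X a 0))//; apply/funext => X; rewrite mxE.
  have : bdlip (fun X => - \sum_b \sum_c Gam (pos X) a b c * vel X b 0 * vel X c 0).
    by apply/bdlip_opp/bdlip_sum => b; apply: bdlip_sum => c; apply/bdlip_mul => //; exact: bdlip_mul.
  by congr bdlip; apply/funext => X; rewrite mxE (negbTE k0) mxE.
have [C [C0 bF lF]] := bdlip_common blF.
have lipF X Y : `|F X - F Y| <= (C + 1) * `|X - Y|.
  apply: mx_norm_leP; first by rewrite mulr_ge0// addr_ge0.
  move=> a k; have := lF (a, k) X Y => /= h.
  have -> : (F X - F Y) a k = F X a k - F Y a k by rewrite mxE [X in _ + X]mxE.
  by apply: le_trans h _; rewrite ler_wpM2r// lerDl.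
pose X0 : 'M[R]_(4, 2) := \matrix_(a, k) (if k == 0 then x0 a 0 else v0 a 0).
have C1 : 0 < C + 1 by rewrite ltr_wpDl.
have [|||X [XX0 dX _]] := @picard R 4 2 (fun _ X => F X) X0 (C + 1) C C1.
- move=> X cX t; apply/cvgrPdist_lt => e e0.
  have /cvgrPdist_lt /(_ (e / (C + 1)) (divr_gt0 e0 C1)) := cX t.
  apply: filterS => s hs; apply: le_lt_trans (lipF _ _) _.
  by rewrite mulrC -ltr_pdivlMr.
- by move=> _; exact: lipF.
- by move=> _; apply: mx_norm_leP => // a k; exact: (bF (a, k)).
pose x (t : R) : 'cV[R]_4 := \col_a X t a 0; pose v (t : R) : 'cV[R]_4 := \col_a X t a 1.
have cX : {for (0 : R), continuous X} by exact: is_derive_continuous (dX 0).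
have [ o vo] := vec_neq0 v0n.
(* The first two bounds keep the clipping inactive; the third keeps the o-th component of the
   velocity, hence the velocity, away from 0. *)
pose e := Num.min (r / 2) (Num.min 1 `|v0 o 0|).
have e0 : 0 < e by rewrite !lt_min r20' ltr01 normr_gt0 vo.
have /nbhs_normP[del /= del0 hdel] : \forall t \near (0 : R), `|X 0 - X t| < e.
  by have /cvgrPdist_lt := cX; exact.
exists del, x, v; split => //.
- by apply/matrixP => a k; rewrite mxE XX0 ord1 mxE.
- by apply/matrixP => a k; rewrite mxE XX0 ord1 mxE.
move=> t ht.
have := hdel t; rewrite /= sub0r normrN => /(_ ht); rewrite XX0 !lt_min => /and3P[e1 e2 e3].
have px : pos (X t) = x t.
  apply/matrixP => a k; rewrite !mxE clip_id; first by rewrite addrC subrK.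
  have h := mx_norm_ge (X0 - X t) a 0; rewrite !mxE in h.
  by rewrite distrC; apply: le_trans h _; exact: ltW.
have pv : vel (X t) = v t.
  apply/matrixP => a k; rewrite !mxE clip_id; first by rewrite addrC subrK.
  have h := mx_norm_ge (X0 - X t) a 1; rewrite !mxE in h.
  by rewrite distrC; apply: le_trans h _; exact: ltW.
have /is_derive_mxP dXt := dX t.
split.
- by rewrite -px; have := pos_ball (X t); rewrite lt_min => /andP[/h1[]].
- apply/eqP => /matrixP /(_ o 0); rewrite !mxE => vt0.
  have h := mx_norm_ge (X0 - X t) o 1; rewrite !mxE vt0 subr0 in h.
  by have := le_lt_trans h e3; rewrite ltxx.
- apply/is_derive_mxP => a k; have := dXt a 0; rewrite mxE /= pv ord1.
  by apply: is_derive_ext => s; rewrite mxE.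
- apply/is_derive_mxP => a k; have := dXt a 1; rewrite mxE /= pv px ord1.
  by apply: is_derive_ext => s; rewrite mxE.
Qed.

End GeodesicODE.

Section CurveSmooth.
Context {R : realType}.

Lemma open_norm_lt (del : R) : open [set t : R | `|t| < del].
Proof.
rewrite openE => t It; apply/nbhs_normP; exists (del - `|t|); first by rewrite /= subr_gt0.
move=> s /= hs; have := ler_normB t (t - s); rewrite opprB addrCA subrr addr0.
by move: It; rewrite /=; lra.
Qed.

Lemma Ck_succ_of_derive p q k (I : set R) (f df : R -> 'M[R]_(p, q)) : open I ->
  (forall t : R, I t -> is_derive t 1 f (df t)) -> Ck k I df -> Ck k.+1 I f.
Proof.
move=> oI h kdf.
have hv (t v : R) : I t -> is_derive t v f (v *: df t).
  move=> It; have [h1 h2] := h t It.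
  have d : differentiable f t by exact/derivable1_diffP.
  apply: DeriveDef; first exact: diff_derivable.
  rewrite deriveE// -[X in 'd f t X](mulr1 v) [LHS](linearZ_LR _ v 1).
  by rewrite -deriveE// h2.
split; first by move=> t It; exact: is_derive_continuous (h t It).
move=> v; split; first by move=> t It; have [] := hv t v It.
have : Ck k I (fun t => v *: df t).
  apply/(Ck_mxP _ _ oI) => a b.
  have : Ck k I (fun t => v * df t a b).
    apply: (Ck_mul oI); first exact: Ck_cst.
    by move/(Ck_mxP _ _ oI): kdf; exact.
  by apply: (Ck_ext oI) => t _; rewrite mxE.
by apply: (Ck_ext oI) => t It; have [_ ->] := hv t v It.
Qed.

(** Bootstrapping: position and velocity of class C^k make both derivatives, the velocity and the
    acceleration, of class C^k. *)
Lemma geodesic_ode_smooth (O : set 'cV[R]_4) Gam (I : set R) (x v : R -> 'cV[R]_4) :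
  open O -> (forall a b c, smooth_on O (fun x => Gam x a b c)) -> open I ->
  (forall t : R, I t -> [/\ O (x t), is_derive t 1 x (v t) &
     is_derive t 1 v (accel Gam (x t) (v t))]) ->
  forall k, Ck k I x /\ Ck k I v.
Proof.
move=> oO sGam oI h.
have dx (t : R) : I t -> is_derive t 1 x (v t) by move=> /h[].
have dv (t : R) : I t -> is_derive t 1 v (accel Gam (x t) (v t)) by move=> /h[].
have xO t : I t -> O (x t) by move=> /h[].
elim=> [|k [kx kv]].
  split; split => //.
    by move=> t It; exact: is_derive_continuous (dx t It).
  by move=> t It; exact: is_derive_continuous (dv t It).
split; first exact: Ck_succ_of_derive oI dx kv.
apply: (Ck_succ_of_derive oI dv); apply/(Ck_mxP _ _ oI) => a b.
have kvc e : Ck k I (fun t => v t e 0) by move/(Ck_mxP _ _ oI): kv; exact.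
have : Ck k I (fun t => - \sum_e \sum_f Gam (x t) a e f * v t e 0 * v t f 0).
  apply: (Ck_opp oI); apply: (Ck_sum oI) => e; apply: (Ck_sum oI) => f.
  apply: (Ck_mul oI) (kvc f); apply: (Ck_mul oI) (kvc e).
  exact: (Ck_comp oI oO xO kx (sGam a e f)).
by apply: (Ck_ext oI) => t _; rewrite mxE.
Qed.

End CurveSmooth.

(** * From common geodesic paths to the projective covector *)

Section Geodesics.
Context {R : realType} {M : topologicalType} {A : atlas R M}.
Variable g : lorentz_metric A.

Lemma accelE (Gam : 'cV[R]_4 -> 'I_4 -> 'I_4 -> 'I_4 -> R) x (v : 'cV[R]_4) :
  accel Gam x v = - \sum_c v c 0 *: (conn_mx Gam c x *m v).
Proof.
apply/matrixP => a k; rewrite ord1 [RHS]mxE [LHS]mxE summxE; congr (- _).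
apply: eq_bigr => b _; rewrite [RHS]mxE [X in _ = _ * X]mxE mulr_sumr.
by apply: eq_bigr => c _; rewrite mxE; ring.
Qed.

Lemma geodesic_chart_alg (J Gi Gj : 'I_4 -> 'M[R]_4) (J0 : 'M[R]_4) (v : 'cV[R]_4) :
  (forall c, J0 *m Gi c = J c + (\sum_e J0 e c *: Gj e) *m J0) ->
  (\sum_c v c 0 *: J c) *m v + J0 *m (- \sum_c v c 0 *: (Gi c *m v))
  + \sum_e (J0 *m v) e 0 *: (Gj e *m (J0 *m v)) = 0.
Proof.
move=> h.
have e1 : J0 *m (\sum_c v c 0 *: (Gi c *m v)) =
    (\sum_c v c 0 *: J c) *m v
    + \sum_c v c 0 *: ((\sum_e J0 e c *: Gj e) *m (J0 *m v)).
  rewrite mulmx_sumr mulmx_suml -big_split /=; apply: eq_bigr => c _.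
  by rewrite -scalemxAr (mulmxA J0) h mulmxDl scalerDr -scalemxAl -(mulmxA _ J0).
have e2 : \sum_c v c 0 *: ((\sum_e J0 e c *: Gj e) *m (J0 *m v)) =
    \sum_e (J0 *m v) e 0 *: (Gj e *m (J0 *m v)).
  under eq_bigr do rewrite mulmx_suml scaler_sumr.
  rewrite exchange_big /=; apply: eq_bigr => e _.
  rewrite [(J0 *m v) e 0]mxE scaler_suml; apply: eq_bigr => c _.
  by rewrite -scalemxAl scalerA mulrC.
by rewrite mulmxN e1 e2 opprD addrA subrr add0r addNr.
Qed.

(** A solution in the chart i becomes a geodesic once its smoothness and its equation are carried to
    every chart j that it meets; [christoffel_trans] supplies the latter. *)
Lemma geodesic_exists i (x0 v0 : 'cV[R]_4) : cimg i x0 -> v0 != 0 ->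
  exists (del : R) (x v : R -> 'cV[R]_4), [/\ 0 < del, x 0 = x0, v 0 = v0,
    forall t : R, `|t| < del -> [/\ cimg i (x t), is_derive t 1 x (v t) &
      is_derive t 1 v (accel (christoffel (g i)) (x t) (v t))] &
    geodesic (levi_civita g) [set t : R | `|t| < del] (fun t => cinv i (x t))].
Proof.
move=> Ox v0n.
have sGam := christoffel_smooth (@open_cimg _ _ _ i) (@gcomp_smooth _ _ _ g i)
  (@gcomp_unit _ _ _ g i).
have [del [x [v [del0 xx0 vv0 sol]]]] := geodesic_local (@open_cimg _ _ _ i) sGam Ox v0n.
exists del, x, v; split => //; first by move=> t /sol[].
pose I := [set t : R | `|t| < del].
have oI : open I by exact: open_norm_lt.
have xC t : I t -> cimg i (x t) by move=> /sol[].
have dx (t : R) : I t -> is_derive t 1 x (v t) by move=> /sol[].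
have dv (t : R) : I t -> is_derive t 1 v (accel (christoffel (g i)) (x t) (v t)).
  by move=> /sol[].
have smth := geodesic_ode_smooth (@open_cimg _ _ _ i) sGam oI
  (fun t It => And3 (xC t It) (dx t It) (dv t It)).
have cgam t : I t -> {for t, continuous (fun t => cinv i (x t))}.
  move=> It; apply: continuous_comp; first exact: is_derive_continuous (dx t It).
  exact: cinv_continuous (xC t It).
have oI' (j : chart A) : open (I `&` (fun t => cinv i (x t)) @^-1` cdom j).
  rewrite openE => t [It jt]; apply: filterI; first exact: (near_in_open oI It).
  apply: (cgam t It); apply: open_nbhs_nbhs; split => //; exact: cdom_open.
have xU j t : I t -> cdom j (cinv i (x t)) -> overlap i j (x t).
  move=> It jt; have [ip E] := cimg_cinv (xC t It).
  by exists (cinv i (x t)).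
split.
  split => // j k; have oJ := oI' j; apply/(Ck_mxP _ _ oJ) => b l; rewrite ord1.
  apply: (@Ck_comp R _ _ k _ (overlap i j) x (fun y => cmap j (cinv i y) b 0) oJ
    (@open_overlap _ _ _ i j)).
  - by move=> t [It jt]; exact: xU.
  - have [kx _] := smth k; apply: Ck_sub kx; exact: subIsetl.
  - exact: transition_comp_smooth.
move=> j t It jt y.
have Ut := xU j t It jt.
have dy (s : R) : I s -> cdom j (cinv i (x s)) -> is_derive s 1 y (jacf i j (x s) *m v s).
  move=> Is js; apply/is_derive_mxP => b l; rewrite ord1.
  have := is_derive_chain (@open_overlap _ _ _ i j) (xU j s Is js)
    (@transition_comp_smooth _ _ _ i j b 1%N) (dx s Is).
  move/is_derive_eq; apply; rewrite mxE; apply: eq_bigr => a _.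
  by rewrite mxE mulrC.
have near_t : \forall s \near t, I s /\ cdom j (cinv i (x s)).
  have oJ := oI' j; rewrite openE in oJ.
  exact: (oJ t (conj It jt)).
have dyE : derive1 y t = jacf i j (x t) *m v t.
  by rewrite derive1E; have [_ E] := dy t It jt.
split.
  rewrite dyE; apply/eqP => h.
  have uJ := jacf_unit Ut.
  have [_ vt _ _] := sol t It; move/eqP: vt; apply.
  by rewrite -[v t](mulKmx uJ) h mulmx0.
pose dJ := \sum_c v t c 0 *: partial_mx c (jacf i j) (x t).
have djac : is_derive t 1 (fun s => jacf i j (x s)) dJ.
  apply/is_derive_mxP => a b; rewrite summxE.
  have := is_derive_chain (@open_overlap _ _ _ i j) Ut
    (@jacf_smooth _ _ _ i j a b 1%N) (dx t It).
  move/is_derive_eq; apply; apply: eq_bigr => c _.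
  by rewrite [RHS]mxE [partial_mx _ _ _ _ _]mxE.
have d2 := is_derive_mulmx djac (dv t It).
have neq : \forall s \near t, jacf i j (x s) *m v s = derive1 y s.
  apply: filterS near_t => s [Is js].
  by rewrite derive1E; have [_ E] := dy s Is js.
have [_ d2E] := near_eq_is_derive neq d2.
have y2 : derive1n 2 y t = dJ *m v t + jacf i j (x t) *m accel (christoffel (g i)) (x t) (v t).
  by rewrite derive1nS derive1n1 derive1E.
have yt : y t = trans i j (x t) by [].
have key := geodesic_chart_alg (v t) (fun c => christoffel_trans g c Ut).
rewrite -accelE in key.
move=> a; rewrite y2 dyE yt.
have /matrixP /(_ a 0) := key; rewrite mxE [X in _ = X -> _]mxE => K; apply: etrans K.
congr (_ + _).
set w := jacf i j (x t) *m v t.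
have := accelE (christoffel (g j)) (trans i j (x t)) w.
move/(congr1 -%R); rewrite opprK => <-.
by rewrite [RHS]mxE /accel [X in _ = - X]mxE opprK.
Qed.

Variable g' : lorentz_metric A.

(** One component of x = y o tau is considered: t1, t2 are the first two derivatives of tau, [ya]
    and [y2] those of the component of y, and [ac] is the second derivative of x. The second
    derivatives are eliminated between the two geodesic equations. *)
Lemma proj_accel_alg (G G' : 'I_4 -> 'I_4 -> R) (y : 'cV[R]_4) (t1 t2 ac y2 ya : R) :
  t1 != 0 ->
  ac = - \sum_b \sum_c G b c * (t1 *: y) b 0 * (t1 *: y) c 0 ->
  ac = t2 * ya + t1 * (t1 * y2) ->
  y2 + \sum_b \sum_c G' b c * y b 0 * y c 0 = 0 ->
  \sum_b \sum_c (G' b c - G b c) * (t1 *: y) b 0 * (t1 *: y) c 0 = t2 / t1 * (t1 * ya).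
Proof.
move=> t10 h1 h2 h3.
have e (F : 'I_4 -> 'I_4 -> R) : \sum_b \sum_c F b c * (t1 *: y) b 0 * (t1 *: y) c 0 =
    t1 * (t1 * \sum_b \sum_c F b c * y b 0 * y c 0).
  rewrite !mulr_sumr; apply: eq_bigr => b _; rewrite !mulr_sumr; apply: eq_bigr => c _.
  by rewrite !mxE; ring.
have -> : \sum_b \sum_c (G' b c - G b c) * (t1 *: y) b 0 * (t1 *: y) c 0 =
    \sum_b \sum_c G' b c * (t1 *: y) b 0 * (t1 *: y) c 0
    - \sum_b \sum_c G b c * (t1 *: y) b 0 * (t1 *: y) c 0.
  rewrite -sumrB; apply: eq_bigr => b _; rewrite -sumrB; apply: eq_bigr => c _.
  by ring.
rewrite mulrA divfK//; move: h1; rewrite !e.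
move: (\sum_b \sum_c G b c * _ * _) => S; move: h3.
move: (\sum_b \sum_c G' b c * _ * _) => S' h3 h1.
have -> : S' = - y2 by lra.
by move: h1 h2 => -> h2; rewrite mulrN mulrN addrC; lra.
Qed.

(** The factor mu is tau'' / tau' at 0, for the reparametrisation tau that makes the geodesic of [g]
    with initial velocity v0 one of [g']. *)
Lemma projective_direction i (x0 v0 : 'cV[R]_4) : cimg i x0 -> v0 != 0 ->
  projectively_related (levi_civita g) (levi_civita g') ->
  exists mu : R, forall a, \sum_b \sum_c
    (christoffel (g' i) x0 a b c - christoffel (g i) x0 a b c) * v0 b 0 * v0 c 0
    = mu * v0 a 0.
Proof.
move=> Ox v0n proj.
have [del [x [v [del0 xx0 vv0 sol geo]]]] := geodesic_exists Ox v0n.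
pose I := [set t : R | `|t| < del].
have oI : open I by exact: open_norm_lt.
have itvI : is_interval I.
  move=> a b; rewrite /I /= !ltr_norml => /andP[a1 a2] /andP[b1 b2] c /andP[ac cb].
  by rewrite ltr_norml (lt_le_trans a1 ac) (le_lt_trans cb b2).
have path : geodesic_path (levi_civita g) I (fun t => cinv i (x t)).
  exists id, (fun t => cinv i (x t)); split => //.
  - by move=> k; exact: Ck_id.
  - by move=> t _; rewrite derive1_id oner_eq0.
  - by rewrite image_id.
have [tau [c' [s1 s2 [s3 s4] s5]]] := (proj I _ oI itvI).1 path.
have I0 : I 0 by rewrite /I /= normr0.
pose y (s : R) := cmap i (c' s).
have xC t : I t -> cimg i (x t) by move=> /sol[].
have dom t : I t -> (tau @` I) (tau t) /\ cdom i (c' (tau t)).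
  move=> It; split; first by exists t.
  by rewrite -s5//; have [] := cimg_cinv (xC t It).
have xy t : I t -> x t = y (tau t).
  move=> It; rewrite /y -s5//.
  by have [_ ->] := cimg_cinv (xC t It).
have [_ smy] := s3; have smyi := smy i.
have dyd (t : R) : I t -> is_derive (tau t) 1 y (derive1 y (tau t)).
  move=> It; have [t1 t2] := dom t It; rewrite derive1E; apply: derivableP.
  by have [_ /(_ 1)[h _]] := smyi 1%N; apply: h; split.
have dtau (t : R) : I t -> is_derive t 1 tau (derive1 tau t).
  move=> It; rewrite derive1E; apply: derivableP.
  by have [_ /(_ 1)[h _]] := s1 1%N; exact: h.
have vE t : I t -> v t = derive1 tau t *: derive1 y (tau t).
  move=> It; have h := is_derive_comp_scalar (dyd t It) (dtau t It).
  have neq : \forall s \near t, y (tau s) = x s.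
    by apply: filterS (near_in_open oI It) => s Is; rewrite xy.
  have [_ e1] := near_eq_is_derive neq h.
  by have [_ [_ e2] _] := sol t It; rewrite -e2 e1.
have dy2 : is_derive (tau 0) 1 (derive1 y) (derive1n 2 y (tau 0)).
  have [t1 t2] := dom 0 I0; rewrite derive1nS derive1n1 derive1E; apply: derivableP.
  have [_ /(_ 1)[_ [_ /(_ 1)[h _]]]] := smyi 2%N.
  have -> : derive1 y = (fun s : R => 'D_1 y s) by apply/funext => s; rewrite derive1E.
  by apply: h; split.
have dtau2 : is_derive (0 : R) 1 (derive1 tau) (derive1n 2 tau 0).
  rewrite derive1nS derive1n1 derive1E; apply: derivableP.
  have [_ /(_ 1)[_ [_ /(_ 1)[h _]]]] := s1 2%N.
  have -> : derive1 tau = (fun s : R => 'D_1 tau s) by apply/funext => s; rewrite derive1E.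
  exact: h.
have /is_derive_mxP dyt := is_derive_comp_scalar dy2 (dtau 0 I0).
have t10 := s2 0 I0.
set t1 := derive1 tau 0 in dyt t10; set t2 := derive1n 2 tau 0 in dtau2.
have acc a : accel (christoffel (g i)) x0 v0 a 0 =
    t2 * derive1 y (tau 0) a 0 + t1 * (t1 * derive1n 2 y (tau 0) a 0).
  have h := is_derive_mulr dtau2 (dyt a 0).
  have neq : \forall s \near (0 : R), derive1 tau s * derive1 y (tau s) a 0 = v s a 0.
    by apply: filterS (near_in_open oI I0) => s Is; rewrite vE// mxE.
  have [_ e1] := near_eq_is_derive neq h.
  have [_ _ /is_derive_mxP /(_ a 0)[_ e2]] := sol 0 I0.
  by rewrite -xx0 -vv0 -e2 e1 [X in _ + _ * X = _]mxE.
have [t1d t2d] := dom 0 I0; have [_ geoeq] := s4 i (tau 0) t1d t2d.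
exists (t2 / t1) => a.
have v0E : v0 = t1 *: derive1 y (tau 0) by rewrite -vv0 vE.
have yx0 : y (tau 0) = x0 by rewrite -xy.
have h3 : derive1n 2 y (tau 0) a 0 + \sum_b \sum_c christoffel (g' i) x0 a b c
    * derive1 y (tau 0) b 0 * derive1 y (tau 0) c 0 = 0.
  by rewrite -yx0; exact: geoeq.
have h1 : accel (christoffel (g i)) x0 v0 a 0 = - \sum_b \sum_c christoffel (g i) x0 a b c
   * (t1 *: derive1 y (tau 0)) b 0 * (t1 *: derive1 y (tau 0)) c 0.
  by rewrite mxE -v0E.
have := proj_accel_alg t10 h1 (acc a) h3; rewrite -v0E => ->.
by rewrite v0E [X in _ = _ * X]mxE.
Qed.

Lemma projective_relation : projectively_related (levi_civita g) (levi_civita g') ->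
  forall i x a b c, cimg i x ->
  christoffel (g' i) x a b c = christoffel (g i) x a b c
   + (a == b)%:R * (2^-1 * (christoffel (g' i) x c c c - christoffel (g i) x c c c))
   + (a == c)%:R * (2^-1 * (christoffel (g' i) x b b b - christoffel (g i) x b b b)).
Proof.
move=> proj i x a b c Ox.
have sym (h : lorentz_metric A) p q r :
    christoffel (h i) x p q r = christoffel (h i) x p r q.
  exact: (christoffel_sym (@open_cimg _ _ _ i) (@gcomp_sym _ _ _ h i) _ _ _ Ox).
pose T a b c := christoffel (g' i) x a b c - christoffel (g i) x a b c.
have H : T a b c = (a == b)%:R * (2^-1 * T c c c) + (a == c)%:R * (2^-1 * T b b b).
  apply: proj_tensor_alg => [p q r|v vn]; first by rewrite /T (sym g') (sym g).
  exact: projective_direction.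
by rewrite -addrA -H addrC subrK.
Qed.

End Geodesics.

(** * Vanishing of the projective covector *)

Section ProjectiveCovector.
Context {R : realType} {M : topologicalType} {A : atlas R M}.
Variables g g' : lorentz_metric A.
Implicit Types (i j : chart A).

Lemma curvature_range_curv i x F :
  curvature_range g i x F -> in_curv_range (g i) x F.
Proof.
case=> Phi [_ ->]; exists Phi; apply/matrixP => a b.
rewrite [LHS]mxE summxE; apply: eq_bigr => c _; rewrite summxE; apply: eq_bigr => d _.
rewrite [RHS]mxE mulrC; congr (_ * _); rewrite [RHS]mxE; apply: eq_bigr => e _.
by rewrite [X in _ = X * _]mxE.
Qed.

(** Two non-proportional simple bivectors are what the eigenvalue argument consumes, so ranges of
    dimension 2 and 3 are treated alike. *)
Lemma class_C_pair i p : cdom i p -> curvature_class_C g p ->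
  exists u1 v1 u2 v2 : 'cV[R]_4, [/\ wedge u1 v1 != 0 /\ wedge u2 v2 != 0,
    forall t : R, wedge u2 v2 != t *: wedge u1 v1,
    in_curv_range (g i) (cmap i p) (wedge u1 v1) &
    in_curv_range (g i) (cmap i p) (wedge u2 v2)].
Proof.
move=> ip /(_ i ip)[s [sz fs sp simp _]].
case: s sz fs sp simp => [[]|F2 [[]|F1 s]] // _ fs sp simp.
have [n2 [u2 [v2 E2]]] : simple_bivector F2 by apply: simp; rewrite inE eqxx.
have [n1 [u1 [v1 E1]]] : simple_bivector F1 by apply: simp; rewrite !inE eqxx orbT.
exists u1, v1, u2, v2; rewrite -E1 -E2; split => //.
- move=> t; apply/eqP => h; move: fs; rewrite free_cons => /andP[/negP + _]; apply.
  by rewrite h; apply: memvZ; apply: memv_span; rewrite inE eqxx.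
- by apply/curvature_range_curv/sp/memv_span; rewrite !inE eqxx orbT.
- by apply/curvature_range_curv/sp/memv_span; rewrite inE eqxx.
Qed.

(* The value of psi read off from T^b_bb = 2 psi_b (no summation). *)
Definition proj_covector i x : 'cV[R]_4 :=
  \col_b (2^-1 * (christoffel (g' i) x b b b - christoffel (g i) x b b b)).

Lemma metric_christoffel_smooth (h : lorentz_metric A) i a b c :
  smooth_on (cimg i) (fun x => christoffel (h i) x a b c).
Proof.
exact: (christoffel_smooth (@open_cimg _ _ _ i) (@gcomp_smooth _ _ _ h i)
  (@gcomp_unit _ _ _ h i)).
Qed.

Lemma proj_covector_smooth i b :
  smooth_on (cimg i) (fun x => proj_covector i x b 0).
Proof.
move=> k; have oi := @open_cimg _ _ _ i.
have : Ck k (cimg i)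
    (fun x => 2^-1 * (christoffel (g' i) x b b b + - christoffel (g i) x b b b)).
  apply: (Ck_mul oi); first exact: Ck_cst.
  apply: (Ck_add oi); first exact: metric_christoffel_smooth.
  by apply: (Ck_opp oi); exact: metric_christoffel_smooth.
by apply: (Ck_ext oi) => x _; rewrite mxE.
Qed.

(** The line must also stay in the open set O, later the chart image of [U], so that class C is
    available along it. *)
Lemma coordinate_line_flow i x0 c (O : set 'cV[R]_4) : cimg i x0 -> open O -> O x0 ->
  exists (r : R) (Phi B : R -> 'M[R]_4), [/\ 0 < r, Phi 0 = 1%:M,
    forall u : R, `|u| <= r ->
      cimg i (u *: delta_mx c 0 + x0) /\ O (u *: delta_mx c 0 + x0),
    forall u : R, `|u| <= r -> is_derive u 1 Phi
      (- (conn_mx (christoffel (g i)) c (u *: delta_mx c 0 + x0) *m Phi u)) &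
    forall u, B u *m Phi u = 1%:M].
Proof.
move=> ix oO Ox.
have [|r [K [r0 K0 hK]]] := @local_bound R (cimg i `&` O) x0 ('I_4 * 'I_4)%type
  (fun ab y => conn_mx (christoffel (g i)) c y ab.1 ab.2)
  (openI (@open_cimg _ _ _ i) oO) (conj ix Ox).
  move=> [a b] /=.
  by have /continuous_mxP /(_ a b) := @conn_continuous _ _ _ g i x0 c ix.
pose r' := r / 2.
have r'0 : 0 < r' by rewrite divr_gt0.
have inball u : `|u| <= r' -> `|u *: delta_mx c 0 + x0 - x0| < r.
  move=> ur; rewrite addrK; apply: mx_norm_lt => // a b; rewrite !mxE.
  have ur' : `|u| < r by rewrite (le_lt_trans ur)// /r' ltr_pdivrMr// ltr_pMr// ltr1n.
  by case: (_ && _); rewrite ?mulr1// mulr0 normr0.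
have [||[Phi B] /= [Phi0 _ dPhi _ BPhi]] := @line_flow _ _ _ g i x0 c r' K (ltW r'0) K0.
- by move=> u /inball /hK[[]].
- move=> u /inball /hK[_ h]; apply: mx_norm_leP => // a b.
  exact: (h (a, b)).
exists r', Phi, B; split => //.
by move=> u /inball /hK[].
Qed.

Lemma unit_mul_neq0 (P Q : 'M[R]_4) (w : 'cV[R]_4) :
  Q *m P = 1%:M -> w != 0 -> P *m w != 0.
Proof.
move=> QP w0; apply: contraNneq w0 => h.
by rewrite -[w]mul1mx -QP -mulmxA h mulmx0.
Qed.

Hypothesis connM : connected [set: M].
Hypothesis projgg' : projectively_related (levi_civita g) (levi_civita g').
Hypothesis hol : holonomy_R10 g \/ holonomy_R11 g \/ holonomy_R13 g.
Variable U : set M.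
Hypothesis oU : open U.
Hypothesis CU : forall p, U p -> curvature_class_C g p.

Lemma proj_covector_eq0 i p : cdom i p -> U p -> proj_covector i (cmap i p) = 0.
Proof.
move=> ip Up.
have rel x : cimg i x -> forall a b c, christoffel (g' i) x a b c =
    christoffel (g i) x a b c + (a == b)%:R * proj_covector i x c 0
    + (a == c)%:R * proj_covector i x b 0.
  by move=> ix a b c; rewrite [X in _ + _ * X + _]mxE [X in _ + _ + _ * X]mxE;
    exact: projective_relation.
have oi := @open_cimg _ _ _ i.
have sG := @gcomp_smooth _ _ _ g i; have sG' := @gcomp_smooth _ _ _ g' i.
have symG := @gcomp_sym _ _ _ g i; have symG' := @gcomp_sym _ _ _ g' i.
have uG := @gcomp_unit _ _ _ g i; have uG' := @gcomp_unit _ _ _ g' i.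
have spsi := @proj_covector_smooth i.
have [i0 [m [w [im w0 hw]]]] := holonomy_annihilated hol.
(* Stated for an arbitrary transport P, this applies both at p and at nearby points of a coordinate
   line, reached by prolonging the path to p along that line. *)
have eig q P Q : cdom i q -> U q -> bitransport g i0 m i q P Q ->
    exists a : R, forall z, dotv (g i (cmap i q) *m (P *m w)) z = 0 ->
      g' i (cmap i q) *m z = a *: (g i (cmap i q) *m z).
  move=> iq Uq PQ; have kill := holonomy_kills_curvature iq PQ hw.
  have [u1 [v1 [u2 [v2 [[n1 n2] ind r1 r2]]]]] := class_C_pair iq (CU Uq).
  have [_ _ QP] := PQ.
  exact: (class_C_eigen_proj oi sG symG uG sG' symG' uG' spsi rel (cimg_cmap iq)
    (unit_mul_neq0 QP w0) kill n1 n2 ind r1 r2).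
have [P [Q PQ]] := @reachable _ _ _ g m i0 connM im p i ip.
have [_ _ QP] := PQ.
pose x0 := cmap i p; have ix0 : cimg i x0 := cimg_cmap ip.
have [a ea] := eig p P Q ip Up PQ.
apply: (local_covector_eq0 oi sG symG uG sG' symG' uG' rel ix0 (unit_mul_neq0 QP w0) ea).
move=> c.
have oUi := @open_chart_image _ _ _ i U oU.
have Ux0 : (cmap i @` (cdom i `&` U)) x0 by exists p.
have [r [Phi [B [r0 Phi0 hO dPhi BPhi]]]] := @coordinate_line_flow i x0 c _ ix0 oUi Ux0.
have z0 : (0 : R) *: delta_mx c 0 + x0 = x0 by rewrite scale0r add0r.
have n0 : `|0 : R| <= r by rewrite normr0 ltW.
exists (fun t => Phi t *m (P *m w)); split; first by rewrite Phi0 mul1mx.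
  have := is_derive_mulmx (dPhi 0 n0) (is_derive_cst (P *m w) (0 : R) (1 : R)).
  by rewrite z0 mulmx0 addr0 Phi0 mulmx1 mulNmx.
have nr : \forall t \near (0 : R), `|t| <= r.
  by apply/nbhs_normP; exists r => // t /=; rewrite sub0r normrN => /ltW.
apply: filterS nr => t tr.
have hi u : `|u| <= r -> cimg i (u *: delta_mx c 0 + x0) by move=> /hO[].
have L := bitransport_line hi dPhi BPhi n0 tr.
have [_ [q [iq Uq] qE]] := hO t tr.
rewrite z0 /x0 cmapK// -/x0 -qE cmapK// in L.
have := eig q _ _ iq Uq (bitransport_comp PQ L).
have B0 : B 0 = 1%:M by have := BPhi 0; rewrite Phi0 mulmx1.
by rewrite qE B0 mulmx1 -(mulmxA _ P).
Qed.

Hypothesis dU : dense U.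

Lemma projective_same_connection :
  same_connection (levi_civita g) (levi_civita g').
Proof.
move=> i p ip a b c.
pose D y := christoffel (g' i) y a b c - christoffel (g i) y a b c.
suff D0 : D (cmap i p) = 0 by apply/esym/eqP; rewrite -subr_eq0; apply/eqP.
have DU q : cdom i q -> U q -> D (cmap i q) = 0.
  move=> iq Uq; have h := proj_covector_eq0 iq Uq.
  have hb d : 2^-1 * (christoffel (g' i) (cmap i q) d d d
      - christoffel (g i) (cmap i q) d d d) = 0.
    by have /matrixP /(_ d 0) := h; rewrite !mxE.
  by rewrite /D (projective_relation projgg' a b c (cimg_cmap iq)) !hb !mulr0 !addr0 subrr.
have cD : {for p, continuous (fun q => D (cmap i q))}.
  apply: continuous_comp; first exact: cmap_continuous.
  apply: continuousB.
    exact: (Ck_continuous (metric_christoffel_smooth g' i a b c 0%N) (cimg_cmap ip)).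
  exact: (Ck_continuous (metric_christoffel_smooth g i a b c 0%N) (cimg_cmap ip)).
apply: contrapT => /eqP Dn.
have e0 : 0 < `|D (cmap i p)| by rewrite normr_gt0.
have /cvgrPdist_lt /(_ _ e0) h := cD.
have : nbhs p (cdom i `&` [set q | `|D (cmap i p) - D (cmap i q)| < `|D (cmap i p)|]).
  by apply: filterI => //; apply: open_nbhs_nbhs; split => //; exact: cdom_open.
rewrite nbhsE => -[V [oV Vp] Vs].
have [q [Vq Uq]] := dU (ex_intro _ p Vp) oV.
have [iq] := Vs q Vq.
by rewrite /= (DU q iq Uq) subr0 ltxx.
Qed.

End ProjectiveCovector.

Theorem theorem6p3 (R : realType) (M : topologicalType) (A : atlas R M)
    (hausdorffM : hausdorff_space M) (connectedM : connected [set: M])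
    (g g' : lorentz_metric A)
    (nonflat_g : non_flat g)
    (holonomy_g : holonomy_R10 g \/ holonomy_R11 g \/ holonomy_R13 g)
    (U : set M) (openU : open U) (denseU : dense U)
    (classC_g : forall p, U p -> curvature_class_C g p)
    (proj_gg' : projectively_related (levi_civita g) (levi_civita g')) :
  same_connection (levi_civita g) (levi_civita g').
Proof.
exact: (projective_same_connection connectedM proj_gg' holonomy_g openU classC_g denseU).
Qed.
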